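(* Fix real numbers $0<x_{\min}<x_{\max}$, $a\ge x_{\max}-x_{\min}$, $b\ge 1$ and $\varepsilon\in(0,1/2)$. Then there is a constant $c>0$ depending only on $\varepsilon,x_{\max},x_{\min}$ with the following property. Let $m=m_n\ge1$, $L=L_n\ge1$, $k=k_n\ge1$ be sequences of integers and $\sigma_z=\sigma_{z,n}\ge0$ a sequence of reals, indexed by $n\in\mathbb N$, such that $\log m=\Theta(\log n)$, $\log L=O(\log n)$, $k\le n^{1-2\varepsilon}$ and $$\max(\sigma_z^4,m^2,n^2)\,k\log n\le m^2n^{1-\varepsilon}L .$$ Suppose that $A_1=\dots=A_L=A\in\mathbb R^{m\times n}$, where $A$ has i.i.d. $N(0,1)$ entries. Then for all sufficiently large $n$, $$\sup_{\mathcal C\in\mathcal F_{a,b,k,n}}R_2^{\dagger}(\mathcal C,m,n,\sigma_z)\ \ge\ c\,\frac{\max(\sigma_z^4,m^2,n^2)\,k\log n}{m^2nL}.$$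
   Context: Model (fixed forward operator): $\boldsymbol x_o\in\mathbb R^n$ is an unknown vector and $X_o=\mathrm{diag}(\boldsymbol x_o)$. One observes $\boldsymbol y_l=AX_o\boldsymbol w_l+\boldsymbol z_l\in\mathbb R^m$ for $l=1,\dots,L$, with the same matrix $A$ in all looks, where $\boldsymbol w_1,\dots,\boldsymbol w_L$ are i.i.d. $N(0,I_n)$, $\boldsymbol z_1,\dots,\boldsymbol z_L$ are i.i.d. $N(0,\sigma_z^2I_m)$, and $A$, $(\boldsymbol w_l)$, $(\boldsymbol z_l)$ are mutually independent. The matrix $A$ is known to the estimator. Minimax risk: $R_2^{\dagger}(\mathcal C,m,n,\sigma_z)=\inf_{\hat{\boldsymbol x}}\sup_{\boldsymbol x_o\in\mathcal C}\mathbb E\left[\|\hat{\boldsymbol x}-\boldsymbol x_o\|_2^2/n\right]$, where the infimum is over all measurable estimators $\hat{\boldsymbol x}$ that are functions of $\boldsymbol y_1,\dots,\boldsymbol y_L$ and $A$, and the expectation is over all the randomness (including $A$). The dependence on $L$ is suppressed in the notation. Signal classes: for $\mathcal C\subset\mathbb R^n$, $N_\eta(\mathcal C)$ denotes the $\eta$-covering number, i.e. the least number of $\ell_2$-balls of radius $\eta$ covering $\mathcal C$. $\mathcal F_{a,b,k,n}$ denotes the collection of all nonempty subsets $\mathcal C\subset[x_{\min},x_{\max}]^n$ such that $N_\eta(\mathcal C)\le (an^b/\eta)^k$ for every $0<\eta\le an^b$. Asymptotic notation: $a_n=O(b_n)$ means there exist $C,M>0$ with $|a_n|\le C|b_n|$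 for all $n>M$; $a_n=\Theta(b_n)$ means $a_n=O(b_n)$ and $b_n=O(a_n)$. *)

(* Defs.v *)
From HB Require Import structures.
From mathcomp Require Import all_boot all_order all_algebra.
From mathcomp Require Import all_classical all_reals all_analysis.
Set Implicit Arguments.
Unset Strict Implicit.
Unset Printing Implicit Defensive.
Import Order.TTheory GRing.Theory Num.Theory.
Import numFieldNormedType.Exports.
Local Open Scope classical_set_scope.
Local Open Scope ring_scope.

(* 'M[T]_(m, n) carries the product sigma-algebra, i.e. the one generated by
   the entries, exactly as the library does for n.-tuple T. *)
Definition measure_matrix_display : measure_display -> measure_display.
Proof. exact. Qed.

Definition matrix_sigma_algebra d (T : measurableType d) (m n : nat) :
    set (set 'M[T]_(m, n)) :=
  <<s \bigcup_(ij in [set: 'I_m * 'I_n])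
        preimage_set_system setT (fun M : 'M[T]_(m, n) => M ij.1 ij.2)
          measurable >>.

Section measurable_matrix.
Context {d} {T : measurableType d}.
Variables m n : nat.

Let matrix_set0 : @matrix_sigma_algebra d T m n set0.
Proof. exact: sigma_algebra0. Qed.

Let matrix_setC A :
  @matrix_sigma_algebra d T m n A -> @matrix_sigma_algebra d T m n (~` A).
Proof. exact: sigma_algebraC. Qed.

Let matrix_bigcup (F : _^nat) :
  (forall i, @matrix_sigma_algebra d T m n (F i)) ->
  @matrix_sigma_algebra d T m n (\bigcup_i (F i)).
Proof. exact: sigma_algebra_bigcup. Qed.

HB.instance Definition _ := @isMeasurable.Build (measure_matrix_display d)
  'M[T]_(m, n) (@matrix_sigma_algebra d T m n)
  matrix_set0 matrix_setC matrix_bigcup.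

End measurable_matrix.

Section probability_notions.
Context d (T : measurableType d) (R : realType) (P : probability T R).

Definition has_law (X : T -> R) (mu : set R -> \bar R) : Prop :=
  measurable_fun setT X /\
  forall B : set R, measurable B -> pushforward P X B = mu B.

Definition mutually_independent (I : finType) (X : I -> T -> R) : Prop :=
  forall (J : {set I}) (B : I -> set R),
    (forall i, i \in J -> measurable (B i)) ->
    P (\bigcap_(i in [set` J]) X i @^-1` B i) =
    (\prod_(i in J) P (X i @^-1` B i))%E.

(* [normal_prob 0 0] is not N(0, 0) in the library: when the standard deviation
   is 0, its density is by convention the indicator of `[0, 1]. *)
Definition centered_gaussian (s : R) : set R -> \bar R :=
  if s == 0 then \d_(0 : R) else normal_prob 0 s.

End probability_notions.

Section model.
Context d (T : measurableType d) (R : realType) (P : probability T R).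
Variables (m n L : nat).
Variables (A : T -> 'M[R]_(m, n)) (w : 'I_L -> T -> 'cV[R]_n)
          (z : 'I_L -> T -> 'cV[R]_m).

Definition noise_index := ('I_m * 'I_n + ('I_L * 'I_n + 'I_L * 'I_m))%type.

Definition scalar_noise (q : noise_index) : T -> R :=
  match q with
  | inl ij => fun t => A t ij.1 ij.2
  | inr (inl lj) => fun t => w lj.1 t lj.2 0
  | inr (inr li) => fun t => z li.1 t li.2 0
  end.

(* A has i.i.d. N(0, 1) entries, the w_l are i.i.d. N(0, I_n), the z_l are
   i.i.d. N(0, sigma ^ 2 I_m), and A, (w_l), (z_l) are mutually independent:
   equivalently, all scalar coordinates are mutually independent centered
   Gaussians with these variances. *)
Definition gaussian_model (sigma : R) : Prop :=
  [/\ forall i j, has_law P (fun t => A t i j) (centered_gaussian 1),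
      forall l j, has_law P (fun t => w l t j 0) (centered_gaussian 1),
      forall l i, has_law P (fun t => z l t i 0) (centered_gaussian sigma)
    & mutually_independent P scalar_noise].

Definition look (x : 'rV[R]_n) (l : 'I_L) (t : T) : 'cV[R]_m :=
  A t *m diag_mx x *m w l t + z l t.

Definition observation (x : 'rV[R]_n) (t : T) :
    'M[R]_(m, n) * L.-tuple 'cV[R]_m :=
  (A t, [tuple look x l t | l < L]).

Definition sq_dist2 (x y : 'rV[R]_n) : R := \sum_j (x 0 j - y 0 j) ^+ 2.

Definition minimax_risk (C : set 'rV[R]_n) : \bar R :=
  ereal_inf
    [set ereal_sup
       [set 'E_P[fun t => (sq_dist2 (xhat (observation x t)) x / n%:R)%R]%E
       | x in C]
    | xhat in [set f : 'M[R]_(m, n) * L.-tuple 'cV[R]_m -> 'rV[R]_n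
              | measurable_fun [set: 'M[R]_(m, n) * L.-tuple 'cV[R]_m] f]].

End model.

Section signal_classes.
Context (R : realType) (n : nat).
Implicit Types C : set 'rV[R]_n.

(* Closed Euclidean ball; the library's balls of 'rV[R]_n are those of the sup
   norm. *)
Definition l2_ball (x : 'rV[R]_n) (r : R) : set 'rV[R]_n :=
  [set y | Num.sqrt (sq_dist2 y x) <= r].

(* The least number of balls, as an element of \bar R (+oo if there is no finite
   cover); the centres need not belong to C. *)
Definition covering_number (eta : R) C : \bar R :=
  ereal_inf [set N%:R%:E | N in
    [set N : nat | exists x : 'I_N -> 'rV[R]_n,
       C `<=` \bigcup_(i in [set: 'I_N]) l2_ball (x i) eta]].

Definition signal_class (xmin xmax a b : R) (k : nat) : set (set 'rV[R]_n) :=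
  [set C : set 'rV[R]_n | [/\ C !=set0,
      C `<=` [set x : 'rV[R]_n | forall j, xmin <= x 0 j <= xmax]
    & forall eta : R, 0 < eta <= a * n%:R `^ b ->
        (covering_number eta C <= ((a * n%:R `^ b / eta) ^+ k)%:E)%E]].

End signal_classes.

(* Main.v *)
Require Import Defs.
From HB Require Import structures.
From mathcomp Require Import all_boot all_order all_algebra.
From mathcomp Require Import all_classical all_reals all_analysis.
From mathcomp Require Import measurable_realfun.
From mathcomp Require Import complex.
From mathcomp Require Import ring lra.
Import Order.TTheory GRing.Theory Num.Theory.
Import numFieldNormedType.Exports.
Local Open Scope classical_set_scope.
Local Open Scope ring_scope.

(** The bound is proved by testing the estimator on a finite code of signals.
    Let x0 ^ 2 be the middle of [xmin ^ 2, xmax ^ 2]. The codewords have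
    coordinates x0 sqrt (1 + dl v_j) for sign vectors v, with dl ^ 2 proportional
    to the claimed rate. If the sign vectors of the code differ in more than a
    quarter of their places, the codewords are at squared distance at least
    n (x0 dl) ^ 2 / 4, and an estimator with a smaller risk than c dl ^ 2 would
    identify the codeword with probability more than 1/2 ([code_risk]). This has
    to be contradicted.

    Given A, a look is a Gaussian vector whose covariance is B B^T at the constant
    signal x0 (1, ..., 1), where B = [x0 A, sigma 1]. At a codeword the covariance
    is B (1 + J) B^T, where J is diagonal, with entries dl v_j on the speckle
    coordinates and 0 on the noise coordinates. As the orthogonal projection P on
    the row space of B satisfies B P = B, one may replace J by K = P J P
    ([signal_mx_cov]). Diagonalizing K and computing one-dimensional integrals
    bounds the second moment of the likelihood ratio of the L looks by
    e ^ (L tr K ^ 2), and the probability that v is decoded from x_v by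
    t / 2 times the probability that v is decoded from the constant signal plus
    e ^ (L tr K ^ 2) / (2 t), for every t > 0 ([gaussian_second_moment]). The
    probabilities under the constant signal sum to at most 1 over the code. With
    t a quarter of the number N of codewords, the average probability of a correct
    decoding is thus small as soon as L tr K ^ 2 is less than log (N / 16) with
    high probability ([obs_prob_compare]).

    It remains to bound tr K ^ 2. Averaged over all sign vectors, it is
    dl ^ 2 times the sum of H_ii ^ 2, where H is the block of P on the speckle
    coordinates ([sum_cov_shift_trace]). The expectation of H_ii ^ 2 is at most a
    constant times m ^ 2 / max (sigma ^ 4, m ^ 2, n ^ 2) ([hat_diag_moment]) for
    three reasons: H_ii <= 1 because P is a projection; H_ii <= x0 ^ 2 |a_i| ^ 2 /
    sigma ^ 2, with a_i the i-th column of A; and tr H <= m. The last one concerns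
    the mean of the H_ii only, but the law of A is invariant under rotations, so
    that the second moment of q H q^T depends on |q| alone. Summing it over all
    q = e_i + e_j and q = e_i - e_j relates the second moment of H_ii to those of
    tr H and of the Hilbert-Schmidt norm of H, and gives the bound 3 (m / n) ^ 2.

    By the Markov inequality half of the sign vectors have a trace of at most
    twice the average. This half is large enough to contain a greedily built code
    with N = t ^ k words, t the integer part of sqrt n, because N is e ^ o(n) and
    2 ^ (7/4) > 3 ([good_code], [code_size]). Any set of at most n ^ (k / 2) signals
    in the box belongs to the class, at scales below a sqrt n by covering it
    point by point and above by a single ball ([finite_signal_class]). Finally
    log N is of order k log n, while L times the average trace is a small multiple
    of k log n by the choice of dl; the growth condition on k, m and L keeps dl
    small.

    Rotation invariance of the Gaussian law itself is obtained by induction over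
    plane rotations ([orthogonal_ind]), and the reduction of an equality of Gram
    matrices C C^T = D D^T to C U = D with U orthogonal ([gram_orthogonal]) allows
    Gaussian laws to be compared through their covariances, even singular ones. *)

(** * Orthogonal matrices *)

Section orthogonal.
Variable R : rcfType.

Definition rot2 p (c s : R) : 'M[R]_(1 + (1 + p)) :=
  block_mx c%:M (row_mx (- s)%:M 0)
           (col_mx s%:M 0) (block_mx c%:M 0 0 1%:M).

Lemma mul_rot2 p (c s a b : R) (z : 'rV[R]_p) :
  row_mx a%:M (row_mx b%:M z) *m rot2 p c s =
  row_mx (a * c + b * s)%:M (row_mx (b * c - a * s)%:M z).
Proof.
rewrite /rot2 mul_row_block mul_row_col mulmx0 addr0 -!scalar_mxM.
rewrite mul_mx_row mul_row_block !mulmx0 mulmx1 !addr0 add0r -!scalar_mxM.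
rewrite add_row_mx add0r -!raddfD /=.
by rewrite mulrN [- (a * s) + _]addrC.
Qed.

Lemma rot2_orthogonal p (c s : R) : c ^+ 2 + s ^+ 2 = 1 ->
  rot2 p c s *m (rot2 p c s)^T = 1%:M.
Proof.
move=> cs; rewrite /rot2 tr_block_mx tr_row_mx tr_col_mx tr_block_mx.
rewrite !trmx0 !tr_scalar_mx mulmx_block mul_row_col mul_mx_row mul_col_row.
rewrite mulmx_block !mulmx0 !mul0mx !addr0 !add0r -!scalar_mxM.
rewrite mul_col_mx mul_row_block mul_block_col.
rewrite !mulmx0 ?mul0mx ?mulmx1 !addr0 -!scalar_mxM mulr1.
rewrite add_row_mx add_block_mx add_col_mx !addr0 !add0r -!raddfD /=.
have -> : c * c + - s * - s = 1 by rewrite -cs; ring.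
have -> : s * s + c * c = 1 by rewrite -cs; ring.
have -> : c * s + - s * c = 0 by ring.
have -> : s * c + c * - s = 0 by ring.
by rewrite !raddf0 row_mx0 col_mx0 -!scalar_mx_block.
Qed.

Section generation.
Variable G : forall p, 'M[R]_p -> Prop.
Hypothesis G1 : forall p, G p 1%:M.
Hypothesis GM : forall p (U V : 'M[R]_p), G p U -> G p V -> G p (U *m V).
Hypothesis GT : forall p (U : 'M[R]_p), U *m U^T = 1%:M -> G p U -> G p U^T.
Hypothesis Gblock : forall p (U : 'M[R]_p),
  G p U -> G (1 + p)%N (block_mx 1%:M 0 0 U).
Hypothesis GN : G 1%N (- 1%:M).
Hypothesis Grot : forall p (c s : R), c != 0 -> c ^+ 2 + s ^+ 2 = 1 ->
  G (1 + (1 + p))%N (rot2 p c s).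

(** The orthogonal matrices with property G; for a trivial G, all of them. *)
Definition rotation p (U : 'M[R]_p) := G p U /\ U *m U^T = 1%:M.

Let orthoM p (U V : 'M[R]_p) : rotation p U -> rotation p V -> rotation p (U *m V).
Proof.
move=> [GU UU] [GV VV]; split; first exact: GM.
by rewrite trmx_mul mulmxA -(mulmxA U) VV mulmx1.
Qed.

Let orthoT p (U : 'M[R]_p) : rotation p U -> rotation p U^T.
Proof.
move=> [GU UU]; split; first exact: GT.
by rewrite trmxK; apply: mulmx1C.
Qed.

Let ortho_block p (U : 'M[R]_p) : rotation p U ->
  rotation (1 + p)%N (block_mx 1%:M 0 0 U).
Proof.
move=> [GU UU]; split; first exact: Gblock.
rewrite tr_block_mx !trmx0 trmx1 mulmx_block !mulmx0 !mul0mx mulmx1 UU.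
by rewrite !addr0 ?add0r -scalar_mx_block.
Qed.

Let scalar_mx11 (A : 'M[R]_1) : A = (A 0 0)%:M.
Proof. exact: mx11_scalar. Qed.

(* Rotating two coordinates moves all their mass onto the first one; a first
   turn by 45 degrees ensures that the second turn has a nonzero cosine. *)
Let to_axis2 p (a b : R) (z : 'rV[R]_p) : exists2 U, rotation (1 + (1 + p))%N U &
  exists2 r, 0 <= r &
  row_mx a%:M (row_mx b%:M z) *m U = row_mx r%:M (row_mx 0 z).
Proof.
wlog a0 : a b / a != 0 => [hw|].
  have [a0|] := eqVneq a 0; last by move=> /hw; apply.
  have [b0|b0] := eqVneq b 0.
    exists 1%:M; first by split=> //; rewrite trmx1 mulmx1.
    by exists 0 => //; rewrite mulmx1 a0 b0 !raddf0.
  pose h : R := Num.sqrt 2^-1.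
  have hh : h ^+ 2 = 2^-1 by rewrite sqr_sqrtr// invr_ge0 ler0n.
  have h0 : h != 0 by rewrite sqrtr_eq0 -ltNge invr_gt0 ltr0n.
  have hs : h ^+ 2 + h ^+ 2 = 1 by rewrite hh; field.
  have [|U oU [r r0 Ur]] := hw (a * h + b * h) (b * h - a * h).
    by rewrite a0 mul0r add0r mulf_neq0.
  exists (rot2 p h h *m U); last by exists r => //; rewrite mulmxA mul_rot2.
  by apply: orthoM => //; split; [exact: Grot|exact: rot2_orthogonal].
pose r := Num.sqrt (a ^+ 2 + b ^+ 2).
have r2 : r ^+ 2 = a ^+ 2 + b ^+ 2 by rewrite sqr_sqrtr// addr_ge0// sqr_ge0.
have r0 : r != 0.
  by rewrite sqrtr_eq0 -ltNge ltr_wpDr ?sqr_ge0// exprn_even_gt0.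
have cs : (a / r) ^+ 2 + (b / r) ^+ 2 = 1.
  by rewrite !expr_div_n -mulrDl r2 divff// -r2 expf_neq0.
exists (rot2 p (a / r) (b / r)).
  split; last exact: rot2_orthogonal.
  by apply: Grot => //; rewrite mulf_neq0 ?invr_eq0.
exists r; first exact: sqrtr_ge0.
rewrite mul_rot2; congr (row_mx _%:M (row_mx _ z)).
  by rewrite !mulrA -mulrDl -!expr2 -r2 expr2 mulfK.
have -> : b * (a / r) - a * (b / r) = 0 by ring.
by rewrite raddf0.
Qed.

Lemma rotate_to_axis p (v : 'rV[R]_(1 + p)) : exists2 U, rotation (1 + p)%N U &
  exists2 r, 0 <= r & v *m U = row_mx r%:M 0.
Proof.
elim: p v => [|p IH] v.
  have vE : v = row_mx (v 0 0)%:M 0.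
    by apply/rowP => j; rewrite !mxE (ord1 j); case: splitP => // k; rewrite (ord1 k) mxE eqxx.
  have [v0|v0] := leP 0 (v 0 0).
    exists 1%:M; first by split=> //; rewrite trmx1 mulmx1.
    by exists (v 0 0) => //; rewrite mulmx1.
  exists (- 1%:M); first by split=> //; rewrite linearN /= trmx1 mulNmx mulmxN opprK mulmx1.
  exists (- v 0 0); first by rewrite oppr_ge0 ltW.
  rewrite mulmxN mulmx1 {1}vE raddfN /=.
  by apply/rowP => j; rewrite !mxE; case: splitP => // k; rewrite !mxE ?oppr0.
rewrite -[v]hsubmxK; have [U oU [r r0 Ur]] := IH (rsubmx v).
rewrite [lsubmx v]scalar_mx11.
have [V oV [t t0 Vt]] := to_axis2 p (lsubmx v 0 0) r 0.
exists (block_mx 1%:M 0 0 U *m V); first by apply: orthoM => //; exact: ortho_block.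
exists t => //; rewrite mulmxA mul_row_block !mulmx0 mulmx1 addr0 add0r Ur.
by rewrite Vt row_mx0.
Qed.

(** Two families of vectors with equal Gram matrices differ by an orthogonal
    matrix: turn both first vectors onto the first axis. If they are nonzero,
    the remaining vectors have equal first coordinates and this coordinate
    splits off; otherwise the first vectors drop out. *)
Lemma gram_rotation r p (C D : 'M[R]_(r, p)) : C *m C^T = D *m D^T ->
  exists2 U, rotation p U & C *m U = D.
Proof.
elim: r p C D => [|r IH] p C D CD.
  exists 1%:M; first by split=> //; rewrite trmx1 mulmx1.
  by rewrite mulmx1 [C]flatmx0 [D]flatmx0.
case: p C D CD => [|p] C D CD.
  exists 1%:M; first by split=> //; rewrite trmx1 mulmx1.
  by rewrite mulmx1 [C]thinmx0 [D]thinmx0.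
rewrite -[C](@vsubmxK _ 1 r p.+1) -[D](@vsubmxK _ 1 r p.+1) in CD *.
move: (@usubmx _ 1 r _ C) (@dsubmx _ 1 r _ C) (@usubmx _ 1 r _ D) (@dsubmx _ 1 r _ D) CD.
move=> c C1 d D1 CD {C D}.
have [U oU [a a0 Ua]] := rotate_to_axis p c; have [V oV [b b0 Vb]] := rotate_to_axis p d.
have orthoK (W : 'M[R]_(1 + p)) k (M : 'M[R]_(k, 1 + p)) : rotation (1 + p) W -> M *m W *m W^T = M.
  by move=> [_ WW]; rewrite -mulmxA WW mulmx1.
have gram (W : 'M[R]_(1 + p)) k l (M : 'M[R]_(k, 1 + p)) (N : 'M[R]_(l, 1 + p)) :
    rotation (1 + p) W -> M *m W *m (N *m W)^T = M *m N^T.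
  by move=> oW; rewrite trmx_mul mulmxA orthoK.
move: CD; rewrite (@tr_col_mx _ 1 r _ c) (@tr_col_mx _ 1 r _ d).
rewrite (@mul_col_row _ 1 r p.+1 1 r c) (@mul_col_row _ 1 r p.+1 1 r d).
move=> /(@eq_block_mx _ 1 r 1 r)[cc cC _ CC].
have ab : a = b.
  have : a ^+ 2 = b ^+ 2.
    move: cc; rewrite -(gram U _ _ _ _ oU) -(gram V _ _ d d oV) Ua Vb.
    rewrite !tr_row_mx !tr_scalar_mx !trmx0 !mul_row_col !mulmx0 !addr0 -!scalar_mxM.
    by move=> /matrixP/(_ 0 0); rewrite !mxE !eqxx !mulr1n -!expr2.
  by move=> /eqP; rewrite eqrXn2// => /eqP.
suff [W oW WE] : exists2 W, rotation (1 + p)%N W &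
    col_mx (row_mx a%:M 0) (C1 *m U) *m W = col_mx (row_mx a%:M 0) (D1 *m V).
  exists (U *m W *m V^T); first by apply: orthoM; [exact: orthoM|exact: orthoT].
  have := congr1 (mulmx^~ V^T) WE; rewrite /= -{1}Ua ab -Vb -!mul_col_mx orthoK// => <-.
  by rewrite !mulmxA.
have {cC} cC : row_mx a%:M 0 *m (C1 *m U)^T = row_mx a%:M 0 *m (D1 *m V)^T.
  by rewrite -{1}Ua ab -Vb !gram.
have {CC} CC : (C1 *m U) *m (C1 *m U)^T = (D1 *m V) *m (D1 *m V)^T by rewrite !gram.
move: (C1 *m U) (D1 *m V) cC CC => {gram orthoK cc Ua Vb} C2 D2 cC CC.
have [a00|a00] := eqVneq a 0.
  have [W oW WE] := IH _ C2 D2 CC; exists W => //.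
  by rewrite a00 raddf0 row_mx0 mul_col_mx mul0mx WE.
move: cC CC; rewrite -[C2]hsubmxK -[D2]hsubmxK.
move: (lsubmx C2) (rsubmx C2) (lsubmx D2) (rsubmx D2) => x E y F.
rewrite !tr_row_mx !mul_row_col !mul0mx !addr0 !mul_scalar_mx => /(scalerI a00).
move=> /(congr1 trmx); rewrite !trmxK => <- /addrI EF.
have [W oW WE] := IH _ E F EF; exists (block_mx 1%:M 0 0 W); first exact: ortho_block.
rewrite mul_col_mx !mul_row_block !mulmx0 !mul0mx !mulmx1 !addr0 !add0r.
by rewrite WE.
Qed.

(** It follows from the previous lemma for the families of the rows of 1 and of U.
    This induction principle turns statements about rotations of n-space into
    computations in the plane. *)
Lemma orthogonal_ind p (U : 'M[R]_p) : U *m U^T = 1%:M -> G p U.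
Proof.
move=> UU; have [|V [GV _] <-] := gram_rotation _ _ 1%:M U; last by rewrite mul1mx.
by rewrite trmx1 mulmx1.
Qed.

End generation.

Lemma gram_orthogonal r p (C D : 'M[R]_(r, p)) : C *m C^T = D *m D^T ->
  exists2 U : 'M[R]_p, U *m U^T = 1%:M & C *m U = D.
Proof.
move=> CD; have [U [_ UU] UE] : exists2 U : 'M[R]_p, rotation (fun _ _ => True) _ U & C *m U = D.
  exact: gram_rotation.
by exists U.
Qed.

Lemma orthogonal_to_axis p (v : 'rV[R]_(1 + p)) :
  exists2 U : 'M[R]_(1 + p), U *m U^T = 1%:M & exists2 r, 0 <= r & v *m U = row_mx r%:M 0.
Proof.
have [U [_ UU] UE] : exists2 U : 'M[R]_(1 + p), rotation (fun _ _ => True) _ U &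
    exists2 r, 0 <= r & v *m U = row_mx r%:M 0.
  exact: rotate_to_axis.
by exists U.
Qed.

Local Notation rC := (real_complex R).

(** A complex eigenvalue mu, with eigenvector v, satisfies mu v v^* = v S v^* =
    conj(mu) v v^* and is therefore real; being a root of the characteristic
    polynomial, it has a real eigenvector too. *)
Lemma symmetric_eigenvector p (S : 'M[R]_p.+1) : S^T = S ->
  exists a (v : 'rV[R]_p.+1), v != 0 /\ v *m S = a *: v.
Proof.
move=> ST; pose N : 'M[R[i]]_p.+1 := map_mx rC S.
have [|mu] := @closed_rootP R[i] (char_poly N) _.
  by rewrite size_char_poly.
rewrite -eigenvalue_root_char => /eigenvalueP[v vN v0].
pose q := v *m (map_mx conjc v)^T.
have conjK : map_mx conjc N = N.
  by apply/matrixP => i j; rewrite !mxE; apply/eqP; rewrite eq_complex /= oppr0 !eqxx.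
have NT : N^T = N by rewrite /N map_trmx ST.
have mq : mu *: q = conjc mu *: q.
  rewrite /q (scalemxAl mu) -vN (scalemxAr (conjc mu)) -mulmxA; congr mulmx.
  have -> : N *m (map_mx conjc v)^T = (map_mx conjc (v *m N))^T.
    by rewrite map_mxM trmx_mul conjK NT.
  by rewrite vN map_mxZ linearZ.
have q0 : q != 0.
  apply: contraNneq v0 => /matrixP/(_ 0 0); rewrite !mxE => q0.
  apply/eqP/rowP => j; rewrite mxE; apply/eqP; move/eqP: q0.
  rewrite psumr_eq0 => [/allP/(_ j)|k _]; last by rewrite !mxE mul_conjC_ge0.
  by rewrite mem_index_enum !mxE => /(_ isT); rewrite mul_conjC_eq0.
have {mq} mu_real : mu = rC (complex.Re mu).
  move/eqP: mq; rewrite -subr_eq0 -scalerBl scaler_eq0 (negPf q0) orbF subr_eq0.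
  move=> /eqP; case: mu {vN} => x y [] /eqP; rewrite -subr_eq0 opprK -mulr2n.
  by rewrite mulrn_eq0 /= => /eqP ->.
have : root (char_poly S) (complex.Re mu).
  rewrite -(fmorph_root rC) map_char_poly -[X in root _ X]mu_real -eigenvalue_root_char.
  by apply/eigenvalueP; exists v.
rewrite -eigenvalue_root_char => /eigenvalueP[u uS u0].
by exists (complex.Re mu), u.
Qed.

(** Induction on the dimension: once an eigenvector lies on the first axis, the
    matrix is block diagonal. *)
Lemma symmetric_diagonalization p (S : 'M[R]_p) : S^T = S ->
  exists2 U : 'M[R]_p, U *m U^T = 1%:M & exists d, S = U *m diag_mx d *m U^T.
Proof.
elim: p S => [|p IH] S ST.
  exists 1%:M; first by rewrite trmx1 mulmx1.
  by exists 0; rewrite [LHS]flatmx0 [RHS]flatmx0.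
have [a [v [v0 vS]]] := symmetric_eigenvector _ S ST.
have [U UU [r r0 vU]] := orthogonal_to_axis p v.
have UU' : U^T *m U = 1%:M by apply: mulmx1C.
have rn0 : r != 0.
  apply: contraNneq v0 => r00; rewrite -[v]mulmx1 -UU mulmxA vU r00.
  by rewrite raddf0 row_mx0 mul0mx.
pose T : 'M[R]_(1 + p) := U^T *m S *m U.
have TT : T^T = T by rewrite /T !trmx_mul trmxK ST mulmxA.
have eT : row_mx r%:M 0 *m T = a *: row_mx r%:M 0 :> 'rV[R]_(1 + p).
  by rewrite -vU /T !mulmxA -(mulmxA v U) UU mulmx1 vS scalemxAl.
have [T' T'T TE] : exists2 T' : 'M[R]_p, T'^T = T' & T = block_mx a%:M 0 0 T'.
  move: TT eT; rewrite -[T]submxK.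
  move: (ulsubmx T) (ursubmx T) (dlsubmx T) (drsubmx T) => A B C D.
  rewrite tr_block_mx mul_row_block !mul0mx !addr0 !mul_scalar_mx scale_row_mx.
  move=> /eq_block_mx[_ <- _ DT] /eq_row_mx[rA rB].
  exists D => //; congr block_mx.
    by apply: (scalerI rn0); rewrite rA !scale_scalar_mx mulrC.
    by apply: (scalerI rn0); rewrite rB !scaler0.
  have C0 : C^T = 0 by apply: (scalerI rn0); rewrite rB !scaler0.
  by rewrite -[C]trmxK C0 trmx0.
have [V VV [d dE]] := IH T' T'T.
pose W : 'M[R]_(1 + p) := block_mx 1%:M 0 0 V.
have WW : W *m W^T = 1%:M.
  rewrite /W tr_block_mx !trmx0 trmx1 mulmx_block.
  by rewrite !mulmx0 !mul0mx mulmx1 VV !addr0 add0r -scalar_mx_block.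
have TW : T = W *m diag_mx (row_mx a%:M d) *m W^T.
  rewrite TE /W diag_mx_row tr_block_mx !trmx0 trmx1 !mulmx_block.
  rewrite !mulmx0 !mul0mx !mulmx1 !mul1mx !addr0 !add0r -dE.
  have -> : diag_mx a%:M = a%:M :> 'M[R]_1.
    by apply/matrixP => i j; rewrite !ord1 !mxE.
  by rewrite mul0mx.
exists (U *m W); first by rewrite trmx_mul mulmxA -(mulmxA U) WW mulmx1.
exists (row_mx a%:M d).
have -> : S = U *m T *m U^T.
  by rewrite /T !mulmxA UU mul1mx -mulmxA UU mulmx1.
by rewrite TW trmx_mul !mulmxA.
Qed.

End orthogonal.

(** * Measurability of matrix-valued maps *)

Section measurable_matrix.
Context d (T : measurableType d) (m n : nat).

Lemma measurable_mx_coord i j :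
  measurable_fun setT (fun M : 'M[T]_(m, n) => M i j).
Proof.
move=> _ Y mY; apply: sub_sigma_algebra; exists (i, j) => //=.
by exists Y.
Qed.

Lemma measurable_mx d' (U : measurableType d') (f : U -> 'M[T]_(m, n)) :
  (forall i j, measurable_fun setT (fun u => f u i j)) -> measurable_fun setT f.
Proof.
move=> mf; apply: (@measurability _ _ _ _ _ _ (\bigcup_(ij in [set: 'I_m * 'I_n])
  preimage_set_system setT (fun M : 'M[T]_(m, n) => M ij.1 ij.2) measurable)) => //.
move=> _ [_ [[i j] _ [Y mY <-]] <-]; rewrite !setTI.
by have := mf i j measurableT _ mY; rewrite setTI.
Qed.

End measurable_matrix.

Section rectangles.
Context d (T : measurableType d) (R : realType) (m n : nat).

Definition rectangle (B : 'I_m -> 'I_n -> set T) : set 'M[T]_(m, n) :=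
  [set M | forall i j, B i j (M i j)].

Lemma measurable_rectangle B : (forall i j, measurable (B i j)) ->
  measurable (rectangle B).
Proof.
move=> mB; rewrite [rectangle B](_ : _ = \bigcap_(i in [set: 'I_m])
    \bigcap_(j in [set: 'I_n]) (fun M : 'M[T]_(m, n) => M i j) @^-1` B i j).
  apply: fin_bigcap_measurable => [|i _]; first exact: finite_finset.
  apply: fin_bigcap_measurable => [|j _]; first exact: finite_finset.
  by rewrite -[X in measurable X]setTI; exact: measurable_mx_coord.
by apply/seteqP; split=> M /= H i => [_ j _|j]; exact: H.
Qed.

(** Rectangles are stable under intersection and generate the sigma-algebra, so
    two probabilities that agree on them are equal. *)
Lemma eq_measure_rectangle (mu nu : probability 'M[T]_(m, n) R) :
  (forall B, (forall i j, measurable (B i j)) ->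
    mu (rectangle B) = nu (rectangle B)) ->
  forall E, measurable E -> mu E = nu E.
Proof.
move=> H E mE.
pose G := [set E | exists2 B, (forall i j, measurable (B i j)) & E = rectangle B].
apply: (@measure_unique _ R 'M[T]_(m, n) G (fun=> setT)) => //.
- apply/seteqP; split.
    apply: smallest_sub; first exact: smallest_sigma_algebra.
    move=> _ [[i j] _ [Y mY <-]]; apply: sub_sigma_algebra.
    exists (fun k l => if (k == i) && (l == j) then Y else setT).
      by move=> k l; case: ifP.
    apply/seteqP; split=> [M [_ /= MY] k l|M /(_ i j)]; last by rewrite !eqxx.
    by case: ifP => // /andP[/eqP-> /eqP->].
  apply: smallest_sub; first exact: sigma_algebra_measurable.
  by move=> _ [B mB ->]; exact: measurable_rectangle.
- move=> _ _ [B mB ->] [C mC ->]; exists (fun i j => B i j `&` C i j).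
    by move=> i j; exact: measurableI.
  apply/seteqP; split=> [M [MB MC] i j|M MBC]; first by split; [exact: MB|exact: MC].
  by split=> i j; have [] := MBC i j.
- by move=> _; exists (fun _ _ => setT) => //; apply/seteqP; split.
- by rewrite bigcup_const.
- by move=> _ [B mB ->]; exact: H.
- by move=> _; apply: (le_lt_trans (probability_le1 mu measurableT)); rewrite ltry.
Qed.

End rectangles.
Arguments rectangle {d T m n} B.
Arguments measurable_rectangle {d T m n B}.
Arguments eq_measure_rectangle {d T R m n}.

(** * Gaussian row vectors *)

Section gaussian_measure.
Variable R : realType.

Definition mx_cons p (z : R * 'rV[R]_p) : 'rV[R]_(1 + p) := row_mx z.1%:M z.2.

Lemma measurable_mx_cons p : measurable_fun setT (@mx_cons p).
Proof.
apply: measurable_mx => i j; rewrite /mx_cons.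
have [k|k] := split_ordP j => ->.
  rewrite (_ : (fun _ => _) = fst); first exact: measurable_fst.
  by apply/funext => z; rewrite row_mxEl (ord1 k) (ord1 i) mxE eqxx.
rewrite (_ : (fun _ => _) = (fun M : 'rV[R]_p => M i k) \o snd).
  by apply: measurableT_comp => //; exact: measurable_mx_coord.
by apply/funext => z; rewrite row_mxEr.
Qed.

HB.instance Definition _ p :=
  isMeasurableFun.Build _ _ _ _ (@mx_cons p) (@measurable_mx_cons p).

(** The real line carries two names of its Borel sigma-algebra; this identity
    moves a law from one to the other. *)
Definition real_id : measurableTypeR R -> R := idfun.

Lemma measurable_real_id : measurable_fun setT real_id.
Proof. exact: (@measurable_id _ _ setT). Qed.

HB.instance Definition _ :=
  isMeasurableFun.Build _ _ _ _ real_id measurable_real_id.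

Definition stdnormal : probability R R :=
  distribution (normal_prob 0 1) real_id.

Fixpoint gaussian_row p : probability 'rV[R]_p R :=
  match p with
  | 0 => \d_(0 : 'rV[R]_0)
  | q.+1 => distribution (stdnormal \x gaussian_row q)%E (@mx_cons q)
  end.

Local Open Scope ereal_scope.

Lemma integral_gaussian_cons p (f : 'rV[R]_(1 + p) -> \bar R) :
  measurable_fun [set: 'rV[R]_(1 + p)] f -> (forall x, 0 <= f x) ->
  \int[gaussian_row p.+1]_x f x =
  \int[stdnormal]_a \int[gaussian_row p]_x f (row_mx a%:M x).
Proof.
move=> mf f0 /=; rewrite ge0_integral_distribution//.
rewrite fubini_tonelli1//=.
exact: measurableT_comp.
Qed.

End gaussian_measure.

(** * The standard normal law on the line *)

Section density.
Local Open Scope ereal_scope.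
Context d (T : measurableType d) (R : realType).
Variables (mu nu : {measure set T -> \bar R}) (g : T -> R).
Hypothesis mg : measurable_fun setT g.
Hypothesis g0 : forall x, (0 <= g x)%R.
Hypothesis nuE : forall A, measurable A -> nu A = \int[mu]_(x in A) (g x)%:E.

Import HBNNSimple.

(** Both sides are limits of their values on an increasing sequence of simple
    functions, for which the identity is the definition of the density. *)
Lemma ge0_integral_density (f : T -> \bar R) : measurable_fun setT f ->
  (forall x, 0 <= f x) -> \int[nu]_x f x = \int[mu]_x (f x * (g x)%:E).
Proof.
move=> mf f0; pose f_ := nnsfun_approx measurableT mf.
have mEg : measurable_fun setT (EFin \o g) by exact/measurable_EFinP.
transitivity (limn (fun n => \int[nu]_x (f_ n x)%:E)).
  rewrite -monotone_convergence//.
  - apply: eq_integral => y _; apply/esym/cvg_lim => //.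
    exact: cvg_nnsfun_approx.
  - by move=> n; exact/measurable_EFinP/measurable_funP.
  - by move=> n y _; rewrite lee_fin.
  - by move=> y _ m n mn; rewrite lee_fin; exact/lefP/nd_nnsfun_approx.
transitivity (limn (fun n => \int[mu]_x ((f_ n x)%:E * (g x)%:E))); last first.
  rewrite -monotone_convergence//.
  - apply: eq_integral => y _; apply/cvg_lim => //.
    apply: cvgeZr => //; exact: cvg_nnsfun_approx.
  - move=> n; apply: emeasurable_funM => //.
    exact/measurable_EFinP/measurable_funP.
  - by move=> n y _; rewrite mule_ge0// lee_fin.
  - move=> y _ m n mn; rewrite lee_wpmul2r ?lee_fin//.
    exact/lefP/nd_nnsfun_approx.
congr (limn _); apply/funext => n.
under eq_integral do rewrite fimfunE -fsumEFin//.
rewrite ge0_integral_fsum//; last 2 first.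
  - by move=> y; exact/measurable_EFinP/measurable_funM.
  - by move=> y x _; rewrite nnfun_muleindic_ge0.
under [RHS]eq_integral => x _.
  rewrite fimfunE -fsumEFin// ge0_mule_fsuml; last first.
    by move=> y; rewrite EFinM nnfun_muleindic_ge0.
  over.
rewrite ge0_integral_fsum//; last 2 first.
  - move=> y; apply: emeasurable_funM => //.
    exact/measurable_EFinP/measurable_funM.
  - by move=> y x _; rewrite mule_ge0 ?lee_fin// -lee_fin EFinM nnfun_muleindic_ge0.
apply: eq_fsbigr => r _.
rewrite integralZl_indic_nnsfun// integral_indic// setIT nuE//.
have [r0|r0] := leP 0%R r; last first.
  rewrite (preimage_nnfun0 _ r0) integral_set0 mule0.
  by rewrite [RHS]integral0_eq// => x _; rewrite indic0 mulr0 mul0e.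
rewrite -ge0_integralZl//; last 2 first.
  - exact: measurable_funTS.
  - by move=> x _; rewrite lee_fin.
rewrite integral_mkcond; apply: eq_integral => x _.
rewrite patchE indicE; case: ifP => _; first by rewrite mulr1.
by rewrite mulr0 mul0e.
Qed.

End density.

Section normal.
Variable R : realType.
Local Notation mu := (@lebesgue_measure R).
Local Notation N := (stdnormal R).
Local Open Scope ereal_scope.

Let affine_pos_measure (c b : R) (A : set R) : (0 < c)%R -> measurable A ->
  mu ((fun x => c * x + b)%R @^-1` A) = (c^-1)%:E * mu A.
Proof.
move=> c0 mA.
pose phi : measurableTypeR R -> measurableTypeR R := fun x => (c * x + b)%R.
have mphi : measurable_fun setT phi.
  apply: measurable_funD => //; apply: measurable_funM => //.
have c0' : (0 <= c)%R := ltW c0.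
suff -> : mu A = mscale (NngNum c0') (pushforward mu phi) A.
  by rewrite /mscale/= muleA -EFinM mulVf ?gt_eqF// mul1e.
move=> mphi'; apply: lebesgue_measure_unique => //.
move=> _ [[x y] _ <-] /=; rewrite /mscale/= /pushforward.
have -> : phi @^-1` `]x, y] = `]((x - b) / c)%R, ((y - b) / c)%R]%classic.
  apply/seteqP; split=> z /=; rewrite !in_itv/= ltr_pdivrMr// ler_pdivlMr//.
    by rewrite ltrBlDr lerBrDr [(z * c)%R]mulrC.
  by rewrite ltrBlDr lerBrDr [(z * c)%R]mulrC.
rewrite !lebesgue_measure_itv/= !lte_fin ltr_pM2r ?invr_gt0// ltrD2r.
case: ifP => _; last by rewrite mule0.
rewrite -!EFinB -EFinM; congr (_%:E); field.
by rewrite gt_eqF.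
Qed.

Lemma lebesgue_affine (c b : R) (A : set R) : c != 0%R -> measurable A ->
  mu ((fun x => c * x + b)%R @^-1` A) = (`|c|^-1)%:E * mu A.
Proof.
move=> cn0 mA; have [c0|c0] := ltP 0%R c.
  by rewrite affine_pos_measure// gtr0_norm.
have {cn0}c0 : (c < 0)%R by rewrite lt_neqAle cn0.
rewrite ltr0_norm// -(affine_pos_measure _ b)//; last by rewrite oppr_gt0.
rewrite -[RHS]lebesgue_measureN.
  by congr (mu _); apply/funext => x /=; rewrite mulrNN.
rewrite -[X in measurable X]setTI.
have : measurable_fun setT (fun x : R => - c * x + b)%R.
  by apply: measurable_funD => //; apply: measurable_funM.
exact.
Qed.

Lemma ge0_integral_affine (c b : R) (f : R -> \bar R) : c != 0%R ->
  measurable_fun [set: R] f -> (forall x, 0 <= f x) ->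
  \int[mu]_x f (c * x + b)%R = (`|c|^-1)%:E * \int[mu]_x f x.
Proof.
move=> cn0 mf f0.
pose phi : measurableTypeR R -> measurableTypeR R := fun x => (c * x + b)%R.
have mphi : measurable_fun setT phi.
  by apply: measurable_funD => //; apply: measurable_funM.
transitivity (\int[pushforward mu phi]_x f x).
  by rewrite ge0_integral_pushforward.
have c0 : (0 <= `|c|^-1)%R by [].
rewrite -(ge0_integral_mscale _ measurableT (NngNum c0))//.
apply: eq_measure_integral => // A mA _.
rewrite /pushforward /mscale/=; exact: lebesgue_affine.
Qed.

Definition phi (x : R) : R := normal_pdf 0 1 x.

Lemma phiE x : phi x = (normal_peak 1 * expR (- x ^+ 2 / 2))%R.
Proof.
by rewrite /phi normal_pdfE ?oner_neq0// /normal_fun subr0 expr1n.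
Qed.

Lemma phi_ge0 x : (0 <= phi x)%R.
Proof. exact: normal_pdf_ge0. Qed.

Lemma measurable_phi : measurable_fun [set: R] phi.
Proof. exact: measurable_normal_pdf. Qed.

Lemma integral_stdnormal (f : R -> \bar R) :
  measurable_fun [set: R] f -> (forall x, 0 <= f x) ->
  \int[N]_x f x = \int[mu]_x (f x * (phi x)%:E).
Proof.
move=> mf f0; rewrite /stdnormal ge0_integral_distribution//.
apply: ge0_integral_density => //.
- exact: measurable_phi.
- exact: phi_ge0.
Qed.

Lemma integral_normal_prob (s : R) (f : R -> \bar R) :
  measurable_fun [set: R] f -> (forall x, 0 <= f x) ->
  \int[normal_prob 0 s]_x f x = \int[mu]_x (f x * (normal_pdf 0 s x)%:E).
Proof.
move=> mf f0; apply: ge0_integral_density => //.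
- exact: measurable_normal_pdf.
- exact: normal_pdf_ge0.
Qed.

(** Scaling a standard normal variable gives the centered normal law. *)
Lemma integral_stdnormal_scale (s : R) (f : R -> \bar R) : (0 < s)%R ->
  measurable_fun [set: R] f -> (forall x, 0 <= f x) ->
  \int[N]_x f (s * x)%R = \int[normal_prob 0 s]_x f x.
Proof.
move=> s0 mf f0; rewrite (integral_normal_prob s f mf f0).
rewrite (integral_stdnormal (fun x => f (s * x)%R)); last 2 first.
- by apply: (measurableT_comp mf); apply: measurable_funM.
- by move=> x; exact: f0.
have sn0 : s != 0%R by rewrite gt_eqF.
pose g x := f x * (s * normal_pdf 0 s x)%:E.
have mpdf : measurable_fun [set: R] (normal_pdf 0 s) by exact: measurable_normal_pdf.
transitivity (\int[mu]_x g (s * x + 0)%R).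
  apply: eq_integral => x _; rewrite /g addr0; congr (_ * _%:E).
  rewrite phiE normal_pdfE// /normal_fun subr0 mulrA; congr (_ * expR _)%R.
    rewrite /normal_peak expr1n mul1r -mulrnAr sqrtrM ?sqr_ge0// sqrtr_sqr gtr0_norm//.
    by rewrite invfM mulrA divff// mul1r.
  by field.
rewrite ge0_integral_affine//; last 2 first.
- by apply: emeasurable_funM => //; apply/measurable_EFinP; exact: measurable_funM.
- by move=> x; rewrite mule_ge0// lee_fin mulr_ge0 ?normal_pdf_ge0 ?ltW.
rewrite -ge0_integralZl//; last 2 first.
- by apply: emeasurable_funM => //; apply/measurable_EFinP; exact: measurable_funM.
- by move=> x _; rewrite mule_ge0// lee_fin mulr_ge0 ?normal_pdf_ge0 ?ltW.
apply: eq_integral => x _; rewrite /g muleCA -EFinM gtr0_norm// mulrA.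
by rewrite mulVf// mul1r.
Qed.

Lemma integral_stdnormalN (f : R -> \bar R) :
  measurable_fun [set: R] f -> (forall x, 0 <= f x) ->
  \int[N]_x f (- x)%R = \int[N]_x f x.
Proof.
move=> mf f0; rewrite !integral_stdnormal//; last exact: measurableT_comp.
pose g y := f y * (phi y)%:E.
transitivity (\int[mu]_x g ((-1) * x + 0)%R).
  apply: eq_integral => x _; rewrite /g mulN1r addr0; congr (_ * _%:E).
  by rewrite !phiE sqrrN.
rewrite ge0_integral_affine//; last 2 first.
- apply: emeasurable_funM => //; apply/measurable_EFinP; exact: measurable_phi.
- by move=> x; rewrite mule_ge0// lee_fin phi_ge0.
by rewrite normrN1 invr1 mul1e.
Qed.

(** Rotation invariance of the plane normal law, by two one-dimensional
    substitutions: the first coordinate of the rotated point is substituted for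
    x at fixed y, then the second one for y; the exponent x ^ 2 + y ^ 2 is
    unchanged and the two Jacobians cancel. *)
Lemma integral_stdnormal_rot (c s : R) (f : R -> R -> \bar R) : c != 0%R ->
  (c ^+ 2 + s ^+ 2 = 1)%R ->
  measurable_fun [set: R * R] (fun z => f z.1 z.2) -> (forall x y, 0 <= f x y) ->
  \int[N]_x \int[N]_y f (x * c + y * s)%R (y * c - x * s)%R =
  \int[N]_x \int[N]_y f x y.
Proof.
move=> cn0 cs mf f0.
have maff (a b : R) : measurable_fun [set: R * R] (fun z => a * z.1 + b * z.2)%R.
  by apply: measurable_funD; apply: measurable_funM.
have mphi (g : R * R -> R) : measurable_fun setT g ->
    measurable_fun setT (fun z => (phi (g z))%:E).
  by move=> mg; apply/measurable_EFinP; apply: measurableT_comp => //; exact: measurable_phi.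
have mfc (g h : R * R -> R) : measurable_fun setT g -> measurable_fun setT h ->
    measurable_fun setT (fun z => f (g z) (h z)).
  move=> mg mh; apply: (@measurableT_comp _ _ _ _ _ _ (fun z : R * R => f z.1 z.2) _ (fun z => (g z, h z))) => //.
  exact: measurable_fun_pair.
pose G (z : R * R) := f z.1 ((z.2 - z.1 * s) / c)%R *
  ((phi ((z.1 - z.2 * s) / c))%:E * (phi z.2)%:E).
pose H (z : R * R) := f z.1 z.2 * ((phi z.1)%:E * (phi z.2)%:E).
have mG : measurable_fun setT G.
  apply: emeasurable_funM; first apply: mfc => //.
    rewrite (_ : (fun _ => _) = fun z : R * R => (- (s / c)) * z.1 + c^-1 * z.2)%R //.
    by apply/funext => z; ring.
  apply: emeasurable_funM; apply: mphi => //.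
  rewrite (_ : (fun _ => _) = fun z : R * R => c^-1 * z.1 + (- (s / c)) * z.2)%R //.
  by apply/funext => z; ring.
have mH : measurable_fun setT H.
  by apply: emeasurable_funM; [exact: mfc|apply: emeasurable_funM; exact: mphi].
have phi0 x : 0 <= (phi x)%:E by rewrite lee_fin phi_ge0.
have G0 z : 0 <= G z by rewrite !mule_ge0.
have H0 z : 0 <= H z by rewrite !mule_ge0.
have iter g : measurable_fun [set: R * R] (fun z => g z.1 z.2) -> (forall x y, 0 <= g x y) ->
    \int[N]_x \int[N]_y g x y =
    \int[mu]_x \int[mu]_y (g x y * ((phi x)%:E * (phi y)%:E)).
  move=> mg g0.
  have mgx x : measurable_fun setT (g x).
    exact: (measurableT_comp mg (measurable_fun_pair (measurable_cst x) (@measurable_id _ _ setT))).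
  rewrite integral_stdnormal; last 2 first.
  - exact: (@measurable_fun_fubini_tonelli_F _ _ _ _ _ N (fun z => g z.1 z.2) mg (fun z => g0 z.1 z.2)).
  - by move=> x; apply: integral_ge0.
  apply: eq_integral => x _; rewrite integral_stdnormal// -ge0_integralZr//; last 2 first.
  - apply: emeasurable_funM; first exact: mgx.
    apply/measurable_EFinP; exact: measurable_phi.
  - by move=> y _; rewrite mule_ge0.
  by apply: eq_integral => y _; rewrite -muleA [X in _ * X]muleC.
rewrite (iter f mf f0).
pose fr x y := f (x * c + y * s)%R (y * c - x * s)%R.
have mfr : measurable_fun [set: R * R] (fun z => fr z.1 z.2).
  apply: mfc.
    rewrite (_ : (fun _ => _) = fun z : R * R => c * z.1 + s * z.2)%R //.
    by apply/funext => z; ring.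
  rewrite (_ : (fun _ => _) = fun z : R * R => (- s) * z.1 + c * z.2)%R //.
  by apply/funext => z; ring.
transitivity (\int[mu]_x \int[mu]_y (fr x y * ((phi x)%:E * (phi y)%:E))).
  by apply: (iter fr mfr) => x y; exact: f0.
transitivity (\int[mu]_x \int[mu]_y G (c * x + y * s, y)%R).
  apply: eq_integral => x _; apply: eq_integral => y _; rewrite /fr /G /=.
  have cs' : (s ^+ 2 = 1 - c ^+ 2)%R by rewrite -cs; ring.
  congr (f _ _ * ((phi _)%:E * _)); first by ring.
    apply: (mulIf cn0); rewrite divfK//.
    have -> : (y - (c * x + y * s) * s = y - c * x * s - y * s ^+ 2)%R by ring.
    by rewrite cs'; ring.
  by field.
transitivity (\int[mu]_y \int[mu]_x G (c * x + y * s, y)%R).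
  apply: (@fubini_tonelli _ _ _ _ _ mu mu (fun z => G (c * z.1 + z.2 * s, z.2)%R)).
    have maff1 : measurable_fun [set: R * R] (fun z => c * z.1 + z.2 * s)%R.
      by apply: measurable_funD; apply: measurable_funM.
    exact: (measurableT_comp mG (measurable_fun_pair maff1 measurable_snd)).
  by move=> z; exact: G0.
have mGy y : measurable_fun [set: R] (fun x => G (x, y)) by exact: measurableT_comp.
have mGx x : measurable_fun [set: R] (fun y => G (x, y)) by exact: measurableT_comp.
have mHx x : measurable_fun [set: R] (fun y => H (x, y)) by exact: measurableT_comp.
transitivity (\int[mu]_y ((`|c|^-1)%:E * \int[mu]_x G (x, y))).
  apply: eq_integral => y _.
  exact: (ge0_integral_affine c (y * s) (fun x => G (x, y)) cn0 (mGy y) (fun x => G0 _)).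
have c10 : 0 <= (`|c|^-1)%:E by rewrite lee_fin.
transitivity ((`|c|^-1)%:E * \int[mu]_y \int[mu]_x G (x, y)).
  apply: ge0_integralZl => //; first exact: (@measurable_fun_fubini_tonelli_G _ _ _ _ _ mu G mG G0).
  by move=> y _; apply: integral_ge0.
transitivity ((`|c|^-1)%:E * \int[mu]_x \int[mu]_y G (x, y)).
  exact: (congr1 (mule (`|c|^-1)%:E) (esym (@fubini_tonelli _ _ _ _ _ mu mu G mG G0))).
transitivity (\int[mu]_x ((`|c|^-1)%:E * \int[mu]_y G (x, y))).
  apply/esym/ge0_integralZl => //; first exact: (@measurable_fun_fubini_tonelli_F _ _ _ _ _ mu G mG G0).
  by move=> y _; apply: integral_ge0.
apply: eq_integral => u _.
transitivity ((`|c|^-1)%:E * \int[mu]_y H (u, c^-1 * y + (- (u * s / c)))%R).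
  apply: (congr1 (mule (`|c|^-1)%:E)); apply: eq_integral => y _; rewrite /G /H /=.
  have cs' : (s ^+ 2 = 1 - c ^+ 2)%R by rewrite -cs; ring.
  congr (f _ _ * _); first by ring.
  rewrite -!EFinM !phiE mulrACA -expRD [X in _ = X%:E]mulrACA -expRD.
  congr (_ * expR _)%:E; apply: (mulIf (expf_neq0 2 cn0)).
  have -> : ((- ((u - y * s) / c) ^+ 2 / 2 + - y ^+ 2 / 2) * c ^+ 2 =
    - (u ^+ 2 - 2 * u * y * s + y ^+ 2 * (c ^+ 2 + s ^+ 2)) / 2)%R by field.
  have -> : ((- u ^+ 2 / 2 + - (c^-1 * y - u * s / c) ^+ 2 / 2) * c ^+ 2 =
    - (u ^+ 2 * (c ^+ 2 + s ^+ 2) - 2 * u * y * s + y ^+ 2) / 2)%R by field.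
  by rewrite cs; ring.
rewrite (ge0_integral_affine c^-1 _ (fun x => H (u, x)) _ (mHx u) (fun x => H0 _)); last by rewrite invr_eq0.
by rewrite muleA -EFinM normfV invrK mulVf ?mul1e// normr_eq0.
Qed.

Lemma normal_peakE (s : R) : (0 < s)%R -> normal_peak s = (s^-1 * normal_peak 1)%R.
Proof.
move=> s0; rewrite /normal_peak expr1n mul1r -mulrnAr sqrtrM ?sqr_ge0//.
by rewrite sqrtr_sqr gtr0_norm// invfM.
Qed.

(** Density of the centered normal law of variance 1 + l with respect to the
    standard one. *)
Definition tilt (l x : R) : R :=
  (Num.sqrt (1 + l))^-1 * expR (x ^+ 2 / 2 * (l / (1 + l))).

Lemma tilt_ge0 l x : (0 <= tilt l x)%R.
Proof. by rewrite mulr_ge0 ?expR_ge0// invr_ge0 sqrtr_ge0. Qed.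

Lemma measurable_tilt l : measurable_fun [set: R] (tilt l).
Proof.
apply: measurable_funM => //; apply: measurableT_comp => //.
by apply: measurable_funM => //; apply: measurable_funM => //; exact: measurable_funX.
Qed.

Lemma integral_tilt l (f : R -> \bar R) : (`|l| <= 2^-1)%R ->
  measurable_fun [set: R] f -> (forall x, 0 <= f x) ->
  \int[N]_x f (Num.sqrt (1 + l) * x)%R = \int[N]_x (f x * (tilt l x)%:E).
Proof.
rewrite ler_norml => /andP[l1 l2] mf f0.
have l0 : (0 < 1 + l)%R by lra.
have s0 : (0 < Num.sqrt (1 + l))%R by rewrite sqrtr_gt0.
rewrite (integral_stdnormal_scale _ _ s0 mf f0) (integral_normal_prob _ _ mf f0).
rewrite (integral_stdnormal (fun x => f x * (tilt l x)%:E)); last 2 first.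
- apply: emeasurable_funM => //; apply/measurable_EFinP; exact: measurable_tilt.
- by move=> x; rewrite mule_ge0// lee_fin tilt_ge0.
apply: eq_integral => x _; rewrite -muleA -EFinM; congr (_ * _%:E).
rewrite normal_pdfE ?gt_eqF// normal_peakE// phiE /tilt mulrACA -expRD.
congr (_ * expR _)%R; rewrite subr0 sqr_sqrtr ?ltW//; field.
by rewrite gt_eqF.
Qed.

(** The squared density times the normal density is again proportional to a
    centered normal density, of variance (1 + l) / (1 - l). The total mass is
    (1 - l ^ 2) ^ (-1/2), which is at most e ^ (l ^ 2) when l ^ 2 <= 1/4. *)
Lemma integral_tilt2 l : (`|l| <= 2^-1)%R ->
  \int[N]_x (tilt l x ^+ 2)%:E <= (expR (l ^+ 2))%:E.
Proof.
rewrite ler_norml => /andP[l1 l2].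
have l0 : (0 < 1 + l)%R by lra.
have l0' : (0 < 1 - l)%R by lra.
pose t : R := Num.sqrt ((1 + l) / (1 - l)).
have t0 : (0 < t)%R by rewrite sqrtr_gt0 divr_gt0.
have t2 : (t ^+ 2 = (1 + l) / (1 - l))%R by rewrite sqr_sqrtr// divr_ge0 ?ltW.
have k0 : (0 <= t / (1 + l))%R by rewrite divr_ge0 ?ltW.
rewrite integral_stdnormal//; last 2 first.
- by apply/measurable_EFinP; apply: measurable_funX; exact: measurable_tilt.
- by move=> x; rewrite lee_fin sqr_ge0.
have -> : \int[mu]_x ((tilt l x ^+ 2)%:E * (phi x)%:E) =
    \int[mu]_x ((t / (1 + l))%:E * (normal_pdf 0 t x)%:E).
  apply: eq_integral => x _; rewrite -!EFinM; congr (_%:E).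
  rewrite normal_pdfE ?gt_eqF// normal_peakE// phiE /tilt exprMn -expRM_natl.
  rewrite exprVn sqr_sqrtr ?ltW// mulrACA -expRD.
  rewrite [RHS]mulrA; congr (_ * expR _)%R.
    by field; rewrite !gt_eqF.
  rewrite subr0 t2; field.
  by rewrite !gt_eqF.
rewrite ge0_integralZl//; last 2 first.
- apply/measurable_EFinP; exact: measurable_normal_pdf.
- by move=> x _; rewrite lee_fin normal_pdf_ge0.
rewrite integral_normal_pdf mule1 lee_fin -(@ler_pXn2r _ 2)// ?nnegrE ?expR_ge0//.
rewrite exprMn t2 -expRM_natl.
have h : (1 + 2%:R * l ^+ 2 <= expR (2%:R * l ^+ 2))%R by exact: expR_ge1Dx.
have l21 : (l ^+ 2 <= 4^-1)%R by nra.
have -> : ((1 + l) / (1 - l) * (1 + l)^-1 ^+ 2 = 1 / (1 - l ^+ 2))%R.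
  by field; rewrite !gt_eqF//; nra.
rewrite ler_pdivrMr; last by nra.
have := sqr_ge0 l; move: (expR _) h => e h l20.
by nra.
Qed.

(** Since x ^ 4 <= 64 e ^ (x ^ 2 / 4), the integrand is dominated by a multiple of
    the normal density of variance 2; the sharp value 3 would not improve the
    rate. *)
Lemma integral_stdnormal_pow4 :
  \int[N]_x (x ^+ 4)%:E <= (64 * Num.sqrt 2)%:E.
Proof.
have s0 : (0 < Num.sqrt 2 :> R)%R by rewrite sqrtr_gt0.
have s2 : (Num.sqrt 2 ^+ 2 = 2 :> R)%R by rewrite sqr_sqrtr.
rewrite integral_stdnormal//; last 2 first.
- by apply/measurable_EFinP; exact: measurable_funX.
- by move=> x; rewrite lee_fin exprn_even_ge0.
have mpdf : measurable_fun [set: R] (fun x => (normal_pdf 0 (Num.sqrt 2) x)%:E).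
  by apply/measurable_EFinP; exact: measurable_normal_pdf.
have <- : \int[mu]_x ((64 * Num.sqrt 2)%:E * (normal_pdf 0 (Num.sqrt 2) x)%:E) =
    (64 * Num.sqrt 2)%:E.
  rewrite -[RHS]mule1 -(integral_normal_pdf 0 (Num.sqrt 2 : R)).
  apply: ge0_integralZl => //.
  by move=> x _; rewrite lee_fin normal_pdf_ge0.
have mx4 : measurable_fun [set: R] (fun x => (x ^+ 4)%:E).
  by apply/measurable_EFinP; exact: measurable_funX.
have mphi : measurable_fun [set: R] (fun x => (phi x)%:E).
  by apply/measurable_EFinP; exact: measurable_phi.
apply: ge0_le_integral => //.
- by move=> x _; rewrite mule_ge0 ?lee_fin ?exprn_even_ge0 ?phi_ge0.
- exact: (emeasurable_funM mx4 mphi).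
- exact: (emeasurable_funM (measurable_cst _) mpdf).
move=> x _; rewrite -!EFinM lee_fin phiE normal_pdfE ?gt_eqF// (normal_peakE _ s0).
rewrite /normal_fun subr0 s2.
have -> : (64 * Num.sqrt 2 * ((Num.sqrt 2)^-1 * normal_peak 1 * expR (- x ^+ 2 / (2 *+ 2)))
    = normal_peak 1 * (64 * expR (- x ^+ 2 / (2 *+ 2))))%R.
  by field; rewrite gt_eqF.
rewrite mulrCA ler_wpM2l ?normal_peak_ge0//.
have -> : (- x ^+ 2 / (2 *+ 2) = x ^+ 2 / 8 * 2 + (- x ^+ 2 / 2))%R by field.
rewrite expRD mulrA ler_wpM2r ?expR_ge0// expRM_natr.
have : (1 + x ^+ 2 / 8 <= expR (x ^+ 2 / 8))%R by exact: expR_ge1Dx.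
have : (0 <= x ^+ 2 / 8)%R by rewrite divr_ge0// sqr_ge0.
have -> : (x ^+ 4 = 64 * (x ^+ 2 / 8) ^+ 2)%R by field.
move: (x ^+ 2 / 8)%R (expR _) => a e a0 ae.
rewrite ler_pM2l// ler_pXn2r// ?nnegrE; lra.
Qed.

End normal.

(** * Gaussian matrices and their rotation invariance *)

Section measurable_operations.
Variable R : realType.

Lemma measurable_mulmx d (T : measurableType d) m n p
    (f : T -> 'M[R]_(m, n)) (g : T -> 'M[R]_(n, p)) :
  measurable_fun setT f -> measurable_fun setT g ->
  measurable_fun setT (fun t => f t *m g t).
Proof.
move=> mf mg; apply: measurable_mx => i j.
rewrite (_ : (fun _ => _) = fun t => \sum_k f t i k * g t k j); last first.
  by apply/funext => t; rewrite mxE.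
apply: measurable_sum => k; apply: measurable_funM.
  exact: (measurableT_comp (measurable_mx_coord _ _ _ _ i k)).
exact: (measurableT_comp (measurable_mx_coord _ _ _ _ k j)).
Qed.

Lemma measurable_mulmxr m n p (C : 'M[R]_(n, p)) :
  measurable_fun setT (fun M : 'M[R]_(m, n) => M *m C).
Proof. exact: measurable_mulmx. Qed.

Lemma measurable_trmx d (T : measurableType d) m n (f : T -> 'M[R]_(m, n)) :
  measurable_fun setT f -> measurable_fun setT (fun t => (f t)^T).
Proof.
move=> mf; apply: measurable_mx => i j.
rewrite (_ : (fun _ => _) = fun t => f t j i); last by apply/funext => t; rewrite mxE.
exact: (measurableT_comp (measurable_mx_coord _ _ _ _ j i)).
Qed.

Lemma measurable_row_mx d (T : measurableType d) m n p
    (f : T -> 'M[R]_(m, n)) (g : T -> 'M[R]_(m, p)) :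
  measurable_fun setT f -> measurable_fun setT g ->
  measurable_fun setT (fun t => row_mx (f t) (g t)).
Proof.
move=> mf mg; apply: measurable_mx => i j; have [k|k] := split_ordP j => ->.
  rewrite (_ : (fun _ => _) = fun t => f t i k); last by apply/funext => t; rewrite row_mxEl.
  exact: (measurableT_comp (measurable_mx_coord _ _ _ _ i k)).
rewrite (_ : (fun _ => _) = fun t => g t i k); last by apply/funext => t; rewrite row_mxEr.
exact: (measurableT_comp (measurable_mx_coord _ _ _ _ i k)).
Qed.

Lemma measurable_scalar_mx d (T : measurableType d) n (f : T -> R) :
  measurable_fun setT f -> measurable_fun setT (fun t => (f t)%:M : 'M[R]_n).
Proof.
move=> mf; apply: measurable_mx => i j.
rewrite (_ : (fun _ => _) = fun t => f t *+ (i == j)); last by apply/funext => t; rewrite mxE.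
by case: (i == j).
Qed.

Lemma measurable_vec_mx m n :
  measurable_fun setT (vec_mx : 'rV[R]_(m * n) -> 'M[R]_(m, n)).
Proof.
apply: measurable_mx => i j.
rewrite (_ : (fun _ => _) = fun u : 'rV[R]_(m * n) => u 0 (mxvec_index i j)); last by apply/funext => t; rewrite mxE.
exact: measurable_mx_coord.
Qed.

End measurable_operations.

Section gaussian.
Variable R : realType.
Local Notation N := (stdnormal R).
Local Notation gamma := (gaussian_row R).

HB.instance Definition _ m n := isMeasurableFun.Build _ _ _ _
  (vec_mx : 'rV[R]_(m * n) -> 'M[R]_(m, n)) (@measurable_vec_mx R m n).

Definition gaussian m n : probability 'M[R]_(m, n) R :=
  distribution (gamma (m * n)) (vec_mx : 'rV[R]_(m * n) -> 'M[R]_(m, n)).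

Local Open Scope ereal_scope.

Lemma integral_gaussian m n (F : 'M[R]_(m, n) -> \bar R) :
  measurable_fun setT F -> (forall M, 0 <= F M) ->
  \int[gaussian m n]_M F M = \int[gamma (m * n)]_x F (vec_mx x).
Proof. by move=> mF F0; rewrite ge0_integral_distribution. Qed.

Lemma measurable_eprod d (T : measurableType d) (I : Type) (s : seq I)
    (h : I -> T -> \bar R) : (forall i, measurable_fun setT (h i)) ->
  measurable_fun setT (fun x => \prod_(i <- s) h i x).
Proof.
move=> mh; elim: s => [|i s IH].
  by under eq_fun do rewrite big_nil; exact: measurable_cst.
by under eq_fun do rewrite big_cons; exact: emeasurable_funM.
Qed.

Lemma measurable_row_cons p (f : 'rV[R]_(1 + p) -> \bar R) a :
  measurable_fun setT f ->
  measurable_fun setT (fun x : 'rV[R]_p => f (row_mx a%:M x)).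
Proof.
move=> mf; apply: (measurableT_comp mf); exact: measurable_row_mx.
Qed.

Lemma integral_gaussian_row_prod p (f : 'I_p -> R -> \bar R) :
  (forall i, measurable_fun setT (f i)) -> (forall i x, 0 <= f i x) ->
  \int[gamma p]_x \prod_i f i (x 0 i)%R = \prod_i \int[N]_x f i x.
Proof.
elim: p f => [|p IH] f mf f0.
  rewrite big_ord0 (eq_integral (cst 1)); last by move=> x _; rewrite big_ord0.
  rewrite integral_cst// mul1e; exact: (probability_setT (gamma 0)).
have mc n (i : 'I_n) (g : R -> \bar R) : measurable_fun setT g ->
    measurable_fun setT (fun x : 'rV[R]_n => g (x 0 i)%R).
  by move=> mg; apply: (measurableT_comp mg); exact: measurable_mx_coord.
have E a (x : 'rV[R]_p) : \prod_(i < p.+1) f i ((row_mx a%:M x : 'rV[R]_(1 + p)) 0 i)%R =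
    f ord0 a * \prod_i f (lift ord0 i) (x 0 i)%R.
  rewrite big_ord_recl; congr (f _ _ * _).
    by rewrite mxE; case: splitP => // k _; rewrite (ord1 k) mxE eqxx.
  apply: eq_bigr => i _; congr (f _ _).
  by rewrite (_ : lift ord0 i = rshift 1 i) ?row_mxEr//; exact: val_inj.
transitivity (\int[N]_a \int[gamma p]_x
    \prod_(i < p.+1) f i ((row_mx a%:M x : 'rV[R]_(1 + p)) 0 i)%R).
  apply: (integral_gaussian_cons _ _ (fun x : 'rV[R]_(1 + p) => \prod_(i < p.+1) f i (x 0 i)%R)).
    by apply: measurable_eprod => i; exact: mc.
  by move=> x; exact: prode_ge0.
rewrite big_ord_recl.
transitivity (\int[N]_a (f ord0 a * \prod_i \int[N]_x f (lift ord0 i) x)).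
  apply: eq_integral => a _; rewrite -IH// -ge0_integralZl//; last 2 first.
  - by apply: measurable_eprod => i; exact: mc.
  - by move=> x _; exact: prode_ge0.
  by apply: eq_integral => x _; exact: E.
rewrite ge0_integralZr//; apply: prode_ge0 => i _.
by apply: integral_ge0.
Qed.

Lemma gaussian_row_rectangle p (B : 'I_1 -> 'I_p -> set R) :
  (forall i j, measurable (B i j)) ->
  gamma p (rectangle B) = \prod_j N (B ord0 j).
Proof.
move=> mB; rewrite -[LHS]mul1e -[X in X * _]/(1%:E) -integral_cst; last exact: measurable_rectangle.
rewrite integral_mkcond.
transitivity (\int[gamma p]_x \prod_j (\1_(B ord0 j) (x 0%R j))%:E).
  apply: eq_integral => x _; rewrite patchE.
  case: ifPn => [|] xB.
    rewrite big1// => j _; rewrite indicE mem_set//.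
    by move/set_mem: xB; apply.
  have [j xj] : exists j, ~ B ord0 j (x 0 j)%R.
    apply/existsNP => H; move/negP: xB; apply; apply/mem_set => i j.
    by rewrite (ord1 i).
  by rewrite (bigD1 j)//= indicE memNset// mul0e.
rewrite (integral_gaussian_row_prod _ (fun j x => (\1_(B ord0 j) x)%:E))//.
  by apply: eq_bigr => j _; rewrite integral_indic// setIT.
by move=> j; apply/measurable_EFinP; exact: measurable_indic.
Qed.

Lemma eq_gaussian_row p (nu : probability 'rV[R]_p R) :
  (forall B : 'I_1 -> 'I_p -> set R, (forall i j, measurable (B i j)) ->
    nu (rectangle B) = \prod_j N (B ord0 j)) ->
  forall E, measurable E -> nu E = gamma p E.
Proof.
move=> H; apply: eq_measure_rectangle => B mB.
by rewrite gaussian_row_rectangle//; exact: H.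
Qed.

Let row_pair p q (z : 'rV[R]_p * 'rV[R]_q) : 'rV[R]_(p + q) := row_mx z.1 z.2.

Let measurable_row_pair p q : measurable_fun setT (@row_pair p q).
Proof. exact: measurable_row_mx. Qed.

HB.instance Definition _ p q :=
  isMeasurableFun.Build _ _ _ _ (@row_pair p q) (@measurable_row_pair p q).

Lemma integral_gaussian_row_split p q (f : 'rV[R]_(p + q) -> \bar R) :
  measurable_fun setT f -> (forall x, 0 <= f x) ->
  \int[gamma (p + q)]_x f x =
  \int[gamma p]_x \int[gamma q]_y f (row_mx x y).
Proof.
move=> mf f0.
transitivity (\int[distribution (gamma p \x gamma q) (@row_pair p q)]_x f x).
  apply: eq_measure_integral => E mE _; apply/esym/eq_gaussian_row => // B mB.
  transitivity ((gamma p \x gamma q)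
     (rectangle (fun i j => B i (lshift q j)) `*`
      rectangle (fun i j => B i (rshift p j)))).
    congr ((gamma p \x gamma q) _); apply/seteqP; split=> -[x y] /=.
      move=> H; split=> i j.
        by have := H i (lshift q j); rewrite row_mxEl.
      by have := H i (rshift p j); rewrite row_mxEr.
    move=> [Hx Hy] i j; have [k|k] := split_ordP j => ->.
      by rewrite row_mxEl; exact: Hx.
    by rewrite row_mxEr; exact: Hy.
  rewrite big_split_ord -(gaussian_row_rectangle p (fun i j => B i (lshift q j)))//.
  rewrite -(gaussian_row_rectangle q (fun i j => B i (rshift p j)))//.
  by apply: product_measure1E; exact: measurable_rectangle.
rewrite ge0_integral_distribution// fubini_tonelli1//.
  exact: measurableT_comp.
by move=> x; exact: f0.
Qed.

(** By induction on the generators of the orthogonal group, the claim reduces to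
    the symmetry of the normal law on the line and to its rotation invariance in
    the plane. *)
Lemma gaussian_row_orthogonal p (U : 'M[R]_p) (f : 'rV[R]_p -> \bar R) :
  (U *m U^T = 1%:M)%R -> measurable_fun setT f -> (forall x, 0 <= f x) ->
  \int[gamma p]_x f (x *m U)%R = \int[gamma p]_x f x.
Proof.
pose G n (V : 'M[R]_n) := forall g : 'rV[R]_n -> \bar R,
  measurable_fun setT g -> (forall x, 0 <= g x) ->
  \int[gamma n]_x g (x *m V)%R = \int[gamma n]_x g x.
have mG n (V : 'M[R]_n) g : measurable_fun [set: 'rV[R]_n] g ->
    measurable_fun [set: 'rV[R]_n] (fun x => g (x *m V)%R : \bar R).
  by move=> mg; apply: (measurableT_comp mg); exact: measurable_mulmxr.
move=> UU; move: f; apply: (@orthogonal_ind R G) => //.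
- by move=> n g mg g0; apply: eq_integral => x _; rewrite mulmx1.
- move=> n V W GV GW g mg g0; rewrite -[RHS]GW//.
  rewrite -[RHS](GV (fun x => g (x *m W)%R)); [|exact: mG|by move=> x; exact: g0].
  by apply: eq_integral => x _; rewrite mulmxA.
- move=> n V VV GV g mg g0.
  rewrite -[LHS](GV (fun x => g (x *m V^T)%R)); [|exact: mG|by move=> x; exact: g0].
  by apply: eq_integral => x _; rewrite -mulmxA VV mulmx1.
- move=> n V GV g mg g0.
  transitivity (\int[N]_a \int[gamma n]_x
      g ((row_mx a%:M x : 'rV[R]_(1 + n)) *m block_mx 1%:M 0 0 V)%R).
    by apply: (integral_gaussian_cons _ _ (fun x => g (x *m _)%R)); [exact: mG|move=> x; exact: g0].
  transitivity (\int[N]_a \int[gamma n]_x g (row_mx a%:M x)%R); last first.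
    exact/esym/(integral_gaussian_cons _ _ g).
  apply: eq_integral => a _.
  transitivity (\int[gamma n]_x g (row_mx a%:M (x *m V))%R).
    apply: eq_integral => x _; congr g.
    by rewrite mul_row_block !mulmx0 mulmx1 addr0 add0r.
  apply: (GV (fun x => g (row_mx a%:M x))) => //; exact: measurable_row_cons.
- move=> g mg g0.
  have mga : measurable_fun [set: R] (fun a => \int[gamma 0]_x g (row_mx a%:M x)).
    have mgc : measurable_fun setT (fun z : R * 'rV[R]_0 => g (row_mx z.1%:M z.2)).
      exact: (measurableT_comp mg (@measurable_mx_cons R 0)).
    exact: (@measurable_fun_fubini_tonelli_F _ _ _ _ _ (gamma 0) _ mgc (fun _ => g0 _)).
  transitivity (\int[N]_a \int[gamma 0]_x g ((row_mx a%:M x : 'rV[R]_(1 + 0)) *m - 1%:M)%R).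
    by apply: (integral_gaussian_cons _ _ (fun x => g (x *m _)%R)); [exact: mG|move=> x; exact: g0].
  transitivity (\int[N]_a \int[gamma 0]_x g (row_mx a%:M x)%R); last first.
    exact/esym/(integral_gaussian_cons _ _ g).
  transitivity (\int[N]_a \int[gamma 0]_x g (row_mx (- a)%:M x)%R); last first.
    by apply: (integral_stdnormalN _ _ mga) => a; exact: integral_ge0.
  apply: eq_integral => a _; apply: eq_integral => x _; congr g.
  rewrite mulmxN mulmx1 (opp_row_mx a%:M x) raddfN [x]thinmx0.
  by rewrite oppr0.
- move=> n c s c0 cs g mg g0.
  have E h : measurable_fun [set: 'rV[R]_(1 + (1 + n))] h -> (forall x, 0 <= h x) ->
      \int[gamma (1 + (1 + n))]_x h x =
      \int[N]_a \int[N]_b \int[gamma n]_x h (row_mx a%:M (row_mx b%:M x)).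
    move=> mh h0; rewrite (integral_gaussian_cons _ _ h)//.
    apply: eq_integral => a _.
    apply: (integral_gaussian_cons _ _ (fun x => h (row_mx a%:M x))) => //.
    exact: measurable_row_cons.
  transitivity (\int[N]_a \int[N]_b \int[gamma n]_x
      g (row_mx a%:M (row_mx b%:M x) *m rot2 R n c s)%R).
    by apply: (E (fun x => g (x *m _)%R)); [exact: mG|move=> x; exact: g0].
  transitivity (\int[N]_a \int[N]_b \int[gamma n]_x g (row_mx a%:M (row_mx b%:M x)));
    last by apply/esym; exact: E.
  pose k a b := \int[gamma n]_x g (row_mx a%:M (row_mx b%:M x)).
  transitivity (\int[N]_a \int[N]_b k (a * c + b * s)%R (b * c - a * s)%R).
    apply: eq_integral => a _; apply: eq_integral => b _; apply: eq_integral => x _.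
    by rewrite mul_rot2.
  apply: (integral_stdnormal_rot _ c s k) => //.
  - have m11 : measurable_fun setT (fun z : (R * R) * 'rV[R]_n => z.1.1).
      exact: measurableT_comp.
    have m12 : measurable_fun setT (fun z : (R * R) * 'rV[R]_n => z.1.2).
      exact: measurableT_comp.
    have mgc : measurable_fun setT (fun z : (R * R) * 'rV[R]_n =>
        g (row_mx z.1.1%:M (row_mx z.1.2%:M z.2))).
      apply: (measurableT_comp mg); apply: measurable_row_mx.
        exact: measurable_scalar_mx.
      by apply: measurable_row_mx => //; exact: measurable_scalar_mx.
    exact: (@measurable_fun_fubini_tonelli_F _ _ _ _ _ (gamma n) _ mgc (fun _ => g0 _)).
  - by move=> a b; exact: integral_ge0.
Qed.

End gaussian.

(** * Comparing two Gaussian laws by their second moment *)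

Section mulmxr_matrix.
Variable R : rcfType.

Lemma lin_mulmxr_orthogonal m n (U : 'M[R]_n) : U *m U^T = 1%:M ->
  lin_mx (mulmxr U : 'M[R]_(m, n) -> _) *m (lin_mx (mulmxr U))^T = 1%:M.
Proof.
move=> UU; have -> : (lin_mx (mulmxr U))^T = lin_mx (mulmxr U^T : 'M[R]_(m, n) -> _).
  apply/matrixP => k l; case/mxvec_indexP: k => i j; case/mxvec_indexP: l => a b.
  rewrite mxE /lin_mx !mxE /= !vec_mx_delta !mxvecE !mxE.
  rewrite (bigD1 b)//= big1 => [|c cb]; last by rewrite mxE (negPf cb) andbF mul0r.
  rewrite (bigD1 j)//= big1 => [|c cj]; last by rewrite mxE (negPf cj) andbF mul0r.
  by rewrite !mxE !eqxx !andbT eq_sym !addr0.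
apply/row_matrixP => i; rewrite !rowE mulmx1 mulmxA !mul_rV_lin /= mxvecK.
by rewrite -mulmxA UU mulmx1 vec_mxK.
Qed.

Lemma sum_mxvec m n (A : 'M[R]_(m, n)) (g : R -> R) :
  \sum_k g (mxvec A 0 k) = \sum_i \sum_j g (A i j).
Proof.
rewrite pair_big /= (reindex _ (curry_mxvec_bij m n)) /=.
by apply: eq_bigr => -[i j] _; rewrite mxvecE.
Qed.

End mulmxr_matrix.

Section second_moment.
Variable R : realType.
Local Notation N := (stdnormal R).
Local Notation gamma := (gaussian_row R).
Local Open Scope ereal_scope.

Definition tilt_row p (l : 'I_p -> R) (x : 'rV[R]_p) : R :=
  (\prod_i tilt R (l i) (x 0 i))%R.

Lemma tilt_row_ge0 p (l : 'I_p -> R) x : (0 <= tilt_row p l x)%R.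
Proof. by apply: prodr_ge0 => i _; exact: tilt_ge0. Qed.

Lemma measurable_tilt_row p (l : 'I_p -> R) : measurable_fun setT (tilt_row p l).
Proof.
apply: measurable_prod => i _.
apply: (measurableT_comp (measurable_tilt _ (l i))); exact: measurable_mx_coord.
Qed.

Definition scale_row p (s : 'I_p -> R) (x : 'rV[R]_p) : 'rV[R]_p :=
  (\row_i (s i * x 0 i))%R.

Lemma measurable_scale_row p s : measurable_fun setT (scale_row p s).
Proof.
apply: measurable_mx => i j.
rewrite (_ : (fun _ => _) = fun x : 'rV[R]_p => s j * x 0 j)%R; last first.
  by apply/funext => x; rewrite mxE.
by apply: measurable_funM => //; exact: measurable_mx_coord.
Qed.

Lemma integral_tilt_row p (l : 'I_p -> R) (f : 'rV[R]_p -> \bar R) :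
  (forall i, `|l i| <= 2^-1)%R -> measurable_fun setT f -> (forall x, 0 <= f x) ->
  \int[gamma p]_x f (scale_row p (fun i => Num.sqrt (1 + l i)%R) x) =
  \int[gamma p]_x (f x * (tilt_row p l x)%:E).
Proof.
elim: p l f => [|p IH] l f l12 mf f0.
  apply: eq_integral => x _; rewrite /tilt_row big_ord0 mule1.
  by congr f; rewrite [LHS]thinmx0 [RHS]thinmx0.
pose l' i := l (lift ord0 i).
pose s0 := Num.sqrt (1 + l ord0)%R.
have lift_r (i : 'I_p) : lift ord0 i = rshift 1 i by exact: val_inj.
have mfx a : measurable_fun setT (fun x : 'rV[R]_p => f (row_mx a%:M x)).
  exact: (measurable_row_cons R p f a mf).
have mtilt := measurable_tilt_row.
have mEtilt n k : measurable_fun setT (fun x => (tilt_row n k x)%:E).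
  by apply/measurable_EFinP; exact: mtilt.
have tilt0 n k x : 0 <= (tilt_row n k x)%:E by rewrite lee_fin tilt_row_ge0.
transitivity (\int[N]_a \int[gamma p]_x
    f (scale_row p.+1 (fun i => Num.sqrt (1 + l i)%R) (row_mx a%:M x : 'rV[R]_(1 + p)))).
  apply: (integral_gaussian_cons _ p (fun x => f (scale_row p.+1 _ x))) => //.
  by apply: (measurableT_comp mf); exact: measurable_scale_row.
transitivity (\int[N]_a \int[gamma p]_x
    (f (row_mx (s0 * a)%:M x)%R * (tilt_row p l' x)%:E)).
  apply: eq_integral => a _; rewrite -IH//; last by move=> i; exact: l12.
  apply: eq_integral => x _; congr f.
  apply/rowP => j; rewrite /scale_row [LHS]mxE.
  have [k|k] := split_ordP (j : 'I_(1 + p)) => ->.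
    rewrite (row_mxEl a%:M x) (row_mxEl (s0 * a)%:M (scale_row p (fun i => Num.sqrt (1 + l' i)%R) x)) (ord1 k) !mxE eqxx !mulr1n; congr (Num.sqrt (1 + l _) * _)%R.
    exact: val_inj.
  by rewrite (row_mxEr a%:M x) (row_mxEr (s0 * a)%:M (scale_row p (fun i => Num.sqrt (1 + l' i)%R) x)) !mxE /l' lift_r.
have mg : measurable_fun setT (fun z : R * 'rV[R]_p =>
    f (row_mx z.1%:M z.2) * (tilt_row p l' z.2)%:E).
  apply: emeasurable_funM.
    exact: (measurableT_comp mf (measurable_mx_cons R p)).
  exact: (measurableT_comp (mEtilt _ _)).
have g0 (z : R * 'rV[R]_p) : 0 <= f (row_mx z.1%:M z.2) * (tilt_row p l' z.2)%:E.
  by rewrite mule_ge0.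
pose g a := \int[gamma p]_x (f (row_mx a%:M x) * (tilt_row p l' x)%:E).
transitivity (\int[N]_a (g a * (tilt R (l ord0) a)%:E)).
  apply: (integral_tilt R (l ord0) g) => //.
    exact: (@measurable_fun_fubini_tonelli_F _ _ _ _ _ (gamma p) _ mg g0).
  by move=> a; apply: integral_ge0 => x _; exact: (g0 (a, x)).
transitivity (\int[N]_a \int[gamma p]_x
    (f (row_mx a%:M x) * (tilt_row p.+1 l (row_mx a%:M x : 'rV[R]_(1 + p)))%:E)).
  apply: eq_integral => a _.
  rewrite -ge0_integralZr//; first last.
  - by rewrite lee_fin tilt_ge0.
  - by move=> x _; exact: (g0 (a, x)).
  - exact: (emeasurable_funM (mfx a) (mEtilt _ _)).
  apply: eq_integral => x _; rewrite -muleA -EFinM; congr (_ * _%:E).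
  rewrite /tilt_row big_ord_recl mulrC; congr (tilt _ _ _ * _)%R.
    by rewrite mxE; case: splitP => // k _; rewrite (ord1 k) mxE eqxx.
  by apply: eq_bigr => i _; rewrite /l' lift_r (row_mxEr a%:M x).
apply/esym/(integral_gaussian_cons _ p (fun x => f x * (tilt_row p.+1 l x)%:E)).
  exact: (emeasurable_funM mf (mEtilt _ _)).
by move=> x; rewrite mule_ge0.
Qed.

Lemma lee_prod (I : Type) (s : seq I) (a b : I -> \bar R) :
  (forall i, 0 <= a i) -> (forall i, a i <= b i) ->
  \prod_(i <- s) a i <= \prod_(i <- s) b i.
Proof.
move=> a0 ab; elim: s => [|i s IH]; first by rewrite !big_nil.
by rewrite !big_cons lee_pmul// prode_ge0.
Qed.

Lemma integral_tilt_row2 p (l : 'I_p -> R) : (forall i, `|l i| <= 2^-1)%R ->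
  \int[gamma p]_x (tilt_row p l x ^+ 2)%:E <= (expR (\sum_i l i ^+ 2))%:E.
Proof.
move=> l12.
have -> : \int[gamma p]_x (tilt_row p l x ^+ 2)%:E =
    \int[gamma p]_x \prod_i (tilt R (l i) (x 0 i)%R ^+ 2)%:E.
  by apply: eq_integral => x _; rewrite /tilt_row -prodrXl prodEFin.
rewrite (integral_gaussian_row_prod _ _ (fun i y => (tilt R (l i) y ^+ 2)%:E)); last 2 first.
- move=> i; apply/measurable_EFinP; apply: measurable_funX; exact: measurable_tilt.
- by move=> i x; rewrite lee_fin sqr_ge0.
apply: (@le_trans _ _ (\prod_i (expR (l i ^+ 2))%:E)).
  apply: lee_prod => i; last exact: integral_tilt2.
  by apply: integral_ge0 => x _; rewrite lee_fin sqr_ge0.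
by rewrite prodEFin expR_sum.
Qed.

(** On the entries of M listed in one row, right multiplication by U acts as an
    orthogonal matrix of size m n. *)
Lemma gaussian_orthogonal m n (U : 'M[R]_n) (F : 'M[R]_(m, n) -> \bar R) :
  (U *m U^T = 1%:M)%R -> measurable_fun setT F -> (forall M, 0 <= F M) ->
  \int[gaussian R m n]_M F (M *m U)%R = \int[gaussian R m n]_M F M.
Proof.
move=> UU mF F0.
have mFU : measurable_fun [set: 'M[R]_(m, n)] (fun M => F (M *m U)%R).
  by apply: (measurableT_comp mF); exact: measurable_mulmxr.
rewrite (integral_gaussian _ _ _ _ mFU)// (integral_gaussian _ _ _ _ mF)//.
pose W := lin_mx (mulmxr U : 'M[R]_(m, n) -> _).
transitivity (\int[gamma (m * n)]_x F (vec_mx (x *m W)%R)).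
  by apply: eq_integral => x _; rewrite /W mul_rV_lin /= mxvecK.
apply: (gaussian_row_orthogonal _ _ W (fun x => F (vec_mx x))) => //.
  exact: lin_mulmxr_orthogonal.
by apply: (measurableT_comp mF); exact: measurable_vec_mx.
Qed.

(** Change of measure. If [C^T C = B^T (1 + K) B], the law of [M *m C] is that of
    the image of [M *m B] when the standard law is replaced by the Gaussian law
    of covariance 1 + K. In an orthonormal basis of eigenvectors of K the density
    factorizes, and the arithmetic-geometric mean inequality separates it from
    the test function. *)
Lemma gaussian_second_moment L p r (K : 'M[R]_p) (B C : 'M[R]_(p, r))
    (F : 'M[R]_(L, r) -> \bar R) (t : R) :
  (0 < t)%R -> K^T = K ->
  (forall u : 'rV[R]_p, `|(u *m K *m u^T) 0 0| <= 2^-1 * (u *m u^T) 0 0)%R ->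
  (C^T *m C = B^T *m (1%:M + K) *m B)%R ->
  measurable_fun setT F -> (forall M, 0 <= F M <= 1) ->
  \int[gaussian R L p]_M F (M *m C)%R <=
  (t / 2)%:E * \int[gaussian R L p]_M F (M *m B)%R +
  (expR (L%:R * \tr (K *m K)) / (2 * t))%:E.
Proof.
move=> t0 KT K12 CB mF F01.
have F0 M : 0 <= F M by have /andP[] := F01 M.
have mFr (D : 'M[R]_(p, r)) : measurable_fun setT (fun M : 'M[R]_(L, p) => F (M *m D)%R).
  by apply: (measurableT_comp mF); exact: measurable_mulmxr.
have [V VV [d KE]] := symmetric_diagonalization _ _ _ KT.
have VVt : (V^T *m V = 1%:M)%R by apply: mulmx1C.
have d12 i : (`|d 0 i| <= 2^-1)%R.
  have := K12 (delta_mx 0 i *m V^T)%R.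
  rewrite !trmx_mul trmxK trmx_delta KE -!mulmxA !(mulmxA V^T V) VVt !mul1mx.
  rewrite mul_delta_mx mulmxA -rowE row_diag_mx -scalemxAl mul_delta_mx !mxE !eqxx.
  by rewrite !mulr1.
have trK : (\tr (K *m K) = \sum_j d 0 j ^+ 2)%R.
  rewrite KE -!mulmxA !(mulmxA V^T V) VVt !mul1mx mxtrace_mulC -!mulmxA VVt mulmx1.
  by rewrite mulmx_diag mxtrace_diag; apply: eq_bigr => j _; rewrite mxE expr2.
pose s := (\row_j Num.sqrt (1 + d 0 j))%R.
pose D := (diag_mx s *m (V^T *m B))%R.
have ss : (diag_mx s *m diag_mx s = 1%:M + diag_mx d)%R.
  rewrite mulmx_diag; apply/matrixP => i j; rewrite !mxE -mulrnDl.
  have [->|_] := eqVneq i j; last by rewrite !mulr0n.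
  rewrite !mulr1n -expr2 sqr_sqrtr//.
  by have := d12 j; rewrite ler_norml => /andP[dj _]; lra.
have [U UU CU] : exists2 U : 'M[R]_p, (U *m U^T = 1%:M)%R & (C^T *m U = D^T)%R.
  apply: gram_orthogonal; rewrite !trmxK CB /D !trmx_mul trmxK tr_diag_mx.
  rewrite -!mulmxA (mulmxA (diag_mx s)) ss; congr (_ *m _)%R.
  by rewrite !mulmxDl !mulmxDr !mul1mx !mulmxA VV mul1mx KE.
have DU : (D = U^T *m C)%R by rewrite -[D]trmxK -CU trmx_mul trmxK.
have UUt : (U^T *m U^T^T = 1%:M)%R by rewrite trmxK; apply: mulmx1C.
pose l (k : 'I_(L * p)) : R := mxvec (\matrix_(i < L, j < p) d 0 j)%R 0%R k.
have l12 k : (`|l k| <= 2^-1)%R.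
  by case/mxvec_indexP: k => i j; rewrite /l mxvecE mxE.
have l2 : (\sum_k l k ^+ 2 = L%:R * \tr (K *m K))%R.
  rewrite trK (sum_mxvec _ _ _ _ (fun y => y ^+ 2)%R).
  under eq_bigr do under eq_bigr do rewrite mxE.
  by rewrite sumr_const card_ord mulr_natl.
pose f (x : 'rV[R]_(L * p)) := F (vec_mx x *m (V^T *m B))%R.
have mf : measurable_fun setT f.
  exact: (measurableT_comp (mFr _) (measurable_vec_mx R L p)).
have f0 x : 0 <= f x by exact: F0.
have -> : \int[gaussian R L p]_M F (M *m C)%R =
    \int[gamma (L * p)]_x (f x * (tilt_row (L * p) l x)%:E).
  transitivity (\int[gaussian R L p]_M F (M *m D)%R).
    rewrite DU; transitivity (\int[gaussian R L p]_M F (M *m U^T *m C)%R).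
      exact/esym/(gaussian_orthogonal _ _ U^T (fun M => F (M *m C)%R)).
    by apply: eq_integral => M _; rewrite mulmxA.
  rewrite (integral_gaussian _ _ _ (fun M => F (M *m D)%R))//.
  transitivity (\int[gamma (L * p)]_x f (scale_row _ (fun k => Num.sqrt (1 + l k)%R) x)).
    apply: eq_integral => x _; congr F; rewrite /D mulmxA; congr (_ *m _)%R.
    apply/matrixP => i j; rewrite mul_mx_diag !mxE.
    by rewrite /l mxvecE mxE mulrC.
  exact: integral_tilt_row.
have -> : \int[gaussian R L p]_M F (M *m B)%R = \int[gamma (L * p)]_x f x.
  transitivity (\int[gaussian R L p]_M F (M *m V^T *m B)%R).
    apply/esym/(gaussian_orthogonal _ _ V^T (fun M => F (M *m B)%R)) => //.
    by rewrite trmxK.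
  rewrite (integral_gaussian _ _ _ (fun M => F (M *m V^T *m B)%R))//.
    by apply: eq_integral => x _; rewrite /f mulmxA.
  exact: (measurableT_comp (mFr _) (measurable_mulmxr _ _ _ _ _)).
have mEtilt : measurable_fun setT (fun x => (tilt_row (L * p) l x)%:E).
  by apply/measurable_EFinP; exact: measurable_tilt_row.
have mEtilt2 : measurable_fun setT (fun x => (tilt_row (L * p) l x ^+ 2)%:E).
  by apply/measurable_EFinP; apply: measurable_funX; exact: measurable_tilt_row.
have t20 : (0 <= t / 2)%R by rewrite divr_ge0 ?ltW.
have t2V : (0 <= (2 * t)^-1)%R by rewrite invr_ge0 mulr_ge0 ?ltW.
have m1 : measurable_fun setT (fun x => (t / 2)%:E * f x).
  exact: (emeasurable_funM (measurable_cst _) mf).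
have m2 : measurable_fun setT
    (fun x => (2 * t)^-1%:E * (tilt_row (L * p) l x ^+ 2)%:E).
  exact: (emeasurable_funM (measurable_cst _) mEtilt2).
apply: (@le_trans _ _ (\int[gamma (L * p)]_x
    ((t / 2)%:E * f x + (2 * t)^-1%:E * (tilt_row (L * p) l x ^+ 2)%:E))).
  apply: ge0_le_integral => //.
  - by move=> x _; rewrite mule_ge0 ?lee_fin ?tilt_row_ge0.
  - exact: (emeasurable_funM mf mEtilt).
  - exact: (emeasurable_funD m1 m2).
  move=> x _; have := F01 (vec_mx x *m (V^T *m B))%R; rewrite -/(f x).
  have := tilt_row_ge0 _ l x; move: (tilt_row _ _ _) => y y0.
  case: (f x) => [z| |]; [|by move=> /andP[]; rewrite leye_eq|by move=> /andP[]; rewrite leeNy_eq].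
  rewrite -!EFinM -EFinD !lee_fin => /andP[z0 z1]; rewrite -subr_ge0.
  have -> : (t / 2 * z + (2 * t)^-1 * y ^+ 2 - z * y =
    ((t * z - y) ^+ 2 + t ^+ 2 * (z * (1 - z))) / (2 * t))%R.
    by field; rewrite gt_eqF.
  have tge0 : (0 <= t)%R := ltW t0.
  by rewrite divr_ge0// ?addr_ge0 ?sqr_ge0// ?mulr_ge0 ?sqr_ge0 ?subr_ge0.
have n1 x : setT x -> 0 <= (t / 2)%:E * f x by rewrite mule_ge0 ?lee_fin.
have n2 x : setT x -> 0 <= (2 * t)^-1%:E * (tilt_row (L * p) l x ^+ 2)%:E.
  by rewrite mule_ge0 ?lee_fin ?sqr_ge0.
rewrite (ge0_integralD _ _ n1 m1 n2 m2)//.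
rewrite !ge0_integralZl//; last by move=> x _; rewrite lee_fin sqr_ge0.
rewrite leeD2l// (mulrC (expR _)) [leRHS]EFinM; apply: lee_wpmul2l; rewrite ?lee_fin//.
by rewrite -l2; exact: integral_tilt_row2.
Qed.

End second_moment.

(** * Orthogonal projection onto the row space of a matrix *)

Section gram_schmidt.
Variable R : rcfType.

Definition sqn q (r : 'rV[R]_q) : R := (r *m r^T) 0 0.

Lemma sqnE q (r : 'rV[R]_q) : sqn q r = \sum_j r 0 j ^+ 2.
Proof. by rewrite /sqn mxE; apply: eq_bigr => j _; rewrite mxE expr2. Qed.

Lemma sqn_ge0 q (r : 'rV[R]_q) : 0 <= sqn q r.
Proof. by rewrite sqnE; apply: sumr_ge0 => j _; exact: sqr_ge0. Qed.

Lemma sqn_eq0 q (r : 'rV[R]_q) : (sqn q r == 0) = (r == 0).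
Proof.
rewrite sqnE psumr_eq0 => [|j _]; last exact: sqr_ge0.
apply/allP/eqP => [r0|-> j _]; last by rewrite mxE expr0n /=.
apply/rowP => j; rewrite mxE; apply/eqP.
by have := r0 j; rewrite mem_index_enum sqrf_eq0; apply.
Qed.

(** One step of Gram-Schmidt orthogonalization adds the projection onto the
    component of the new vector orthogonal to the previous ones. With the
    convention 0^-1 = 0, linearly dependent vectors need no special treatment
    and the projection is an explicit, hence measurable, function of them. *)
Fixpoint gram_schmidt q (s : seq 'rV[R]_q) : 'M[R]_q :=
  if s is b :: s' then
    let P := gram_schmidt q s' in
    let r := b *m (1%:M - P) in P + (sqn q r)^-1 *: (r^T *m r)
  else 0.

Lemma gram_schmidt_sym q s : (gram_schmidt q s)^T = gram_schmidt q s.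
Proof.
elim: s => [|b s IH] /=; first by rewrite trmx0.
by rewrite linearD linearZ /= trmx_mul trmxK IH.
Qed.

Lemma gram_schmidt_idem q s :
  gram_schmidt q s *m gram_schmidt q s = gram_schmidt q s.
Proof.
elim: s => [|b s IH] /=; first by rewrite mul0mx.
set P := gram_schmidt q s in IH *; set r := b *m _.
have PT : P^T = P by exact: gram_schmidt_sym.
have rP : r *m P = 0 by rewrite -mulmxA mulmxBl mul1mx IH subrr mulmx0.
have Pr : P *m r^T = 0 by rewrite -[P]PT -trmx_mul rP trmx0.
have E1 : P *m (r^T *m r) = 0 by rewrite mulmxA Pr mul0mx.
have E2 : r^T *m r *m P = 0 by rewrite -mulmxA rP mulmx0.
have E3 : r^T *m r *m (r^T *m r) = sqn q r *: (r^T *m r).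
  rewrite -mulmxA (mulmxA r) [r *m _]mx11_scalar -/(sqn q r).
  by rewrite mul_scalar_mx -scalemxAr.
rewrite mulmxDl !mulmxDr IH -!scalemxAr -!scalemxAl E1 E2 E3 !scaler0 addr0 add0r.
congr (_ + _).
rewrite !scalerA; have [->|r0] := eqVneq (sqn q r) 0; first by rewrite invr0 !mul0r.
by rewrite mulrAC mulVf// mul1r.
Qed.

Lemma gram_schmidt_fix q s b : b \in s -> b *m gram_schmidt q s = b.
Proof.
elim: s => [//|c s IH] /=; set P := gram_schmidt q s in IH *; set r := c *m _.
have PT : P^T = P by exact: gram_schmidt_sym.
have rP : r *m P = 0.
  by rewrite -mulmxA mulmxBl mul1mx gram_schmidt_idem subrr mulmx0.
have Pr : P *m r^T = 0 by rewrite -[P]PT -trmx_mul rP trmx0.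
rewrite inE => /predU1P[->|/IH bP].
  have cE : c = c *m P + r by rewrite /r mulmxBr mulmx1 addrC subrK.
  have crT : c *m r^T = (sqn q r)%:M.
    have -> : c *m r^T = (c *m P + r) *m r^T by rewrite -cE.
    by rewrite mulmxDl -mulmxA Pr mulmx0 add0r [LHS]mx11_scalar.
  rewrite mulmxDr -scalemxAr mulmxA crT mul_scalar_mx scalerA [RHS]cE.
  congr (_ + _); have [/eqP|r0] := eqVneq (sqn q r) 0; last by rewrite mulVf ?scale1r.
  by rewrite sqn_eq0 => /eqP->; rewrite scaler0.
have br : b *m r^T = 0 by rewrite -bP -mulmxA Pr mulmx0.
by rewrite mulmxDr -scalemxAr mulmxA br mul0mx scaler0 addr0.
Qed.

Lemma gram_schmidt_trace q s : \tr (gram_schmidt q s) <= (size s)%:R.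
Proof.
elim: s => [|b s IH] /=; first by rewrite mxtrace0.
set r := b *m _; rewrite mxtraceD mxtraceZ mxtrace_mulC [r *m _]mx11_scalar.
rewrite -/(sqn q r) mxtrace_scalar -natr1 lerD// mulr1n.
by have [->|r0] := eqVneq (sqn q r) 0; rewrite ?mulr0 ?ler01// mulVf.
Qed.

(** Beside idempotence and symmetry, this inclusion of row spaces says that no
    direction outside the span of the vectors is kept; it is what makes the noise
    bound on the hat matrix possible. *)
Lemma gram_schmidt_sub q s k (B : 'M[R]_(k, q)) :
  (forall b, b \in s -> (b <= B)%MS) -> (gram_schmidt q s <= B)%MS.
Proof.
elim: s => [|b s IH] /= sB; first exact: sub0mx.
have PB : (gram_schmidt q s <= B)%MS by apply: IH => c cs; rewrite sB// inE cs orbT.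
rewrite addmx_sub// scalemx_sub// mulmx_sub// mulmxBr mulmx1 addmx_sub//.
  by rewrite sB// mem_head.
by rewrite -scaleN1r scalemx_sub// mulmx_sub.
Qed.

Lemma gram_schmidt_orthogonal q s (Q : 'M[R]_q) : Q *m Q^T = 1%:M ->
  gram_schmidt q [seq b *m Q | b <- s] = Q^T *m gram_schmidt q s *m Q.
Proof.
move=> QQ; elim: s => [|b s IH] /=; first by rewrite mulmx0 mul0mx.
rewrite IH; set P := gram_schmidt q s.
have -> : b *m Q *m (1%:M - Q^T *m P *m Q) = b *m (1%:M - P) *m Q.
  by rewrite !mulmxBr !mulmx1 !mulmxA -(mulmxA b Q) QQ mulmx1 mulmxBl.
set r := b *m _.
have -> : sqn q (r *m Q) = sqn q r.
  by rewrite /sqn trmx_mul mulmxA -(mulmxA r) QQ mulmx1.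
by rewrite mulmxDr mulmxDl -scalemxAr -scalemxAl trmx_mul !mulmxA.
Qed.

Definition row_proj m q (B : 'M[R]_(m, q)) : 'M[R]_q :=
  gram_schmidt q [seq row i B | i <- enum 'I_m].

Lemma row_proj_fix m q (B : 'M[R]_(m, q)) : B *m row_proj m q B = B.
Proof.
apply/row_matrixP => i; rewrite row_mul gram_schmidt_fix//.
by apply: map_f; rewrite mem_enum.
Qed.

Lemma row_proj_trace m q (B : 'M[R]_(m, q)) : \tr (row_proj m q B) <= m%:R.
Proof. by rewrite (le_trans (gram_schmidt_trace _ _))// size_map size_enum_ord. Qed.

Lemma row_proj_sub m q (B : 'M[R]_(m, q)) : (row_proj m q B <= B)%MS.
Proof. by apply: gram_schmidt_sub => b /mapP[i _ ->]; exact: row_sub. Qed.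

Lemma row_proj_orthogonal m q (B : 'M[R]_(m, q)) (Q : 'M[R]_q) : Q *m Q^T = 1%:M ->
  row_proj m q (B *m Q) = Q^T *m row_proj m q B *m Q.
Proof.
move=> QQ; rewrite -gram_schmidt_orthogonal//; congr gram_schmidt.
by rewrite -[RHS]map_comp; apply: eq_map => i /=; rewrite row_mul.
Qed.

Lemma proj_sqn q (P : 'M[R]_q) (u : 'rV[R]_q) : P^T = P -> P *m P = P ->
  (u *m P *m u^T) 0 0 = sqn q (u *m P).
Proof. by move=> PT PP; rewrite /sqn trmx_mul PT mulmxA -(mulmxA u P P) PP. Qed.

(** Pythagoras' theorem for the decomposition u = u P + u (1 - P). *)
Lemma sqn_proj_le q (P : 'M[R]_q) (u : 'rV[R]_q) : P^T = P -> P *m P = P ->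
  sqn q (u *m P) <= sqn q u.
Proof.
move=> PT PP.
have -> : sqn q u = sqn q (u *m P) + sqn q (u *m (1%:M - P)).
  rewrite -proj_sqn// -proj_sqn; last 2 first.
  - by rewrite linearB /= trmx1 PT.
  - by rewrite mulmxBl mul1mx mulmxBr mulmx1 PP subrr subr0.
  have -> : forall A B : 'M[R]_1, A 0 0 + B 0 0 = (A + B) 0 0 by move=> A B; rewrite mxE.
  by rewrite -mulmxDl -mulmxDr addrC subrK mulmx1.
by rewrite lerDl sqn_ge0.
Qed.

End gram_schmidt.

Section base.
Variables (R : rcfType) (m n : nat) (x0 sigma : R).

(** Each look of the signal x0 (1, ..., 1) is the image by this matrix of a
    standard Gaussian vector, the concatenation of the speckle w and of the
    normalized additive noise. *)
Definition base_mx (A : 'M[R]_(m, n)) : 'M[R]_(m, n + m) :=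
  row_mx (x0 *: A) sigma%:M.

(** The observation at the constant signal only sees the coordinates of the
    Gaussian vector along the row space of the base matrix. *)
Definition base_proj A : 'M[R]_(n + m) := row_proj R m (n + m) (base_mx A).

Lemma base_projT A : (base_proj A)^T = base_proj A.
Proof. exact: gram_schmidt_sym. Qed.

Lemma base_proj_idem A : base_proj A *m base_proj A = base_proj A.
Proof. exact: gram_schmidt_idem. Qed.

(** The block of the projection that concerns the speckle; its diagonal, as the
    leverages in linear regression, measures how much of each coordinate of the
    signal is visible in one look. *)
Definition hat_mx A : 'M[R]_n := ulsubmx (base_proj A).

Lemma hat_mxT A : (hat_mx A)^T = hat_mx A.
Proof. by rewrite /hat_mx trmx_ulsub base_projT. Qed.

(** Rotating the columns of A rotates the row space of the base matrix, with the
    noise coordinates left fixed. *)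
Lemma hat_mx_orthogonal A (Q : 'M[R]_n) : Q *m Q^T = 1%:M ->
  hat_mx (A *m Q) = Q^T *m hat_mx A *m Q.
Proof.
move=> QQ; pose W : 'M[R]_(n + m) := block_mx Q 0 0 1%:M.
have WW : W *m W^T = 1%:M.
  rewrite tr_block_mx !trmx0 trmx1 mulmx_block !mulmx0 !mul0mx mulmx1.
  by rewrite QQ !addr0 add0r -scalar_mx_block.
have BW : base_mx (A *m Q) = base_mx A *m W.
  by rewrite /base_mx mul_row_block !mulmx0 mulmx1 addr0 add0r scalemxAl.
rewrite /hat_mx /base_proj BW row_proj_orthogonal// -/(base_proj A).
rewrite -[base_proj A]submxK tr_block_mx !trmx0 !mulmx_block !mulmx0 !mul0mx.
by rewrite !addr0 !block_mxKul.
Qed.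

Lemma hat_mx_sqn A (u : 'rV[R]_n) :
  (u *m hat_mx A *m u^T) 0 0 = sqn R _ (row_mx u 0 *m base_proj A).
Proof.
rewrite -proj_sqn ?base_projT ?base_proj_idem//; congr (fun_of_matrix _ _ _).
rewrite -[base_proj A]submxK mul_row_block !mul0mx !addr0 tr_row_mx trmx0.
by rewrite mul_row_col mulmx0 addr0.
Qed.

Lemma hat_mx_diag A i :
  hat_mx A i i = sqn R _ (row_mx (delta_mx 0 i) 0 *m base_proj A).
Proof. by rewrite -hat_mx_sqn trmx_delta -rowE -colE !mxE. Qed.

Lemma hat_mx_diag_ge0 A i : 0 <= hat_mx A i i.
Proof. by rewrite hat_mx_diag sqn_ge0. Qed.

Lemma sqn_row_delta i : sqn R _ (row_mx (delta_mx 0 i) 0 : 'rV[R]_(n + m)) = 1.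
Proof.
rewrite /sqn tr_row_mx trmx0 mul_row_col mulmx0 addr0 trmx_delta mul_delta_mx.
by rewrite mxE !eqxx.
Qed.

Lemma hat_mx_diag_le1 A i : hat_mx A i i <= 1.
Proof.
by rewrite hat_mx_diag -(sqn_row_delta i) sqn_proj_le ?base_projT ?base_proj_idem.
Qed.

Lemma hat_mx_trace A : \tr (hat_mx A) <= m%:R.
Proof.
apply: le_trans (row_proj_trace _ _ _ (base_mx A)).
rewrite -[row_proj _ _ _ _]/(base_proj A) -[X in _ <= \tr X]submxK mxtrace_block.
rewrite lerDl; apply: sumr_ge0 => i _.
have -> : drsubmx (base_proj A) i i =
    sqn R _ (row_mx 0 (delta_mx 0 i) *m base_proj A).
  rewrite -proj_sqn ?base_projT ?base_proj_idem//.
  rewrite -[base_proj A]submxK mul_row_block !mul0mx !add0r tr_row_mx trmx0.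
  rewrite mul_row_col mulmx0 add0r trmx_delta -rowE -colE block_mxKdr.
  by rewrite !mxE.
exact: sqn_ge0.
Qed.

(** The left-hand side is part of the squared norm of the i-th row of the
    projection, which is its i-th diagonal entry. *)
Lemma hat_mx_row A i : \sum_j hat_mx A i j ^+ 2 <= hat_mx A i i.
Proof.
have E j : ((row_mx (delta_mx 0 i) 0 : 'rV[R]_(n + m)) *m base_proj A) 0 (lshift m j) = hat_mx A i j.
  rewrite -[base_proj A]submxK mul_row_block !mul0mx !addr0 row_mxEl -rowE mxE.
  by rewrite /hat_mx.
rewrite [leRHS]hat_mx_diag sqnE big_split_ord /= -[leLHS]addr0 lerD//; last first.
  by apply: sumr_ge0 => j _; exact: sqr_ge0.
by apply: ler_sum => j _; rewrite E.
Qed.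

(** If u is the i-th axis, the projection of u on the row space is c B for some
    c, so that H_ii = <c, x0 a_i> by Bu = x0 a_i, while H_ii = |c B| ^ 2 is at
    least sigma ^ 2 |c| ^ 2. The claim is the nonnegativity of
    |sigma ^ 2 c - x0 a_i| ^ 2, where a_i is the i-th column of A. *)
Lemma hat_mx_noise A i :
  sigma ^+ 2 * hat_mx A i i <= x0 ^+ 2 * \sum_r A r i ^+ 2.
Proof.
pose u : 'rV[R]_(n + m) := row_mx (delta_mx 0 i) 0.
have [c uP] : exists c : 'rV[R]_m, u *m base_proj A = c *m base_mx A.
  exists (u *m (base_proj A *m pinvmx (base_mx A))).
  by rewrite -[RHS]mulmxA mulmxKpV// row_proj_sub.
have uB : u *m (base_mx A)^T = x0 *: row i A^T.
  rewrite /u /base_mx tr_row_mx mul_row_col mul0mx addr0 linearZ /= -scalemxAr.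
  by rewrite -rowE.
have PB : base_proj A *m (base_mx A)^T = (base_mx A)^T.
  by rewrite -[in LHS](base_projT A) -trmx_mul row_proj_fix.
have HB : hat_mx A i i = sqn R _ (c *m base_mx A) by rewrite hat_mx_diag -uP.
have Hc : hat_mx A i i = x0 * \sum_r c 0 r * A r i.
  rewrite HB /sqn trmx_mul -uP mulmxA -(mulmxA u) PB uB -scalemxAl 2!mxE.
  by congr (_ * _); apply: eq_bigr => r _; rewrite !mxE mulrC.
have Hs : sigma ^+ 2 * \sum_r c 0 r ^+ 2 <= hat_mx A i i.
  rewrite HB /base_mx mul_mx_row sqnE big_split_ord /= -[leLHS]add0r lerD//.
    by apply: sumr_ge0 => j _; exact: sqr_ge0.
  rewrite mulr_sumr; apply: ler_sum => r _.
  by rewrite row_mxEr mul_mx_scalar mxE exprMn.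
have : 0 <= \sum_r (sigma ^+ 2 * c 0 r - x0 * A r i) ^+ 2.
  by apply: sumr_ge0 => r _; exact: sqr_ge0.
have -> : \sum_r (sigma ^+ 2 * c 0 r - x0 * A r i) ^+ 2 =
    sigma ^+ 2 * (sigma ^+ 2 * \sum_r c 0 r ^+ 2)
    - 2 * (sigma ^+ 2 * (x0 * \sum_r c 0 r * A r i))
    + x0 ^+ 2 * \sum_r A r i ^+ 2.
  rewrite !mulr_sumr -sumrB -big_split /=; apply: eq_bigr => r _; ring.
rewrite -Hc => H; have := ler_wpM2l (sqr_ge0 sigma) Hs.
by move: H; lra.
Qed.

(** The perturbation of the covariance of the Gaussian vector when the signal
    x0 (1, ..., 1) becomes x0 (sqrt (1 + d_1), ..., sqrt (1 + d_n)). *)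
Definition pert_mx (d : 'rV[R]_n) : 'M[R]_(n + m) := block_mx (diag_mx d) 0 0 0.

(** The perturbation is seen through the base matrix only, so it may be
    compressed to the row space. The Hilbert-Schmidt norm of the compression is
    small when the noise is large or m is small with respect to n, while that of
    the uncompressed perturbation is |d| in all cases. *)
Definition cov_shift A d : 'M[R]_(n + m) :=
  base_proj A *m pert_mx d *m base_proj A.

Lemma cov_shiftT A d : (cov_shift A d)^T = cov_shift A d.
Proof.
rewrite /cov_shift !trmx_mul base_projT mulmxA; congr (_ *m _ *m _).
by rewrite /pert_mx tr_block_mx !trmx0 tr_diag_mx.
Qed.

(** By cyclicity of the trace only the upper left block of the projection
    matters. *)
Lemma cov_shift_trace A d : \tr (cov_shift A d *m cov_shift A d) =
  \sum_i \sum_j d 0 i * d 0 j * hat_mx A i j ^+ 2.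
Proof.
rewrite /cov_shift; set P := base_proj A; set J := pert_mx d.
have -> : \tr (P *m J *m P *m (P *m J *m P)) = \tr ((P *m J) *m (P *m J)).
  rewrite mxtrace_mulC !mulmxA -(mulmxA _ P P) base_proj_idem.
  by rewrite mxtrace_mulC !mulmxA base_proj_idem.
rewrite -[P]submxK /J /pert_mx mulmx_block !mulmx0 !addr0 mulmx_block !mulmx0 !mul0mx.
rewrite !addr0 mxtrace_block mxtrace0 addr0 -[ulsubmx P]/(hat_mx A) /mxtrace.
apply: eq_bigr => i _; rewrite mxE; apply: eq_bigr => j _.
rewrite !mul_mx_diag.
have Hji : hat_mx A j i = hat_mx A i j by rewrite -[in LHS](hat_mxT A) mxE.
by rewrite [in LHS]mxE [X in _ * X]mxE Hji; ring.
Qed.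

Lemma cov_shift_le A (d : 'rV[R]_n) (e : R) (u : 'rV[R]_(n + m)) :
  0 <= e -> (forall j, `|d 0 j| <= e) ->
  `|(u *m cov_shift A d *m u^T) 0 0| <= e * (u *m u^T) 0 0.
Proof.
move=> e0 de; rewrite -/(sqn R _ u).
have -> : u *m cov_shift A d *m u^T =
    (u *m base_proj A) *m pert_mx d *m (u *m base_proj A)^T.
  by rewrite trmx_mul base_projT !mulmxA.
apply: (@le_trans _ _ (e * sqn R _ (u *m base_proj A))); last first.
  by rewrite ler_wpM2l// sqn_proj_le ?base_projT ?base_proj_idem.
move: (u *m base_proj A) => v; rewrite -[v]hsubmxK; move: (lsubmx v) (rsubmx v) => a b.
rewrite /pert_mx mul_row_block !mulmx0 !addr0 tr_row_mx mul_row_col mul0mx addr0.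
rewrite mul_mx_diag mxE sqnE big_split_ord /= mulrDr.
apply: (le_trans (ler_norm_sum _ _ _)); apply: ler_wpDr.
  by rewrite mulr_ge0//; apply: sumr_ge0 => j _; exact: sqr_ge0.
rewrite mulr_sumr; apply: ler_sum => j _; rewrite row_mxEl !mxE.
rewrite mulrAC -expr2 normrM mulrC (ger0_norm (sqr_ge0 _)).
by rewrite ler_wpM2r ?sqr_ge0.
Qed.

Definition signal_mx A (x : 'rV[R]_n) : 'M[R]_(m, n + m) :=
  row_mx (A *m diag_mx x) sigma%:M.

(** The projection fixes the rows of the base matrix, so that compressing the
    perturbation does not change the covariance of the observation. *)
Lemma signal_mx_cov A (d x : 'rV[R]_n) :
  (forall j, x 0 j ^+ 2 = x0 ^+ 2 * (1 + d 0 j)) ->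
  signal_mx A x *m (signal_mx A x)^T =
  base_mx A *m (1%:M + cov_shift A d) *m (base_mx A)^T.
Proof.
move=> xd.
have BP : base_mx A *m base_proj A = base_mx A by exact: row_proj_fix.
have PB : base_proj A *m (base_mx A)^T = (base_mx A)^T.
  by rewrite -[in LHS](base_projT A) -trmx_mul BP.
rewrite mulmxDr mulmxDl mulmx1 /cov_shift !mulmxA BP -(mulmxA _ (base_proj A)) PB.
rewrite -mulmxDl -[X in (X + _)]mulmx1 -mulmxDr /signal_mx /base_mx /pert_mx.
have -> : 1%:M + block_mx (diag_mx d) 0 0 0 =
    block_mx (1%:M + diag_mx d) 0 0 1%:M :> 'M[R]_(n + m).
  by rewrite [1%:M in LHS]scalar_mx_block add_block_mx !addr0.
rewrite mul_row_block !mulmx0 addr0 add0r.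
rewrite mulmx1 !tr_row_mx !mul_row_col; congr (_ + _).
rewrite trmx_mul tr_diag_mx !mulmxA -(mulmxA A) mulmx_diag.
rewrite linearZ /= -scalemxAl -scalemxAl -scalemxAr scalerA -expr2.
rewrite scalemxAl scalemxAr; congr (_ *m _ *m _); apply/matrixP => i j.
rewrite !mxE -mulrnDl; have [->|_] := eqVneq i j; last by rewrite !mulr0n mulr0.
by rewrite !mulr1n -expr2 xd.
Qed.

End base.

(** * Second moment of the diagonal of the projection *)

Section projection_moment.
Variable R : realType.

Lemma measurable_gram_schmidt d (T : measurableType d) q (fs : seq (T -> 'rV[R]_q)) :
  (forall f, List.In f fs -> measurable_fun setT f) ->
  measurable_fun setT (fun t => gram_schmidt R q [seq f t | f <- fs]).
Proof.
elim: fs => [|b fs IH] /= mfs; first exact: measurable_cst.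
have mP := IH (fun f ffs => mfs f (or_intror ffs)).
have mb := mfs b (or_introl erefl).
set P := fun t => gram_schmidt R q [seq f t | f <- fs] in mP *.
have mr : measurable_fun setT (fun t => b t *m (1%:M - P t)).
  apply: measurable_mulmx => //; apply: measurable_mx => i j.
  rewrite (_ : (fun _ => _) = fun t => (1%:M : 'M[R]_q) i j - P t i j); last first.
    by apply/funext => t; rewrite !mxE.
  by apply: measurable_funB => //; exact: (measurableT_comp (measurable_mx_coord _ _ _ _ i j)).
have mrT := measurable_trmx _ _ _ _ _ _ mr.
set r := (X in measurable_fun setT X) in mr mrT.
have mrr := measurable_mulmx _ _ _ _ _ _ _ _ mr mrT.
have mrr' := measurable_mulmx _ _ _ _ _ _ _ _ mrT mr.
(* The inverse of a nonnegative real is its power of exponent -1. *)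
apply: measurable_mx => i j.
rewrite (_ : (fun _ => _) = fun t => P t i j +
    (r t *m (r t)^T) 0 0 `^ (-1) * ((r t)^T *m r t) i j); last first.
  by apply/funext => t; rewrite powR_inv1 ?(sqn_ge0 _ _ (r t))// mxE [X in _ + X = _]mxE.
apply: measurable_funD; first exact: (measurableT_comp (measurable_mx_coord _ _ _ _ i j)).
apply: measurable_funM; last exact: (measurableT_comp (measurable_mx_coord _ _ _ _ i j)).
apply: (@measurableT_comp _ _ _ _ _ _ (fun y : R => y `^ (-1))); first exact: measurable_powR.
exact: (measurableT_comp (measurable_mx_coord _ _ _ _ 0 0)).
Qed.

Lemma measurable_row_proj d (T : measurableType d) m q (B : T -> 'M[R]_(m, q)) :
  measurable_fun setT B -> measurable_fun setT (fun t => row_proj R m q (B t)).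
Proof.
move=> mB.
rewrite (_ : (fun _ => _) = fun t =>
    gram_schmidt R q [seq f t | f <- [seq (fun t => row i (B t)) | i <- enum 'I_m]]).
  apply: measurable_gram_schmidt => f.
  have : forall s : seq 'I_m, List.In f [seq (fun t => row i (B t)) | i <- s] ->
      exists i, f = fun t => row i (B t).
    elim=> [//|i s IH] /= [<-|/IH//]; by exists i.
  move=> /[apply] -[i ->]; apply: measurable_mx => k j.
  rewrite (_ : (fun _ => _) = fun t => B t i j); last by apply/funext => t; rewrite mxE.
  exact: (measurableT_comp (measurable_mx_coord _ _ _ _ i j)).
by apply/funext => t; rewrite /row_proj -map_comp.
Qed.

Section moment.
Variables (m n : nat) (x0 sigma : R).
Local Notation H := (hat_mx R m n x0 sigma).
Local Notation Gam := (gaussian R m n).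

Lemma measurable_base_mx : measurable_fun setT (base_mx R m n x0 sigma).
Proof.
apply: measurable_row_mx => //; apply: measurable_mx => i j.
rewrite (_ : (fun _ => _) = fun A : 'M[R]_(m, n) => x0 * A i j); last first.
  by apply/funext => t; rewrite mxE.
by apply: measurable_funM => //; exact: measurable_mx_coord.
Qed.

Lemma measurable_base_proj : measurable_fun setT (base_proj R m n x0 sigma).
Proof. apply: measurable_row_proj; exact: measurable_base_mx. Qed.

Lemma measurable_hat_mx : measurable_fun setT H.
Proof.
apply: measurable_mx => i j.
rewrite (_ : (fun _ => _) = fun A => base_proj R m n x0 sigma A (lshift m i) (lshift m j)).
  apply: (measurableT_comp (measurable_mx_coord _ _ _ _ _ _)); exact: measurable_base_proj.
by apply/funext => A; rewrite /hat_mx !mxE.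
Qed.

Lemma measurable_hat_form (u : 'rV[R]_n) :
  measurable_fun setT (fun A => (u *m H A *m u^T) 0 0).
Proof.
apply: (measurableT_comp (measurable_mx_coord _ _ _ _ 0 0)).
apply: measurable_mulmx => //; apply: measurable_mulmx => //.
exact: measurable_hat_mx.
Qed.

Local Open Scope ereal_scope.

Lemma integral_gaussian_entry (f : R -> \bar R) i j :
  measurable_fun setT f -> (forall x, 0 <= f x) ->
  \int[Gam]_A f (A i j) = \int[stdnormal R]_x f x.
Proof.
move=> mf f0; rewrite (integral_gaussian _ _ _ (fun A => f (A i j)))//; last first.
  apply: (measurableT_comp mf); exact: measurable_mx_coord.
pose k0 := mxvec_index i j.
pose g k : R -> \bar R := if k == k0 then f else cst 1.
transitivity (\int[gaussian_row R (m * n)]_x \prod_k g k (x 0 k)%R).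
  apply: eq_integral => x _; rewrite (bigD1 k0)//= big1 => [|k /negPf kk0].
    by rewrite mule1 /g eqxx mxE.
  by rewrite /g kk0.
rewrite (integral_gaussian_row_prod _ _ g); last 2 first.
- by move=> k; rewrite /g; case: ifP.
- by move=> k x; rewrite /g; case: ifP => // _; rewrite lee_fin.
rewrite (bigD1 k0)//= big1 => [|k /negPf kk0]; first by rewrite mule1 /g eqxx.
rewrite /g kk0 integral_cst// mul1e; exact: probability_setT.
Qed.

End moment.

(** The Cauchy-Schwarz inequality with a constant vector, from the sum of the
    squares (v_r - v_s) ^ 2. *)
Lemma sqr_sum_le p (v : 'I_p -> R) :
  (\sum_r v r) ^+ 2 <= p%:R * \sum_r v r ^+ 2.
Proof.
have : 0 <= \sum_r \sum_s (v r - v s) ^+ 2.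
  by apply: sumr_ge0 => r _; apply: sumr_ge0 => s _; exact: sqr_ge0.
have -> : \sum_r \sum_s (v r - v s) ^+ 2 =
    2 * (p%:R * \sum_r v r ^+ 2) - 2 * (\sum_r v r) ^+ 2.
  have -> : p%:R * \sum_r v r ^+ 2 = \sum_r \sum_(s < p) v r ^+ 2.
    by rewrite mulr_sumr; apply: eq_bigr => r _; rewrite sumr_const card_ord mulr_natl.
  have {1}-> : \sum_r \sum_(s < p) v r ^+ 2 =
      2^-1 * (\sum_r \sum_(s < p) v r ^+ 2 + \sum_(r < p) \sum_s v s ^+ 2).
    by rewrite [X in _ + X]exchange_big /=; field.
  rewrite mulrA mulfV// mul1r expr2 mulr_suml mulr_sumr -big_split -sumrB /=.
  apply: eq_bigr => r _; rewrite !mulr_sumr -big_split -sumrB /=.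
  by apply: eq_bigr => s _; ring.
by lra.
Qed.

Section moment_bound.
Variables (m n : nat) (x0 sigma : R).
Hypotheses (m_gt0 : (0 < m)%N).
Local Notation H := (hat_mx R m n.+1 x0 sigma).
Local Notation Gam := (gaussian R m n.+1).
Local Open Scope ereal_scope.

Let a_ := \int[Gam]_A ((H A 0%R 0%R) ^+ 2)%:E.

Let measurable_form2 (u : 'rV[R]_n.+1) :
  measurable_fun setT (fun A => ((u *m H A *m u^T) 0 0 ^+ 2)%R%:E).
Proof.
by apply/measurable_EFinP; apply: measurable_funX; exact: measurable_hat_form.
Qed.

Let diagE A i : (H A i i =
  ((delta_mx 0 i : 'rV[R]_n.+1) *m H A *m (delta_mx 0 i : 'rV[R]_n.+1)^T) 0 0)%R.
Proof. by rewrite trmx_delta -rowE -colE !mxE. Qed.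

(** The law of A is invariant under right multiplication by orthogonal matrices,
    so the second moment of the quadratic form u H u^T depends on |u| only. *)
Lemma integral_hat_form (u : 'rV[R]_n.+1) :
  \int[Gam]_A ((u *m H A *m u^T) 0 0 ^+ 2)%R%:E = (sqn R _ u ^+ 2)%:E * a_.
Proof.
have [U UU [r r0 uU]] := orthogonal_to_axis R n u.
have uUE : (u *m U = r *: delta_mx 0 0)%R.
  rewrite uU; apply/rowP => j; have [k|k] := split_ordP (j : 'I_(1 + n)) => ->.
    rewrite (row_mxEl r%:M) (ord1 k) [in LHS]mxE eqxx mulr1n.
    have -> : lshift n (0%R : 'I_1) = ord0 :> 'I_n.+1 by exact: val_inj.
    by rewrite !mxE !eqxx mulr1.
  by rewrite (row_mxEr r%:M) !mxE /= mulr0.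
have ur : (sqn R _ u = r ^+ 2)%R.
  have -> : (sqn R _ u = sqn R _ (u *m U))%R.
    by rewrite /sqn trmx_mul mulmxA -(mulmxA u) UU mulmx1.
  rewrite uUE /sqn linearZ /= -scalemxAl -scalemxAr scalerA trmx_delta mul_delta_mx.
  by rewrite !mxE !eqxx mulr1 expr2.
have UUt : (U^T *m U^T^T = 1%:M)%R by rewrite trmxK; apply: mulmx1C.
transitivity (\int[Gam]_A (((u *m H (A *m U^T) *m u^T) 0 0) ^+ 2)%R%:E).
  apply/esym/(gaussian_orthogonal _ _ _ U^T (fun A => ((u *m H A *m u^T) 0 0 ^+ 2)%R%:E)) => //.
  by move=> A; rewrite lee_fin sqr_ge0.
transitivity (\int[Gam]_A ((sqn R _ u ^+ 2)%:E * (H A 0%R 0%R ^+ 2)%:E)).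
  apply: eq_integral => A _; rewrite hat_mx_orthogonal// trmxK.
  have -> : (u *m (U *m H A *m U^T) *m u^T = (u *m U) *m H A *m (u *m U)^T)%R.
    by rewrite trmx_mul !mulmxA.
  rewrite uUE linearZ /= -!scalemxAl -scalemxAr scalerA -expr2 -ur -EFinM.
  by rewrite mxE -diagE exprMn.
rewrite ge0_integralZl//.
- apply/measurable_EFinP; apply: measurable_funX.
  exact: (measurableT_comp (measurable_mx_coord _ _ _ _ _ _) (measurable_hat_mx _ _ _ _)).
- by move=> A _; rewrite lee_fin sqr_ge0.
- by rewrite lee_fin sqr_ge0.
Qed.

Lemma integral_hat_diag i : \int[Gam]_A (H A i i ^+ 2)%:E = a_.
Proof.
under eq_integral do rewrite diagE.
rewrite (integral_hat_form (delta_mx 0%R i)) /sqn trmx_delta mul_delta_mx mxE !eqxx.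
by rewrite expr1n mul1e.
Qed.

Let a_ge0 : 0 <= a_.
Proof. by apply: integral_ge0 => A _; rewrite lee_fin sqr_ge0. Qed.

Let a_le1 : a_ <= 1.
Proof.
apply: (@le_trans _ _ (\int[Gam]_A (cst 1) A)).
  apply: ge0_le_integral => //.
  - by move=> A _; rewrite lee_fin sqr_ge0.
  - by under eq_fun do rewrite diagE; exact: measurable_form2.
  - move=> A _; rewrite lee_fin expr_le1// ?hat_mx_diag_le1//.
    exact: hat_mx_diag_ge0.
by rewrite integral_cst// mul1e (le_trans (probability_le1 Gam measurableT)).
Qed.

(** Polarization: summing the second moments of the quadratic form over all
    vectors e_i + e_j and e_i - e_j produces the moments of the diagonal, of the
    trace and of the Hilbert-Schmidt norm, and the last two are at most m ^ 2
    and m. *)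
Lemma hat_diag_moment_dim : a_ <= (3 * (m%:R / n.+1%:R) ^+ 2)%:E.
Proof.
pose N : R := n.+1%:R.
have [a aE] : exists a : R, a_ = a%:E.
  exists (fine a_); rewrite fineK// ge0_fin_numE//.
  by rewrite (le_lt_trans a_le1)// ltry.
have a0 : (0 <= a)%R by rewrite -lee_fin -aE.
pose u s i j : 'rV[R]_n.+1 := (delta_mx 0 i + s *: delta_mx 0 j)%R.
pose q s i j A : R := ((u s i j *m H A *m (u s i j)^T) 0 0 ^+ 2)%R.
have qE s i j A : (q s i j A = (H A i i + 2 * s * H A i j + s ^+ 2 * H A j j) ^+ 2)%R.
  rewrite /q /u; have := hat_mxT _ _ _ x0 sigma A; move: (H A) => h hT.
  have hji : (h j i = h i j)%R by rewrite -[in LHS]hT mxE.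
  rewrite linearD linearZ /= !trmx_delta mulmxDl mulmxDr !mulmxDl.
  rewrite -!scalemxAr -!scalemxAl -!rowE -!colE !scalerA !mxE hji.
  by congr (_ ^+ 2)%R; ring.
have q0 s i j A : 0 <= (q s i j A)%:E by rewrite lee_fin sqr_ge0.
have mq s i j : measurable_fun setT (fun A => (q s i j A)%:E).
  exact: measurable_form2.
have Iq s i j : (s ^+ 2 = 1)%R -> \int[Gam]_A (q s i j A)%:E =
    ((2 + 2 * s * (i == j)%:R) ^+ 2 * a)%:E.
  move=> s1; rewrite /q integral_hat_form aE -EFinM; congr (_ ^+ 2 * _)%R%:E.
  rewrite /sqn /u linearD linearZ /= !trmx_delta mulmxDl !mulmxDr.
  rewrite -!scalemxAr -!scalemxAl scalerA !mul_delta_mx_cond !mxE !eqxx.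
  by rewrite -expr2 s1 (eq_sym j i); case: (i == j); rewrite /= ?mulr1n ?mulr0n !mxE /= ?mulr1n; ring.
pose S A : R := (\sum_i \sum_j (q 1 i j A + q (-1) i j A))%R.
have IS : \int[Gam]_A (S A)%:E = ((8 * N ^+ 2 + 8 * N) * a)%:E.
  have -> : (fun A => (S A)%:E) = fun A =>
      \sum_i \sum_j ((q 1 i j A)%:E + (q (-1) i j A)%:E).
    apply/funext => A; rewrite /S -sumEFin; apply: eq_bigr => i _.
    by rewrite -sumEFin; apply: eq_bigr => j _; rewrite EFinD.
  have mqq i j : measurable_fun setT (fun A => (q 1 i j A)%:E + (q (-1) i j A)%:E).
    exact: emeasurable_funD.
  have qq0 i j A : 0 <= (q 1 i j A)%:E + (q (-1) i j A)%:E by rewrite adde_ge0.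
  rewrite ge0_integral_sum//; last 2 first.
  - by move=> i; exact: emeasurable_sum.
  - by move=> i A _; exact: sume_ge0.
  have -> : ((8 * N ^+ 2 + 8 * N) * a =
      \sum_(i < n.+1) \sum_(j < n.+1) (8 + 8 * (i == j)%:R) * a)%R.
    under eq_bigr => i _.
      rewrite -mulr_suml big_split /= sumr_const card_ord -mulr_sumr.
      rewrite (bigD1 i)//= eqxx big1 => [|j /negPf ji]; last by rewrite eq_sym ji.
      over.
    by rewrite sumr_const card_ord -(mulr_natr (_ * a)) -(mulr_natr 8) -/N /= addr0; ring.
  rewrite -sumEFin; apply: eq_bigr => i _.
  rewrite ge0_integral_sum// -sumEFin; apply: eq_bigr => j _.
  rewrite ge0_integralD// !Iq ?sqrrN ?expr1n// -EFinD; congr (_%:E).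
  by case: (i == j) => /=; ring.
have SE A : (S A <= 4 * N * (\sum_i H A i i ^+ 2) + (4 * m%:R ^+ 2 + 8 * m%:R))%R.
  have tr0 : (0 <= \tr (H A))%R by apply: sumr_ge0 => i _; exact: hat_mx_diag_ge0.
  have trm : (\tr (H A) <= m%:R)%R := hat_mx_trace _ _ _ _ _ _.
  have hs : (\sum_i \sum_j H A i j ^+ 2 <= m%:R)%R.
    by apply: le_trans trm; apply: ler_sum => i _; exact: hat_mx_row.
  have -> : (S A = 4 * N * (\sum_i H A i i ^+ 2) + 4 * \tr (H A) ^+ 2 +
      8 * \sum_i \sum_j H A i j ^+ 2)%R.
    transitivity (\sum_i (2 * N * H A i i ^+ 2 + 4 * (H A i i * \tr (H A)) +
        2 * (\sum_j H A j j ^+ 2) + 8 * \sum_j H A i j ^+ 2))%R.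
      apply: eq_bigr => i _; rewrite /mxtrace !mulr_sumr.
      have -> : (2 * N * H A i i ^+ 2 = \sum_(j < n.+1) 2 * H A i i ^+ 2)%R.
        by rewrite sumr_const card_ord -mulr_natl -/N; ring.
      by rewrite -!big_split /=; apply: eq_bigr => j _; rewrite !qE; ring.
    rewrite !big_split /= -!mulr_sumr -mulr_suml -/(\tr (H A)) sumr_const card_ord.
    by rewrite -(mulr_natr (\sum_j H A j j ^+ 2)%R) -/N; ring.
  rewrite -addrA lerD2l lerD//; last by rewrite ler_pM2l.
  by rewrite ler_pM2l// ler_pXn2r// nnegrE.
have ub : ((8 * N ^+ 2 + 8 * N) * a)%:E <= (4 * N * (N * a) + (4 * m%:R ^+ 2 + 8 * m%:R))%:E.
  have mH i : measurable_fun setT (fun A => (H A i i ^+ 2)%:E).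
    by under eq_fun do rewrite diagE; exact: measurable_form2.
  have H0 i A : 0 <= (H A i i ^+ 2)%:E by rewrite lee_fin sqr_ge0.
  have mS : measurable_fun setT S.
    apply: measurable_sum => i; apply: measurable_sum => j.
    by apply: measurable_funD; apply/measurable_EFinP; exact: mq.
  rewrite -IS; apply: (@le_trans _ _ (\int[Gam]_A ((4 * N)%:E * \sum_i (H A i i ^+ 2)%:E +
      (4 * m%:R ^+ 2 + 8 * m%:R)%:E))).
    apply: ge0_le_integral => //.
    - move=> A _; rewrite lee_fin; apply: sumr_ge0 => i _; apply: sumr_ge0 => j _.
      by rewrite addr_ge0 ?sqr_ge0.
    - exact/measurable_EFinP.
    - apply: emeasurable_funD => //; apply: emeasurable_funM => //.
      exact: emeasurable_sum.
    - by move=> A _; rewrite sumEFin -EFinM -EFinD lee_fin.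
  have mSH : measurable_fun setT (fun A => \sum_i (H A i i ^+ 2)%:E).
    exact: emeasurable_sum.
  have SH0 A : setT A -> 0 <= \sum_i (H A i i ^+ 2)%:E by move=> _; exact: sume_ge0.
  rewrite (ge0_integralD _ measurableT (f1 := fun A => (4 * N)%:E * \sum_i (H A i i ^+ 2)%:E)
    (f2 := cst (4 * m%:R ^+ 2 + 8 * m%:R)%:E)); last 4 first.
  - by move=> A _; apply: mule_ge0; [rewrite lee_fin mulr_ge0|exact: SH0].
  - exact: emeasurable_funM.
  - by move=> A _; rewrite lee_fin addr_ge0.
  - exact: measurable_cst.
  rewrite (ge0_integralZl _ measurableT mSH SH0); last by rewrite lee_fin mulr_ge0.
  rewrite ge0_integral_sum// (eq_bigr (fun=> a%:E)) => [|i _]; last first.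
    by rewrite integral_hat_diag aE.
  rewrite sumEFin sumr_const card_ord -[(a *+ _)%R]mulr_natl -/N -EFinM.
  rewrite integral_cst// [leRHS]EFinD; apply: leeD => //.
  rewrite -[leRHS]mule1; apply: lee_wpmul2l; last exact: probability_le1.
  by rewrite lee_fin addr_ge0.
move: ub; rewrite aE !lee_fin => ub.
have N1 : (1 <= N)%R by rewrite ler1n.
have m1 : (1 <= m%:R :> R)%R by rewrite ler1n.
rewrite expr_div_n mulrA ler_pdivlMr; last by rewrite exprn_gt0// ltr0n.
rewrite -/N; move: ub a0 N1 m1; move: (N) (m%:R : R)%R => y z ub a0' y1 z1.
have y2 : (0 <= a * y)%R by rewrite mulr_ge0// (le_trans _ y1).
by nra.
Qed.

(** Bound by the noise: H_ii is at most x0 ^ 2 |a_i| ^ 2 / sigma ^ 2, and the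
    fourth moment of the normal law controls the second moment of |a_i| ^ 2. *)
Lemma hat_diag_moment_noise :
  (sigma ^+ 4)%:E * a_ <= (64 * Num.sqrt 2 * x0 ^+ 4 * m%:R ^+ 2)%:E.
Proof.
have m4 r : measurable_fun setT (fun A : 'M[R]_(m, n.+1) => (A r 0%R ^+ 4)%:E).
  by apply/measurable_EFinP; apply: measurable_funX; exact: measurable_mx_coord.
have c0 : 0 <= (x0 ^+ 4 * m%:R)%:E by rewrite lee_fin mulr_ge0 ?exprn_even_ge0.
have p40 y : 0 <= (y ^+ 4)%:E :> \bar R by rewrite lee_fin exprn_even_ge0.
have mH : measurable_fun setT (fun A => (H A 0%R 0%R ^+ 2)%:E).
  by under eq_fun do rewrite diagE; exact: measurable_form2.
have H20 A : 0 <= (H A 0%R 0%R ^+ 2)%:E by rewrite lee_fin sqr_ge0.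
rewrite -ge0_integralZl//.
apply: (@le_trans _ _ (\int[Gam]_A ((x0 ^+ 4 * m%:R)%:E * \sum_r (A r 0%R ^+ 4)%:E))).
  apply: ge0_le_integral => //.
  - by move=> A _; rewrite mule_ge0.
  - exact: emeasurable_funM.
  - by apply: emeasurable_funM => //; exact: emeasurable_sum.
  move=> A _; rewrite sumEFin -!EFinM lee_fin.
  have h1 := hat_mx_noise _ _ _ x0 sigma A 0%R.
  have h0 : (0 <= sigma ^+ 2 * H A 0%R 0%R)%R by rewrite mulr_ge0 ?sqr_ge0 ?hat_mx_diag_ge0.
  have -> : (sigma ^+ 4 * H A 0%R 0%R ^+ 2 = (sigma ^+ 2 * H A 0%R 0%R) ^+ 2)%R by ring.
  apply: (@le_trans _ _ ((x0 ^+ 2 * \sum_r A r 0%R ^+ 2) ^+ 2)%R).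
    by rewrite ler_pXn2r// nnegrE// (le_trans h0).
  have -> : (x0 ^+ 4 = (x0 ^+ 2) ^+ 2)%R by ring.
  rewrite exprMn -[leRHS]mulrA; apply: ler_wpM2l; first exact: sqr_ge0.
  have := sqr_sum_le m (fun r => A r 0 ^+ 2)%R.
  by under [X in (_ <= _ * X)%R]eq_bigr do rewrite -exprM.
rewrite ge0_integralZl//; last 2 first.
- exact: emeasurable_sum.
- by move=> A _; exact: sume_ge0.
rewrite ge0_integral_sum//.
apply: (@le_trans _ _ ((x0 ^+ 4 * m%:R)%:E * \sum_(r < m) (64 * Num.sqrt 2)%:E)).
  rewrite lee_wpmul2l//; apply: lee_sum => r _.
  rewrite (integral_gaussian_entry _ _ (fun y => (y ^+ 4)%:E))//; last first.
    by apply/measurable_EFinP; exact: measurable_funX.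
  exact: integral_stdnormal_pow4.
rewrite sumEFin sumr_const card_ord -EFinM lee_fin -(mulr_natr (64 * _)).
by rewrite le_eqVlt; apply/orP; left; apply/eqP; ring.
Qed.

Lemma hat_diag_moment i : \int[Gam]_A (H A i i ^+ 2)%:E <=
  ((3 + 64 * Num.sqrt 2 * x0 ^+ 4) * m%:R ^+ 2 /
   Num.max (sigma ^+ 4) (Num.max (m%:R ^+ 2) (n.+1%:R ^+ 2)))%:E.
Proof.
rewrite integral_hat_diag.
have [a aE] : exists a : R, a_ = a%:E.
  exists (fine a_); rewrite fineK// ge0_fin_numE//.
  by rewrite (le_lt_trans a_le1)// ltry.
have := hat_diag_moment_noise; have := hat_diag_moment_dim; have := a_le1; have := a_ge0.
rewrite aE -EFinM !lee_fin => a0 a1 a2 a4.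
have m1 : (1 <= m%:R :> R)%R by rewrite ler1n.
have n1 : (1 <= n.+1%:R :> R)%R by rewrite ler1n.
have {}a2 : (a * n.+1%:R ^+ 2 <= 3 * m%:R ^+ 2)%R.
  by move: a2; rewrite expr_div_n mulrA ler_pdivlMr// exprn_gt0// ltr0n.
have C0 : (0 <= 64 * Num.sqrt 2 * x0 ^+ 4 * m%:R ^+ 2)%R.
  apply: mulr_ge0; last exact: sqr_ge0.
  by apply: mulr_ge0; [rewrite mulr_ge0 ?sqrtr_ge0|exact: exprn_even_ge0].
have M20 : (0 <= (m%:R : R) ^+ 2)%R by exact: sqr_ge0.
rewrite ler_pdivlMr; last by rewrite !lt_max (exprn_gt0 2 (lt_le_trans ltr01 n1)) !orbT.
rewrite mulrDl /Num.max; case: ifP => _; first case: ifP => _.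
- by apply: (le_trans a2); rewrite lerDl.
- apply: (@le_trans _ _ (1 * m%:R ^+ 2)%R); first by rewrite ler_wpM2r.
  by rewrite mul1r; lra.
- by rewrite mulrC; apply: (le_trans a4); rewrite lerDr mulr_ge0.
Qed.

End moment_bound.
End projection_moment.

(** * Sign perturbations of a constant signal *)

Section signs.
Variable R : realType.

Definition sgn (b : bool) : R := (-1) ^+ b.

Lemma norm_sgn b : `|sgn b| = 1.
Proof. by rewrite normrX normrN1 expr1n. Qed.

Lemma sum_sgn n (i j : 'I_n) :
  \sum_(v : {ffun 'I_n -> bool}) sgn (v i) * sgn (v j) = (2 ^ n * (i == j))%:R.
Proof.
have [->|ij] := eqVneq i j.
  rewrite (eq_bigr (fun=> 1)) => [|v _]; last by rewrite /sgn -expr2 sqrr_sign.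
  by rewrite sumr_const card_ffun card_bool card_ord muln1.
rewrite muln0.
(* flipping the sign at i is an involution that changes the sign of the sum *)
pose flip (v : {ffun 'I_n -> bool}) := [ffun k => if k == i then ~~ v k else v k].
have flipK : involutive flip.
  move=> v; apply/ffunP => k; rewrite !ffunE.
  by case: (k == i); rewrite ?negbK.
set S := \sum_v _.
have : S = - S.
  rewrite {1}/S (reindex_inj (inv_inj flipK)) /= -sumrN; apply: eq_bigr => v _.
  rewrite /sgn !ffunE eqxx eq_sym (negPf ij) -mulNr; congr (_ * _).
  by case: (v i); rewrite /= ?expr1 ?expr0 ?opprK.
by move=> /eqP; rewrite -addr_eq0 -mulr2n mulrn_eq0 /= => /eqP.
Qed.

Section perturbation.
Variables (m n L : nat) (x0 sigma dl : R).

Definition sign_pert (v : {ffun 'I_n -> bool}) : 'rV[R]_n :=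
  \row_j (dl * sgn (v j)).

Definition sign_signal (v : {ffun 'I_n -> bool}) : 'rV[R]_n :=
  \row_j (x0 * Num.sqrt (1 + dl * sgn (v j))).

Local Notation K v A := (cov_shift R m n x0 sigma A (sign_pert v)).
Local Notation Gam := (gaussian R m n).
Local Notation obs x A Xi := (Xi *m (signal_mx R m n sigma A x)^T).

Lemma cov_shift_trace_ge0 v A : 0 <= \tr (K v A *m K v A).
Proof.
rewrite -[X in _ *m X]cov_shiftT; move: (K v A) => M.
apply: sumr_ge0 => i _; rewrite mxE; apply: sumr_ge0 => j _.
by rewrite mxE -expr2 sqr_ge0.
Qed.

(** Averaging over the signs cancels the off-diagonal entries of the hat matrix
    and leaves the sum of H_ii ^ 2, instead of the full Hilbert-Schmidt norm that
    bounds the trace for one given sign vector. *)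
Lemma sum_cov_shift_trace A :
  \sum_v \tr (K v A *m K v A) =
  (2 ^ n)%:R * dl ^+ 2 * \sum_i hat_mx R m n x0 sigma A i i ^+ 2.
Proof.
under eq_bigr do rewrite cov_shift_trace.
rewrite exchange_big /= mulr_sumr; apply: eq_bigr => i _.
rewrite exchange_big /= (bigD1 i)//= [X in _ + X]big1 => [|j /negPf ji].
  have := sum_sgn n i i; rewrite eqxx muln1 => <-.
  by rewrite addr0 !mulr_suml; apply: eq_bigr => v _; rewrite !mxE; ring.
rewrite (eq_bigr (fun v : {ffun 'I_n -> bool} => dl ^+ 2 * hat_mx R m n x0 sigma A i j ^+ 2 * (sgn (v i) * sgn (v j)))) => [|v _].
  by rewrite -mulr_sumr sum_sgn eq_sym ji muln0 mulr0.
by rewrite !mxE; ring.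
Qed.

Lemma measurable_cov_trace v :
  measurable_fun setT (fun A => \tr (K v A *m K v A)).
Proof.
have mK : measurable_fun setT (fun A => K v A).
  have mP := measurable_base_proj R m n x0 sigma.
  by apply: measurable_mulmx => //; apply: measurable_mulmx.
apply: measurable_sum => i.
apply: (measurableT_comp (measurable_mx_coord _ _ _ _ i i)).
exact: measurable_mulmx.
Qed.

Lemma measurable_signal_mx x : measurable_fun setT (fun A => signal_mx R m n sigma A x).
Proof. by apply: measurable_row_mx => //; exact: measurable_mulmxr. Qed.

Lemma measurable_obs x : measurable_fun setT
  (fun z : 'M[R]_(m, n) * 'M[R]_(L, n + m) => (z.1, obs x z.1 z.2)).
Proof.
apply: measurable_fun_pair => //; apply: measurable_mulmx => //.
apply: measurable_trmx; apply: (measurableT_comp (measurable_signal_mx x)) => //.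
Qed.

Local Open Scope ereal_scope.

(** The probability of an event under the signal x: conditionally on A, the L
    looks are the rows of the image of an L x (n + m) standard Gaussian matrix. *)
Definition obs_prob x (E : set ('M[R]_(m, n) * 'M[R]_(L, m))) : \bar R :=
  \int[Gam]_A \int[gaussian R L (n + m)]_Xi (\1_E (A, obs x A Xi))%:E.

(** Conditionally on A, the change of measure applies as long as L tr K ^ 2 is at
    most s. The other matrices A are rare by the Markov inequality, and contribute
    the first term. *)
Lemma obs_prob_compare v (s t : R) (E : set ('M[R]_(m, n) * 'M[R]_(L, m))) :
  (0 <= dl <= 2^-1)%R -> (0 < s)%R -> (0 < t)%R -> measurable E ->
  obs_prob (sign_signal v) E <=
  (L%:R / s)%:E * \int[Gam]_A (\tr (K v A *m K v A))%:E +
  ((t / 2)%:E * obs_prob (const_mx x0) E + (expR s / (2 * t))%:E).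
Proof.
move=> /andP[dl0 dl12] s0 t0 mE.
pose F x A := \int[gaussian R L (n + m)]_Xi (\1_E (A, obs x A Xi))%:E.
have mE1 : measurable_fun setT (fun y => (\1_E y)%:E : \bar R).
  by apply/measurable_EFinP; exact: measurable_indic.
have mF x : measurable_fun setT (F x).
  apply: (@measurable_fun_fubini_tonelli_F _ _ _ _ _ (gaussian R L (n + m))
    (fun z => (\1_E (z.1, obs x z.1 z.2))%:E)); last by move=> z; rewrite lee_fin.
  exact: (measurableT_comp mE1 (measurable_obs x)).
have F0 x A : 0 <= F x A by apply: integral_ge0 => Xi _; rewrite lee_fin.
have F1 x A : F x A <= 1.
  apply: (@le_trans _ _ (\int[gaussian R L (n + m)]_Xi 1)).
    apply: ge0_le_integral => //.
    - apply: (measurableT_comp mE1); apply: measurable_fun_pair => //.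
      exact: measurable_mulmxr.
    - by move=> Xi _; rewrite lee_fin indicE; case: (_ \in _); rewrite ?lexx ?ler01.
  by rewrite integral_cst// mul1e probability_le1.
have mT := measurable_cov_trace v.
have T0 A : 0 <= (\tr (K v A *m K v A))%:E by rewrite lee_fin cov_shift_trace_ge0.
have mET : measurable_fun setT (fun A => (\tr (K v A *m K v A))%:E).
  exact/measurable_EFinP.
have key A : F (sign_signal v) A <= (L%:R / s)%:E * (\tr (K v A *m K v A))%:E +
    ((t / 2)%:E * F (const_mx x0) A + (expR s / (2 * t))%:E).
  have e0 : 0 <= (expR s / (2 * t))%:E.
    by rewrite lee_fin divr_ge0 ?expR_ge0// mulr_ge0// ltW.
  have t20 : 0 <= (t / 2)%:E by rewrite lee_fin divr_ge0// ltW.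
  have Ls0 : 0 <= (L%:R / s)%:E by rewrite lee_fin divr_ge0// ltW.
  have [Ts|Ts] := leP (L%:R * \tr (K v A *m K v A))%R s; last first.
    apply: (le_trans (F1 _ _)); rewrite -[leLHS]adde0; apply: leeD.
      by rewrite -EFinM lee_fin mulrAC ler_pdivlMr// mul1r ltW.
    by rewrite adde_ge0// mule_ge0.
  rewrite -[leLHS]add0e; apply: leeD; first by rewrite mule_ge0.
  have -> : F (const_mx x0) A =
      \int[gaussian R L (n + m)]_Xi (\1_E (A, Xi *m (base_mx R m n x0 sigma A)^T)%R)%:E.
    apply: eq_integral => Xi _; congr (\1_E (_, _ *m _^T)%R)%:E.
    by rewrite /signal_mx /base_mx diag_const_mx mul_mx_scalar.
  apply: (le_trans (gaussian_second_moment R L _ _ (K v A) (base_mx R m n x0 sigma A)^T _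
      (fun Y => (\1_E (A, Y))%:E) t _ _ _ _ _ _)) => //.
  - exact: cov_shiftT.
  - move=> u; apply: cov_shift_le; first by rewrite invr_ge0.
    by move=> j; rewrite mxE normrM norm_sgn mulr1 ger0_norm.
  - rewrite !trmxK; apply: signal_mx_cov => j; rewrite !mxE exprMn sqr_sqrtr//.
    rewrite /sgn; case: (v j); rewrite /= ?expr1 ?expr0 ?mulr1 ?mulrN1; lra.
  - apply: (measurableT_comp mE1); exact: measurable_fun_pair.
  - by move=> Y; rewrite !lee_fin indicE; case: (_ \in _); rewrite !lexx ler01.
  rewrite leeD2l// lee_fin ler_wpM2r// ?ler_expR//.
  by rewrite invr_ge0 mulr_ge0// ltW.
have e0 : 0 <= (expR s / (2 * t))%:E.
  by rewrite lee_fin divr_ge0 ?expR_ge0// mulr_ge0// ltW.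
have t20 : 0 <= (t / 2)%:E by rewrite lee_fin divr_ge0// ltW.
have Ls0 : 0 <= (L%:R / s)%:E by rewrite lee_fin divr_ge0// ltW.
pose f1 A := (L%:R / s)%:E * (\tr (K v A *m K v A))%:E.
pose f2 A := (t / 2)%:E * F (const_mx x0) A.
have f10 A : setT A -> 0 <= f1 A by move=> _; rewrite mule_ge0.
have f20 A : setT A -> 0 <= f2 A by move=> _; rewrite mule_ge0.
have f30 A : setT A -> 0 <= f2 A + (expR s / (2 * t))%:E by move=> _; rewrite adde_ge0// f20.
have mf1 : measurable_fun setT f1 by exact: emeasurable_funM.
have mf2 : measurable_fun setT f2 by exact: emeasurable_funM.
have mf3 : measurable_fun setT (fun A => f2 A + (expR s / (2 * t))%:E) by exact: emeasurable_funD.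
apply: (@le_trans _ _ (\int[Gam]_A (f1 A + (f2 A + (expR s / (2 * t))%:E)))).
  apply: (ge0_le_integral _ measurableT (fun A _ => F0 _ A) (mF _)).
    exact: emeasurable_funD.
  by move=> A _; exact: key.
rewrite (ge0_integralD _ measurableT f10 mf1 f30 mf3).
rewrite (ge0_integralD _ measurableT f20 mf2 (f2 := cst (expR s / (2 * t))%:E))//.
rewrite (ge0_integralZl _ measurableT mET (fun A _ => T0 A) Ls0).
rewrite (ge0_integralZl _ measurableT (mF _) (fun A _ => F0 _ A) t20).
rewrite leeD2l// leeD2l// integral_cst// -[leRHS]mule1 lee_wpmul2l//.
exact: probability_le1.
Qed.

End perturbation.
End signs.

(** * The law of the observation *)

Section model_law.
Variable R : realType.

(** All the coordinates of the noise, degenerate or not, are multiples of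
    standard normal variables. *)
Lemma centered_gaussianE (c : R) (B : set R) : 0 <= c -> measurable B ->
  centered_gaussian c B = stdnormal R ((fun x => c * x) @^-1` B).
Proof.
move=> c0 mB; rewrite /centered_gaussian; have [->|cn0] := eqVneq c 0.
  have -> : (fun x : R => 0 * x) @^-1` B = if 0 \in B then setT else set0.
    apply/seteqP; split => x /=; rewrite mul0r; first by move/mem_set => ->.
    by case: ifPn => // /set_mem.
  rewrite diracE; case: ifP => _ /=; last by rewrite measure0.
  exact/esym/probability_setT.
have {cn0}c0 : 0 < c by rewrite lt_neqAle eq_sym cn0.
have mcB : measurable ((fun x : R => c * x) @^-1` B).
  rewrite -[X in measurable X]setTI; have : measurable_fun setT (fun x : R => c * x).
    exact: measurable_funM.
  exact.
have E1 : (\int[normal_prob 0 c]_x (\1_B x)%:E)%E = normal_prob 0 c B.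
  by rewrite integral_indic// setIT.
have E2 : (\int[stdnormal R]_x (\1_((fun x => c * x) @^-1` B) x)%:E)%E =
    stdnormal R ((fun x => c * x) @^-1` B).
  by rewrite integral_indic// setIT.
have mB1 : measurable_fun [set: R] (fun x : R => (\1_B x)%:E : \bar R).
  by apply/measurable_EFinP; exact: measurable_indic.
have B0 x : (0 <= (\1_B x)%:E :> \bar R)%E by rewrite lee_fin.
by rewrite -E2 -E1 -(integral_stdnormal_scale R c _ c0 mB1 B0).
Qed.

Section vectorization.
Variables (m n L : nat).

Local Notation I := (noise_index m n L).
Local Notation N := (m * n + L * (n + m))%N.

(** Position of each scalar noise variable in one long Gaussian vector. *)
Definition noise_pos (q : I) : 'I_N :=
  match q with
  | inl ij => lshift _ (mxvec_index ij.1 ij.2)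
  | inr (inl lj) => rshift _ (mxvec_index lj.1 (lshift m lj.2))
  | inr (inr li) => rshift _ (mxvec_index li.1 (rshift n li.2))
  end.

Lemma noise_pos_bij : bijective noise_pos.
Proof.
have mxvec_index_inj p r : injective (uncurry (@mxvec_index p r)).
  by move=> [i j] [k l] /cast_ord_inj /enum_rank_inj.
apply: inj_card_bij; last first.
  by rewrite !card_sum !card_prod !card_ord mulnDr.
move=> [[i j]|[[l j]|[l i]]] [[i' j']|[[l' j']|[l' i']]] /= /eqP;
  rewrite ?eq_lrshift ?eq_rlshift ?eq_lshift ?eq_rshift// => /eqP.
- by move=> /(mxvec_index_inj _ _ (i, j) (i', j')) ->.
- move=> /(mxvec_index_inj _ _ (l, _) (l', _)) E.
  have /= -> := congr1 fst E; have /= /eqP := congr1 snd E.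
  by rewrite eq_lshift => /eqP ->.
- move=> /(mxvec_index_inj _ _ (l, _) (l', _)) /(congr1 snd) /= /eqP.
  by rewrite eq_lrshift.
- move=> /(mxvec_index_inj _ _ (l, _) (l', _)) /(congr1 snd) /= /eqP.
  by rewrite eq_rlshift.
- move=> /(mxvec_index_inj _ _ (l, _) (l', _)) E.
  have /= -> := congr1 fst E; have /= /eqP := congr1 snd E.
  by rewrite eq_rshift => /eqP ->.
Qed.

Definition noise_sd (sigma : R) (q : I) : R := if q is inr (inr _) then sigma else 1.

Definition sd_row (sigma : R) : 'rV[R]_N :=
  row_mx (const_mx 1) (mxvec (\matrix_(l < L, j < n + m)
    (row_mx (const_mx 1) (const_mx sigma) : 'rV[R]_(n + m)) 0 j)).

Lemma sd_rowE sigma q : sd_row sigma 0 (noise_pos q) = noise_sd sigma q.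
Proof.
rewrite /sd_row; case: q => [[i j]|[[l j]|[l i]]] /=.
- by rewrite row_mxEl mxE.
- by rewrite row_mxEr mxvecE mxE row_mxEl mxE.
- by rewrite row_mxEr mxvecE mxE row_mxEr mxE.
Qed.

Section vector.
Context d (T : measurableType d) (P : probability T R).
Variables (A : T -> 'M[R]_(m, n)) (w : 'I_L -> T -> 'cV[R]_n)
          (z : 'I_L -> T -> 'cV[R]_m) (sigma : R).
Hypothesis sigma_ge0 : 0 <= sigma.
Hypothesis model : gaussian_model P A w z sigma.

Definition noise_row (t : T) : 'rV[R]_N :=
  row_mx (mxvec (A t)) (mxvec (\matrix_(l < L) row_mx (w l t)^T (z l t)^T)).

Lemma noise_rowE t q : noise_row t 0 (noise_pos q) = scalar_noise A w z q t.
Proof.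
rewrite /noise_row; case: q => [[i j]|[[l j]|[l i]]] /=.
- by rewrite row_mxEl mxvecE.
- by rewrite row_mxEr mxvecE mxE row_mxEl mxE.
- by rewrite row_mxEr mxvecE mxE row_mxEr mxE.
Qed.

Lemma scalar_noise_law q :
  has_law P (scalar_noise A w z q) (centered_gaussian (noise_sd sigma q)).
Proof.
case: model => lA lw lz _; case: q => [[i j]|[[l j]|[l i]]] /=.
- exact: lA.
- exact: lw.
- exact: lz.
Qed.

Lemma measurable_noise_row : measurable_fun setT noise_row.
Proof.
apply: measurable_mx => i k; rewrite (ord1 i).
have [f fK gK] := noise_pos_bij; rewrite -(gK k).
under eq_fun do rewrite noise_rowE.
by have [] := scalar_noise_law (f k).
Qed.

HB.instance Definition _ := isMeasurableFun.Build _ _ _ _ noise_row measurable_noise_row.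
HB.instance Definition _ :=
  isMeasurableFun.Build _ _ _ _ (scale_row R N (fun k => sd_row sigma 0 k))
    (measurable_scale_row R N (fun k => sd_row sigma 0 k)).

Local Open Scope ereal_scope.

(** Independence of the scalar coordinates determines the probabilities of
    rectangles, hence the joint law. *)
Lemma noise_row_law E : measurable E ->
  distribution P noise_row E =
  distribution (gaussian_row R N) (scale_row R N (fun k => sd_row sigma 0%R k)) E.
Proof.
apply: eq_measure_rectangle => B mB.
have mcB k : measurable ((fun x : R => sd_row sigma 0 k * x)%R @^-1` B ord0 k).
  rewrite -[X in measurable X]setTI.
  have : measurable_fun setT (fun x : R => sd_row sigma 0 k * x)%R by exact: measurable_funM.
  by apply => //; exact: mB.
have [f fK gK] := noise_pos_bij.
transitivity (\prod_(q in [set: I]%SET) P (scalar_noise A w z q @^-1` B ord0 (noise_pos q))).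
  have [_ _ _ ind] := model; rewrite -ind; last by move=> q _; exact: mB.
  congr (P _); apply/seteqP; split=> t /=.
    by move=> H q _ /=; rewrite -noise_rowE; exact: H.
  move=> H i k; rewrite (ord1 i) -(gK k) noise_rowE.
  by apply: (H (f k)); rewrite /= inE.
have scaleE k x : scale_row R N (fun k => sd_row sigma 0%R k) x 0%R k =
    (sd_row sigma 0 k * x 0 k)%R by rewrite /scale_row [LHS]mxE.
transitivity (\prod_k stdnormal R ((fun x : R => sd_row sigma 0 k * x)%R @^-1` B ord0 k));
    last first.
  rewrite -(gaussian_row_rectangle _ _
    (fun i k => (fun x : R => sd_row sigma 0 k * x)%R @^-1` B i k)); last first.
    by move=> i k; rewrite (ord1 i).
  congr (gaussian_row R N _); apply/seteqP; split=> x H i k.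
    by have := H i k; rewrite (ord1 i) /= scaleE.
  by have := H i k; rewrite (ord1 i) /= scaleE.
rewrite (reindex noise_pos) /=; last by exists f => k _; [exact: fK|exact: gK].
apply: eq_big => q; first by rewrite inE.
move=> _; rewrite sd_rowE -centered_gaussianE//; last by case: q => [?|[?|?]] /=.
by have [_ <-] := scalar_noise_law q.
Qed.

(** The observation as a function of the noise vector, in which the additive
    noise already has standard deviation sigma: hence the coefficient 1. *)
Definition row_obs (x : 'rV[R]_n) (u : 'rV[R]_N) : 'M[R]_(m, n) * 'M[R]_(L, m) :=
  (vec_mx (lsubmx u), vec_mx (rsubmx u) *m (signal_mx R m n 1 (vec_mx (lsubmx u)) x)^T)%R.

Definition obs_tuple (y : 'M[R]_(m, n) * 'M[R]_(L, m)) :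
    'M[R]_(m, n) * L.-tuple 'cV[R]_m :=
  (y.1, [tuple (row l y.2)^T%R | l < L]).

Lemma observationE x t : observation A w z x t = obs_tuple (row_obs x (noise_row t)).
Proof.
rewrite /observation /obs_tuple /row_obs /noise_row row_mxKl row_mxKr !mxvecK /=.
congr pair; apply: eq_from_tnth => l; rewrite !tnth_mktuple.
rewrite row_mul rowK /signal_mx tr_row_mx mul_row_col tr_scalar_mx mulmx1.
by rewrite linearD /= !trmx_mul !trmxK.
Qed.

Lemma measurable_obs_tuple : measurable_fun setT obs_tuple.
Proof.
apply: measurable_fun_pair => //; apply/measurable_fun_tnthP => l.
rewrite (_ : _ \o _ = fun y => (row l y.2)^T%R); last first.
  by apply/funext => y; rewrite /= tnth_mktuple.
apply: measurable_trmx; apply: measurable_mx => i j.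
rewrite (_ : (fun _ => _) = fun y : 'M[R]_(m, n) * 'M[R]_(L, m) => y.2 l j); last first.
  by apply/funext => y; rewrite mxE.
exact: (measurableT_comp (measurable_mx_coord _ _ _ _ l j)).
Qed.

Let measurable_lsub : measurable_fun setT (fun u : 'rV[R]_N => vec_mx (lsubmx u) : 'M[R]_(m, n)).
Proof.
apply: measurable_mx => i j.
rewrite (_ : (fun _ => _) = fun u : 'rV[R]_N => u 0%R (lshift _ (mxvec_index i j))).
  exact: measurable_mx_coord.
by apply/funext => u; rewrite !mxE.
Qed.

Let measurable_rsub : measurable_fun setT (fun u : 'rV[R]_N => vec_mx (rsubmx u) : 'M[R]_(L, n + m)).
Proof.
apply: measurable_mx => i j.
rewrite (_ : (fun _ => _) = fun u : 'rV[R]_N => u 0%R (rshift _ (mxvec_index i j))).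
  exact: measurable_mx_coord.
by apply/funext => u; rewrite !mxE.
Qed.

Lemma measurable_row_obs x : measurable_fun setT (row_obs x).
Proof.
apply: measurable_fun_pair; first exact: measurable_lsub.
apply: measurable_mulmx; first exact: measurable_rsub.
apply: measurable_trmx; apply: (measurableT_comp (measurable_signal_mx R m n 1 x)).
exact: measurable_lsub.
Qed.

Lemma row_obs_scale x a b :
  row_obs x (scale_row R N (fun k => sd_row sigma 0%R k) (row_mx a b)) =
  (vec_mx a, vec_mx b *m (signal_mx R m n sigma (vec_mx a) x)^T)%R.
Proof.
have aE : lsubmx (scale_row R N (fun k => sd_row sigma 0%R k) (row_mx a b)) = a.
  apply/rowP => k; rewrite [LHS]mxE /scale_row [LHS]mxE /sd_row !row_mxEl mxE.
  exact: mul1r.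
have bE : vec_mx (rsubmx (scale_row R N (fun k => sd_row sigma 0%R k) (row_mx a b))) =
    row_mx (lsubmx (vec_mx b)) (sigma *: rsubmx (vec_mx b))%R :> 'M[R]_(L, n + m).
  apply/matrixP => i j; rewrite [LHS]mxE [LHS]mxE /scale_row [LHS]mxE /sd_row !row_mxEr mxvecE.
  have [k|k] := split_ordP j => ->.
    by rewrite row_mxEl mxE row_mxEl !mxE mul1r.
  by rewrite row_mxEr mxE row_mxEr !mxE.
rewrite /row_obs aE bE; congr pair.
rewrite -[X in _ = (X *m _)%R]hsubmxK /signal_mx !tr_row_mx !mul_row_col !tr_scalar_mx.
by rewrite mulmx1 mul_mx_scalar.
Qed.

Lemma measurable_observation x : measurable_fun setT (observation A w z x).
Proof.
rewrite (_ : observation A w z x = obs_tuple \o (row_obs x \o noise_row)).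
  apply: (measurableT_comp measurable_obs_tuple).
  exact: (measurableT_comp (measurable_row_obs x) measurable_noise_row).
by apply/funext => t; rewrite /= observationE.
Qed.

Lemma observation_law x E : measurable E ->
  P (observation A w z x @^-1` E) = obs_prob R m n L sigma x (obs_tuple @^-1` E).
Proof.
move=> mE; pose E' := obs_tuple @^-1` E.
have mE' : measurable E'.
  by rewrite -[X in measurable X]setTI; exact: measurable_obs_tuple.
pose G := row_obs x @^-1` E'.
have mG : measurable G.
  by rewrite -[X in measurable X]setTI; exact: measurable_row_obs.
transitivity (distribution P noise_row G).
  congr (P _); apply/seteqP; split=> t /=; rewrite /G /E' /=; by rewrite observationE.
rewrite noise_row_law//.
pose S := scale_row R N (fun k => sd_row sigma 0%R k).
have mS : measurable_fun setT S by exact: measurable_scale_row.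
have mE1 : measurable_fun setT (fun y => (\1_E' y)%:E : \bar R).
  by apply/measurable_EFinP; exact: measurable_indic.
have mF : measurable_fun setT (fun u => (\1_E' (row_obs x (S u)))%:E : \bar R).
  exact: (measurableT_comp mE1 (measurableT_comp (measurable_row_obs x) mS)).
have mSG : measurable (S @^-1` G) by rewrite -[X in measurable X]setTI; exact: mS.
transitivity (\int[gaussian_row R N]_u (\1_E' (row_obs x (S u)))%:E).
  transitivity (\int[gaussian_row R N]_u (\1_(S @^-1` G) u)%:E).
    by rewrite integral_indic// setIT.
  by apply: eq_integral => u _; rewrite !indicE.
rewrite (integral_gaussian_row_split _ _ _ _ mF); last by move=> u; rewrite lee_fin.
rewrite /obs_prob.
have mobs : measurable_fun setT (fun z : 'M[R]_(m, n) * 'M[R]_(L, n + m) =>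
    (\1_E' (z.1, z.2 *m (signal_mx R m n sigma z.1 x)^T)%R)%:E : \bar R).
  exact: (measurableT_comp mE1 (measurable_obs R m n L sigma x)).
rewrite (integral_gaussian R m n (fun A0 => \int[gaussian R L (n + m)]_Xi
    (\1_E' (A0, Xi *m (signal_mx R m n sigma A0 x)^T)%R)%:E)); last 2 first.
- apply: (@measurable_fun_fubini_tonelli_F _ _ _ _ _ (gaussian R L (n + m)) _ mobs).
  by move=> z0; rewrite lee_fin.
- by move=> A0; apply: integral_ge0 => Xi _; rewrite lee_fin.
apply: eq_integral => a _.
rewrite (integral_gaussian R L (n + m) (fun Xi =>
    (\1_E' (vec_mx a, Xi *m (signal_mx R m n sigma (vec_mx a) x)^T)%R)%:E)); last 2 first.
- apply: (measurableT_comp mE1); apply: measurable_fun_pair => //.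
  exact: measurable_mulmxr.
- by move=> Xi; rewrite lee_fin.
by apply: eq_integral => b _; rewrite row_obs_scale.
Qed.

End vector.
End vectorization.
End model_law.

(** * Binary codes and finite signal classes *)

Section codes.
Local Open Scope nat_scope.
Variable n : nat.
Implicit Types (u v : {ffun 'I_n -> bool}) (S D : {set {ffun 'I_n -> bool}}).

Definition hamming u v : nat := #|[set i | u i != v i]%SET|.

Lemma hammingxx u : hamming u u = 0.
Proof. by apply/eqP; rewrite cards_eq0; apply/eqP/setP => i; rewrite !inE eqxx. Qed.

Lemma hammingC u v : hamming u v = hamming v u.
Proof. by congr #|pred_of_set _|; apply/setP => i; rewrite !inE eq_sym. Qed.

(** Each v weighs 2 ^ (n - d(u, v)); by the binomial formula the total weight
    is 3 ^ n. *)
Lemma hamming_ball u r : r <= n ->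
  #|[set v | hamming u v <= r]%SET| * 2 ^ (n - r) <= 3 ^ n.
Proof.
move=> rn.
have <- : \sum_(v : {ffun 'I_n -> bool}) 2 ^ (n - hamming u v) = 3 ^ n.
  transitivity (\prod_(i < n) \sum_(b : bool) (if u i != b then 1 else 2)).
    rewrite bigA_distr_bigA /=; apply: eq_bigr => v _.
    rewrite (bigID (fun i => u i != v i)) /= big1 => [|i ->//]; rewrite mul1n.
    rewrite (eq_bigr (fun=> 2)) => [|i /negPf->//]; rewrite prod_nat_const; congr (2 ^ _).
    have := cardsC [set i | u i != v i]%SET; rewrite card_ord -/(hamming u v) => {1}<-.
    by rewrite addKn; apply: eq_card => i; rewrite !inE.
  rewrite (eq_bigr (fun=> 3)) => [|i _]; last by rewrite big_bool; case: (u i).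
  by rewrite prod_nat_const card_ord.
rewrite -sum_nat_const [X in _ <= X](bigID (mem [set v | hamming u v <= r]%SET)) /=.
apply: leq_trans (leq_addr _ _); apply: leq_sum => v; rewrite inE => vr.
by rewrite leq_exp2l// leq_sub2l.
Qed.

(** Greedy construction of a code inside a prescribed set of words. *)
Lemma greedy_code S r V N : (forall u, #|[set v | hamming u v <= r]%SET| <= V) ->
  N * V <= #|S| -> exists D, [/\ D \subset S, #|D| = N &
    forall u v, u \in D -> v \in D -> u != v -> r < hamming u v].
Proof.
move=> ballV; elim: N => [|N IH] NV.
  by exists finset.set0; split; [exact: finset.sub0set|rewrite cards0|move=> u v; rewrite inE].
have [|D [DS DN Dr]] := IH; first by apply: leq_trans NV; rewrite leq_mul2r leqnSn orbT.
have V0 : 0 < V.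
  apply: leq_trans (ballV [ffun=> true]); apply/card_gt0P; exists [ffun=> true].
  by rewrite inE hammingxx.
pose U := (\bigcup_(u in D) [set v | hamming u v <= r]%SET)%SET.
have [v vS vU] : exists2 v, v \in S & v \notin U.
  apply/subsetPn; apply: contraL NV => /subset_leq_card SU; rewrite -ltnNge mulSn.
  apply: leq_ltn_trans SU _; apply: (@leq_ltn_trans (N * V)); last by rewrite -[X in X < _]add0n ltn_add2r.
  rewrite -DN -sum_nat_const /U; elim/big_rec2: _ => [|u x y _ IHy]; first by rewrite cards0.
  by rewrite (leq_trans (leq_card_setU _ _))// leq_add.
have far u : u \in D -> r < hamming u v.
  move=> uD; rewrite ltnNge; apply: contra vU => uv.
  by apply/finset.bigcupP; exists u => //; rewrite inE.
exists (v |: D)%SET; split.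
- by rewrite finset.subUset finset.sub1set vS.
- rewrite cardsU1 DN; suff -> : v \notin D by [].
  by apply/negP => /far; rewrite hammingxx.
- move=> u1 u2; rewrite !inE => /predU1P[->|u1D] /predU1P[->|u2D]; rewrite ?eqxx//.
  + by move=> _; rewrite hammingC; exact: far.
  + by move=> _; exact: far.
  + exact: Dr.
Qed.

End codes.

Section finite_class.
Variable R : realType.

(** A ball of radius at least a sqrt n around a point of the class covers the
    whole box. For a smaller radius eta, one ball per point suffices, because
    a n ^ b / eta is at least sqrt n when b >= 1. *)
Lemma finite_signal_class n (k : nat) (xmin xmax a b : R) (I : finType) (D : {set I})
    (f : I -> 'rV[R]_n) :
  (0 < n)%N -> xmin < xmax -> xmax - xmin <= a -> 1 <= b -> (0 < #|D|)%N ->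
  (forall v j, xmin <= f v 0 j <= xmax) ->
  #|D|%:R <= Num.sqrt (n%:R : R) ^+ k ->
  signal_class xmin xmax a b k [set x | exists2 v, v \in D & x = f v].
Proof.
move=> n0 xx xa b1 D0 fx Dk.
have [v0 v0D] : exists v, v \in D by apply/card_gt0P.
have n1 : 1 <= n%:R :> R by rewrite ler1n.
have sn1 : 1 <= Num.sqrt (n%:R : R) by rewrite -[X in X <= _]sqrtr1 ler_sqrt// ltr0n.
have sn0 : 0 < Num.sqrt (n%:R : R) := lt_le_trans ltr01 sn1.
have nb : n%:R <= n%:R `^ b :> R by rewrite -[X in X <= _]powRr1// ler_powR.
have a0 : 0 < a by apply: lt_le_trans xa; rewrite subr_gt0.
have nn : n%:R = Num.sqrt (n%:R : R) * Num.sqrt n%:R by rewrite -expr2 sqr_sqrtr.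
split.
- by exists (f v0), v0.
- by move=> _ [v _ ->] j; exact: fx.
move=> eta /andP[eta0 etaM].
have [big|small] := leP (a * Num.sqrt n%:R) eta.
- apply: (@le_trans _ _ 1%:E); last first.
    by rewrite lee_fin exprn_ege1// ler_pdivlMr// mul1r.
  apply: ereal_inf_lbound; exists 1%N => //; exists (fun=> f v0) => _ [v vD ->].
  exists ord0 => //; rewrite /l2_ball /=; apply: le_trans big.
  have as0 : 0 <= a * Num.sqrt n%:R by rewrite mulr_ge0 ?sqrtr_ge0// ltW.
  rewrite -(@ler_pXn2r _ 2)// ?nnegrE ?sqrtr_ge0//.
  rewrite sqr_sqrtr; last by apply: sumr_ge0 => j _; exact: sqr_ge0.
  rewrite exprMn sqr_sqrtr// mulrC mulr_natl -[X in _ *+ X]card_ord -sumr_const.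
  apply: ler_sum => j _.
  have /andP[h1 h2] := fx v j; have /andP[h3 h4] := fx v0 j.
  by rewrite -ler_sqrt ?sqr_ge0// !sqrtr_sqr (ger0_norm (ltW a0)) ler_norml; lra.
- apply: (@le_trans _ _ (#|D|%:R)%:E).
    apply: ereal_inf_lbound; exists #|D| => //; exists (fun i => f (enum_val i)).
    move=> _ [v vD ->]; exists (enum_rank_in v0D v) => //=.
    rewrite enum_rankK_in// /l2_ball /= /sq_dist2 big1 ?sqrtr0 ?ltW// => j _.
    by rewrite subrr expr0n.
  rewrite lee_fin; apply: (le_trans Dk); apply: lerXn2r; rewrite ?nnegrE ?sqrtr_ge0//.
    by rewrite divr_ge0 ?mulr_ge0 ?powR_ge0// ltW.
  rewrite ler_pdivlMr//; apply: (@le_trans _ _ (Num.sqrt n%:R * (a * Num.sqrt n%:R))).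
    by rewrite ler_pM2l// ltW.
  by rewrite mulrCA -nn ler_pM2l.
Qed.

End finite_class.

(** * Lower bound for the risk over a code *)

Section code_risk.
Variable R : realType.

Lemma sq_dist2_ge0 n (x y : 'rV[R]_n) : 0 <= sq_dist2 x y.
Proof. by apply: sumr_ge0 => j _; exact: sqr_ge0. Qed.

Lemma sq_dist2_triangle n (x y c : 'rV[R]_n) :
  sq_dist2 x y <= 2 * sq_dist2 c x + 2 * sq_dist2 c y.
Proof.
rewrite /sq_dist2 !mulr_sumr -big_split /=; apply: ler_sum => j _.
have := sqr_ge0 (c 0 j - x 0 j + (c 0 j - y 0 j)); nra.
Qed.

(** The two values sqrt (1 + dl) and sqrt (1 - dl) differ by at least dl: their
    squares differ by 2 dl, and their sum is at most 2. *)
Lemma sign_signal_dist n (x0 dl : R) (u v : {ffun 'I_n -> bool}) :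
  0 <= dl <= 1 ->
  (hamming n u v)%:R * (x0 * dl) ^+ 2 <=
  sq_dist2 (sign_signal R n x0 dl u) (sign_signal R n x0 dl v).
Proof.
move=> /andP[dl0 dl1].
rewrite /hamming -sum1_card natr_sum mulr_suml.
rewrite /sq_dist2 [leLHS]big_mkcond /=.
apply: ler_sum => j _; rewrite !mxE inE; case: ifPn => uvj; last exact: sqr_ge0.
rewrite mul1r -mulrBr !exprMn ler_wpM2l ?sqr_ge0//.
pose p := Num.sqrt (1 + dl); pose q := Num.sqrt (1 - dl).
have p2 : p ^+ 2 = 1 + dl by rewrite sqr_sqrtr//; lra.
have q2 : q ^+ 2 = 1 - dl by rewrite sqr_sqrtr//; lra.
have p0 : 0 <= p by exact: sqrtr_ge0.
have q0 : 0 <= q by exact: sqrtr_ge0.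
have pq : dl ^+ 2 <= (p - q) ^+ 2.
  have h1 : (p - q) ^+ 2 * (p + q) ^+ 2 = 4 * dl ^+ 2.
    by rewrite -exprMn -subr_sqr p2 q2; ring.
  have h2 : (p + q) ^+ 2 <= 4.
    by have := sqr_ge0 (p - q); nra.
  by have := sqr_ge0 (p - q); nra.
have e1 : 1 + dl * sgn R true = 1 - dl by rewrite /sgn expr1 mulrN1.
have e0 : 1 + dl * sgn R false = 1 + dl by rewrite /sgn expr0 mulr1.
move: uvj; case: (u j); case: (v j) => // _; rewrite e0 e1 -/p -/q//.
by rewrite -[leRHS]sqrrN opprB.
Qed.

Section risk.
Variables (m n L : nat) (x0 dl sigma : R).
Hypotheses (n_gt0 : (0 < n)%N) (dl_gt0 : 0 < dl) (dl_le : dl <= 2^-1).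
Hypothesis sigma_ge0 : 0 <= sigma.
Local Notation W := {ffun 'I_n -> bool}.
Local Notation X := (sign_signal R n x0 dl).

Definition mean_trace (v : W) : \bar R :=
  \int[gaussian R m n]_A
    (\tr (cov_shift R m n x0 sigma A (sign_pert R n dl v) *m
          cov_shift R m n x0 sigma A (sign_pert R n dl v)))%:E.

Context d (T : measurableType d) (P : probability T R).
Variables (A : T -> 'M[R]_(m, n)) (w : 'I_L -> T -> 'cV[R]_n)
          (z : 'I_L -> T -> 'cV[R]_m).
Hypothesis model : gaussian_model P A w z sigma.
Variable xhat : 'M[R]_(m, n) * L.-tuple 'cV[R]_m -> 'rV[R]_n.
Hypothesis mxhat : measurable_fun setT xhat.

(** A quarter of the smallest possible squared distance between two codewords
    that differ in more than n / 4 places. *)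
Let rad : R := n%:R * (x0 * dl) ^+ 2 / 16.

Let decode (v : W) : set ('M[R]_(m, n) * L.-tuple 'cV[R]_m) :=
  [set y | sq_dist2 (xhat y) (X v) < rad].

Let measurable_dist v : measurable_fun setT (fun y => sq_dist2 (xhat y) (X v)).
Proof.
apply: measurable_sum => j; apply: measurable_funX; apply: measurable_funB => //.
exact: (measurableT_comp (measurable_mx_coord _ _ _ _ 0 j)).
Qed.

Let measurable_decode v : measurable (decode v).
Proof.
rewrite [decode v](_ : _ = (fun y => sq_dist2 (xhat y) (X v)) @^-1` `]-oo, rad[).
  by rewrite -[X in measurable X]setTI; exact: measurable_dist.
by apply/seteqP; split=> y /=; rewrite in_itv.
Qed.

Local Open Scope ereal_scope.

Lemma risk_decode v :
  (rad / n%:R)%:E * (1 - P (observation A w z (X v) @^-1` decode v)) <=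
  'E_P[fun t => (sq_dist2 (xhat (observation A w z (X v) t)) (X v) / n%:R)%R].
Proof.
have mobs := measurable_observation R m n L d T P A w z sigma model (X v).
have mD : measurable (observation A w z (X v) @^-1` decode v).
  by rewrite -[X in measurable X]setTI; exact: mobs.
have rad0 : (0 <= rad)%R by rewrite /rad divr_ge0// mulr_ge0// sqr_ge0.
have rn0 : 0 <= (rad / n%:R)%:E by rewrite lee_fin divr_ge0.
rewrite -probability_setC// unlock.
rewrite -[X in _ * P X]setIT -integral_indic//; last exact: measurableC.
have mI : measurable_fun setT
    (fun t => (\1_(~` (observation A w z (X v) @^-1` decode v)) t)%:E : \bar R).
  by apply/measurable_EFinP; apply: measurable_indic; exact: measurableC.
rewrite -ge0_integralZl//.
apply: ge0_le_integral => //.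
- by move=> t _; rewrite mule_ge0.
- exact: emeasurable_funM.
- apply/measurable_EFinP; apply: measurable_funM => //.
  exact: (measurableT_comp (measurable_dist v) mobs).
move=> t _; rewrite indicE -EFinM lee_fin.
have [|_] := boolP (t \in _); last first.
  by rewrite mulr0 divr_ge0// sq_dist2_ge0.
move=> /set_mem /= /negP; rewrite -leNgt => ?.
by rewrite mulr1 ler_pM2r// invr_gt0 ltr0n.
Qed.

Lemma decode_disjoint (D : {set W}) y :
  (forall u v, u \in D -> v \in D -> u != v -> (n < 4 * hamming n u v)%N) ->
  (\sum_(v in D) \1_(decode v) y <= 1 :> R)%R.
Proof.
move=> Dfar.
have [[v vD yv]|none] := pselect (exists2 v, v \in D & decode v y); last first.
  rewrite big1// => v vD; rewrite indicE memNset// => yv.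
  by apply: none; exists v.
rewrite (bigD1 v)//= big1 ?addr0 => [|u /andP[uD uv]].
  by rewrite indicE; case: (_ \in _); rewrite ?lexx ?ler01.
rewrite indicE memNset// => yu.
have h1 := sign_signal_dist n x0 dl u v.
have h2 := sq_dist2_triangle n (X u) (X v) (xhat y).
have h3 : (n%:R <= 4 * (hamming n u v)%:R :> R)%R.
  by rewrite -natrM ler_nat ltnW// Dfar.
have h4 : (0 <= (x0 * dl) ^+ 2)%R by exact: sqr_ge0.
have {}h1 : ((hamming n u v)%:R * (x0 * dl) ^+ 2 <= sq_dist2 (X u) (X v))%R.
  by apply: h1; rewrite (ltW dl_gt0) (le_trans dl_le)// invf_le1 ?ler1n.
move: yv yu; rewrite /decode /rad /=.
have := ler_wpM2r h4 h3.
lra.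
Qed.

(** Among the codewords of a well-separated code, at least one is decoded with
    probability at most 1/2: on average over the code, the change of measure
    replaces the probability of decoding v by that under the constant signal,
    and the latter probabilities sum to at most 1. *)
Lemma code_risk (D : {set W}) (s : R) :
  (0 < #|D|)%N -> (0 < s)%R -> (expR s <= #|D|%:R / 16)%R ->
  (forall u v, u \in D -> v \in D -> u != v -> (n < 4 * hamming n u v)%N) ->
  (forall v, v \in D -> (L%:R / s)%:E * mean_trace v <= (4^-1)%:E) ->
  exists2 v, v \in D & (x0 ^+ 2 * dl ^+ 2 / 32)%:E <=
    'E_P[fun t => (sq_dist2 (xhat (observation A w z (X v) t)) (X v) / n%:R)%R].
Proof.
move=> D0 s0 sD Dfar Dtr.
pose x1 : 'rV[R]_n := const_mx x0.
pose E' v := obs_tuple R m n L @^-1` decode v.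
have lawx x v : P (observation A w z x @^-1` decode v) = obs_prob R m n L sigma x (E' v).
  exact: observation_law.
pose p v := fine (P (observation A w z (X v) @^-1` decode v)).
pose q v := fine (P (observation A w z x1 @^-1` decode v)).
have mobs x : measurable_fun setT (observation A w z x).
  exact: (measurable_observation R m n L d T P A w z sigma model x).
have mpre x v : measurable (observation A w z x @^-1` decode v).
  by rewrite -[X in measurable X]setTI; exact: mobs.
have pE v : P (observation A w z (X v) @^-1` decode v) = (p v)%:E.
  by rewrite fineK// fin_num_measure.
have qE v : P (observation A w z x1 @^-1` decode v) = (q v)%:E.
  by rewrite fineK// fin_num_measure.
have N0 : (0 < #|D|%:R :> R)%R by rewrite ltr0n.
have pq v : v \in D -> (p v <= 4^-1 + (#|D|%:R / 8 * q v + 8^-1))%R.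
  move=> vD; rewrite -lee_fin -pE lawx.
  have t0 : (0 < #|D|%:R / 4 :> R)%R by rewrite divr_gt0.
  apply: (le_trans (obs_prob_compare R m n L x0 sigma dl v s (#|D|%:R / 4) _ _ s0 t0 _)) => //.
  - by rewrite (ltW dl_gt0).
  - rewrite -[X in measurable X]setTI; exact: measurable_obs_tuple.
  rewrite [leRHS]EFinD; apply: leeD; first exact: Dtr.
  rewrite [leRHS]EFinD; apply: leeD.
    rewrite -lawx qE -EFinM lee_fin.
    by have -> : (#|D|%:R / 4 / 2 * q v = #|D|%:R / 8 * q v)%R by field.
  rewrite lee_fin ler_pdivrMr; last by rewrite mulr_gt0.
  by apply: (le_trans sD); lra.
have mind v : measurable_fun setT
    (fun t => (\1_(decode v) (observation A w z x1 t))%:E : \bar R).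
  apply/measurable_EFinP.
  by apply: (measurableT_comp (measurable_indic _) (mobs x1)); exact: measurable_decode.
have ind0 v t : 0 <= (\1_(decode v) (observation A w z x1 t))%:E :> \bar R.
  by rewrite lee_fin.
have sumq : (\sum_(v in D) q v <= 1)%R.
  rewrite -lee_fin -sumEFin.
  have -> : \sum_(v in D) (q v)%:E =
      \int[P]_t (\sum_(v <- enum D) (\1_(decode v) (observation A w z x1 t))%:E).
    rewrite (ge0_integral_sum P measurableT mind (fun v t _ => ind0 v t)).
    rewrite big_enum /=; apply: eq_bigr => v _; rewrite -qE.
    transitivity (\int[P]_t (\1_(observation A w z x1 @^-1` decode v) t)%:E).
      by rewrite integral_indic// setIT.
    by apply: eq_integral => t _; rewrite !indicE.
  apply: (@le_trans _ _ (\int[P]_t 1)).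
    apply: ge0_le_integral => //.
    - by move=> t _; apply: sume_ge0.
    - exact: emeasurable_sum.
    - by move=> t _; rewrite sumEFin lee_fin big_enum /=; exact: decode_disjoint.
  by rewrite integral_cst// mul1e probability_le1.
have [v0 v0D] : exists v, v \in D by apply/card_gt0P.
have [v vD vmin] := arg_minP p v0D.
exists v => //.
have p12 : (p v <= 2^-1)%R.
  rewrite -(ler_pM2l N0).
  have : (#|D|%:R * p v <= \sum_(u in D) p u)%R.
    rewrite mulr_natl -sumr_const; apply: ler_sum => u uD; exact: vmin.
  have : (\sum_(u in D) p u <= \sum_(u in D) (4^-1 + (#|D|%:R / 8 * q u + 8^-1)))%R.
    by apply: ler_sum => u uD; exact: pq.
  rewrite !big_split /= -mulr_sumr !sumr_const.
  rewrite -(mulr_natl 4^-1) -(mulr_natl 8^-1).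
  have := ler_wpM2l (ltW N0) sumq.
  move: (\sum_(i in D) q i)%R (\sum_(u in D) p u)%R => a b; lra.
apply: le_trans (risk_decode v); rewrite pE -EFinB -EFinM lee_fin.
have nn0 : (0 < n%:R :> R)%R by rewrite ltr0n.
have -> : (rad / n%:R = x0 ^+ 2 * dl ^+ 2 / 16)%R.
  by rewrite /rad; field; rewrite gt_eqF.
have : (0 <= x0 ^+ 2 * dl ^+ 2)%R by rewrite mulr_ge0 ?sqr_ge0.
move: (x0 ^+ 2 * dl ^+ 2)%R => a a0.
by nra.
Qed.

End risk.
End code_risk.

(** * Choice of the code and of the parameters *)

Section code_choice.
Variable R : realType.

(** The constant of the bound on the second moment of the diagonal of the hat
    matrix. *)
Definition moment_const (x0 : R) : R := 3 + 64 * Num.sqrt 2 * x0 ^+ 4.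

Lemma moment_const_gt0 x0 : 0 < moment_const x0.
Proof.
by rewrite ltr_wpDr// mulr_ge0 ?exprn_even_ge0// mulr_ge0 ?sqrtr_ge0.
Qed.

Definition dominant (m n : nat) (sigma : R) : R :=
  Num.max (sigma ^+ 4) (Num.max (m%:R ^+ 2) (n%:R ^+ 2)).

(** Both averages are taken at once: the one over the signs leaves the squares of
    the diagonal of the hat matrix, the one over A bounds them. *)
Lemma sum_mean_trace (m n : nat) (x0 dl sigma : R) : (0 < m)%N ->
  (\sum_v mean_trace R m n.+1 x0 dl sigma v <=
   ((2 ^ n.+1)%:R * (dl ^+ 2 * (n.+1%:R *
     (moment_const x0 * m%:R ^+ 2 / dominant m n.+1 sigma))))%:E)%E.
Proof.
move=> m0.
have mH i : measurable_fun setT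
    (fun A => (hat_mx R m n.+1 x0 sigma A i i ^+ 2)%:E : \bar R).
  apply/measurable_EFinP; apply: measurable_funX.
  exact: (measurableT_comp (measurable_mx_coord _ _ _ _ i i) (measurable_hat_mx _ _ _ _ _)).
have H0 i A : (0 <= (hat_mx R m n.+1 x0 sigma A i i ^+ 2)%:E :> \bar R)%E.
  by rewrite lee_fin sqr_ge0.
have c0 : (0 <= ((2 ^ n.+1)%:R * dl ^+ 2)%:E :> \bar R)%E.
  by rewrite lee_fin mulr_ge0 ?sqr_ge0.
rewrite /mean_trace -ge0_integral_sum//; last 2 first.
- by move=> v; apply/measurable_EFinP; exact: measurable_cov_trace.
- by move=> v A _; rewrite lee_fin cov_shift_trace_ge0.
have -> : (\int[gaussian R m n.+1]_A \sum_(v : {ffun 'I_n.+1 -> bool})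
    (\tr (cov_shift R m n.+1 x0 sigma A (sign_pert R n.+1 dl v) *m
          cov_shift R m n.+1 x0 sigma A (sign_pert R n.+1 dl v)))%:E =
    \int[gaussian R m n.+1]_A (((2 ^ n.+1)%:R * dl ^+ 2)%:E *
      \sum_i (hat_mx R m n.+1 x0 sigma A i i ^+ 2)%:E))%E.
  by apply: eq_integral => A _; rewrite !sumEFin sum_cov_shift_trace EFinM.
rewrite ge0_integralZl//; last 2 first.
- exact: emeasurable_sum.
- by move=> A _; exact: sume_ge0.
rewrite mulrA [leRHS]EFinM lee_wpmul2l// ge0_integral_sum//.
apply: (@le_trans _ _ (\sum_(i < n.+1)
    (moment_const x0 * m%:R ^+ 2 / dominant m n.+1 sigma)%:E)%E).
  by apply: lee_sum => i _; exact: hat_diag_moment.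
by rewrite sumEFin sumr_const card_ord mulr_natl.
Qed.

(** At least half of the sign vectors have a perturbation of at most twice the
    average size (Markov), and the greedy code is taken among them. *)
Lemma good_code (n N : nat) (T : {ffun 'I_n -> bool} -> \bar R) (e : R) :
  0 < e -> (forall v, 0 <= T v)%E -> (\sum_v T v <= ((2 ^ n)%:R * e)%:E)%E ->
  (2 * N * 3 ^ n <= 2 ^ n * 2 ^ (n - n %/ 4))%N ->
  exists D : {set {ffun 'I_n -> bool}}, [/\ #|D| = N,
    forall v, v \in D -> (T v <= (2 * e)%:E)%E &
    forall u v, u \in D -> v \in D -> u != v -> (n < 4 * hamming n u v)%N].
Proof.
move=> e0 T0 Te NV.
pose S := [set v | (T v <= (2 * e)%:E)%E]%SET.
have S2 : (2 ^ n <= 2 * #|S|)%N.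
  have bad : (#|~: S|%SET * 2 <= 2 ^ n)%N.
    rewrite -(ler_nat R) natrM -(ler_pM2r e0) -mulrA -lee_fin.
    apply: le_trans Te; rewrite mulr_natl -sumr_const -sumEFin.
    rewrite [leRHS](bigID (mem (~: S)%SET)) /=.
    apply: (@le_trans _ _ (\sum_(v in (~: S)%SET) T v)%E).
      by apply: lee_sum => v; rewrite !inE -ltNge => /ltW.
    by rewrite leeDl// sume_ge0.
  have := cardsC S; rewrite card_ffun card_bool card_ord => SC.
  by rewrite -(leq_add2r (#|~: S|%SET * 2)) (mulnC 2) -mulnDl SC (muln2 (2 ^ n)) -addnn leq_add2l.
pose r := (n %/ 4)%N; pose V := (3 ^ n %/ 2 ^ (n - r))%N.
have [||D [DS DN Df]] := @greedy_code n S r V N.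
- by move=> u; rewrite leq_divRL ?expn_gt0// hamming_ball// leq_div.
- have h : (2 * (N * V) * 2 ^ (n - r) <= 2 ^ n * 2 ^ (n - r))%N.
    apply: leq_trans NV; rewrite mulnA -mulnA leq_mul2l leq_trunc_div orbT//.
  move: h; rewrite leq_pmul2r ?expn_gt0// => h.
  by rewrite -(@leq_pmul2l 2)//; apply: leq_trans h S2.
exists D; split=> //.
- by move=> v /(fintype.subsetP DS); rewrite inE.
- move=> u v uD vD uv; have := Df u v uD vD uv; rewrite /r => h.
  apply: (@leq_trans (4 * (n %/ 4).+1)); last by rewrite leq_mul2l h orbT.
  by rewrite mulnC; exact: ltn_ceil.
Qed.

(** The size t ^ k of the code, for t the integer part of sqrt n: it is at most
    n ^ (k / 2), large enough for log (t ^ k / 16) >= (k log n) / 8, and small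
    enough for the greedy construction because k log n is o(n). *)
Lemma code_size (eps : R) (n k : nat) : 0 < eps -> (2 ^ 17 <= n)%N ->
  10 / eps <= n%:R `^ eps -> (0 < k)%N -> k%:R <= n%:R `^ (1 - 2 * eps) ->
  exists N : nat, [/\ (0 < N)%N, N%:R <= Num.sqrt (n%:R : R) ^+ k,
    k%:R * ln (n%:R : R) / 8 <= ln (N%:R / 16) &
    (2 * N * 3 ^ n <= 2 ^ n * 2 ^ (n - n %/ 4))%N].
Proof.
move=> eps0 n17 neps k0 kn.
have n0 : (0 < n)%N by apply: leq_trans n17.
have n_ge : (2 ^+ 17 <= n%:R :> R) by rewrite -natrX ler_nat.
have nR0 : 0 < n%:R :> R by rewrite ltr0n.
have n1 : 1 <= n%:R :> R by rewrite ler1n.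
pose q : R := Num.sqrt n%:R.
have q2 : q ^+ 2 = n%:R by rewrite sqr_sqrtr.
have q300 : 300 <= q.
  by rewrite -(@ler_pXn2r _ 2) ?nnegrE ?sqrtr_ge0// q2; apply: le_trans n_ge; lra.
pose t := Num.truncn q.
have /andP[tq qt] : t%:R <= q < t.+1%:R by apply: truncn_itv; exact: sqrtr_ge0.
have tq1 : q / 2 <= t%:R by move: qt; rewrite -natr1; lra.
have t256 : 256 <= t%:R :> R by move: qt; rewrite -natr1; lra.
have t0 : 0 < t%:R :> R by apply: (lt_le_trans _ t256); rewrite ltr0n.
have lnn0 : 0 <= ln (n%:R : R) by rewrite ln_ge0.
have lnt_le : ln (t%:R : R) <= ln (n%:R : R) / 2.
  have : ln ((t%:R : R) ^+ 2) <= ln (n%:R : R).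
    by rewrite ler_ln ?posrE ?exprn_gt0// -q2 ler_pXn2r ?nnegrE ?sqrtr_ge0 ?ler0n.
  by rewrite lnXn// -mulr_natr; lra.
have lnt_ge : ln (n%:R : R) / 4 <= ln (t%:R : R).
  have : ln (n%:R : R) <= ln ((t%:R : R) ^+ 4).
    rewrite ler_ln ?posrE ?exprn_gt0//.
    have h1 : (q / 2) ^+ 2 <= t%:R ^+ 2 :> R.
      by rewrite ler_pXn2r ?nnegrE ?divr_ge0 ?sqrtr_ge0// ltW.
    have h2 : n%:R / 4 <= t%:R ^+ 2 :> R by apply: le_trans h1; rewrite expr_div_n q2; lra.
    have -> : (t%:R ^+ 4 = (t%:R ^+ 2) ^+ 2 :> R) by rewrite -exprM.
    by move: h2 n_ge; move: (t%:R ^+ 2) (n%:R) => a b h2 h3; nra.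
  by rewrite lnXn// -mulr_natr; lra.
have k1 : 1 <= k%:R :> R by rewrite ler1n.
have NR : (t ^ k)%:R = t%:R ^+ k :> R by rewrite natrX.
have N256 : 256 <= (t ^ k)%:R :> R.
  rewrite NR; apply: (le_trans t256); rewrite -[leLHS]expr1 ler_weXn2l//.
  by apply: le_trans t256; lra.
have N0 : 0 < (t ^ k)%:R :> R by apply: (lt_le_trans _ N256); rewrite ltr0n.
have lnN : ln ((t ^ k)%:R : R) = k%:R * ln t%:R by rewrite NR lnXn// mulr_natl.
exists (t ^ k)%N; split.
- by rewrite -(ltr0n R).
- by rewrite NR lerXn2r// nnegrE ?sqrtr_ge0// ltW.
- have : ln ((t ^ k)%:R : R) <= ln (((t ^ k)%:R / 16) ^+ 2).
    rewrite ler_ln ?posrE ?exprn_gt0 ?divr_gt0//.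
    by move: N256; move: ((t ^ k)%:R : R)%R => y; nra.
  rewrite lnXn ?divr_gt0// lnN -mulr_natr => h.
  by have := ler_wpM2l (ler0n R k) lnt_ge; lra.
- have tn0 : (0 < t)%N by rewrite -(ltr0n R).
  rewrite -(ler_nat R) -ler_ln ?posrE ?ltr0n ?muln_gt0 ?expn_gt0 ?tn0//.
  rewrite !natrM !lnM ?posrE ?mulr_gt0 ?ltr0n ?expn_gt0 ?tn0//.
  rewrite lnN !natrX !lnXn// -!(mulr_natr (ln _)) natrB ?leq_div//.
  have d4 : (n %/ 4)%N%:R <= n%:R / 4 :> R.
    by rewrite ler_pdivlMr// -natrM ler_nat leq_trunc_div.
  have ln2_0 : 0 < ln (2 : R) by rewrite ln_gt0// ltr1n.
  have ln2_1 : ln (2 : R) <= 1.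
    by rewrite (_ : 2 = 1 + 1 :> R); [apply: le_ln1Dx; lra|lra].
  (* The greedy code exists because 2 ^ (7/4) > 3. *)
  have gap : 47 / 128 <= 7 * ln (2 : R) - 4 * ln (3 : R).
    have h : 47 / 128 <= ln (128 / 81 : R).
      rewrite (_ : 128 / 81 = (1 + - (47 / 128))^-1 :> R); last by field.
      by rewrite lnV ?posrE; [rewrite lerNr; apply: le_ln1Dx; lra|lra].
    have <- : ln (128 / 81 : R) = 7 * ln (2 : R) - 4 * ln (3 : R).
      rewrite !mulr_natl -!lnXn// -ln_div ?posrE ?exprn_gt0//.
      by congr (ln _); field.
    by [].
  have klnn : k%:R * ln (n%:R : R) <= n%:R / 10.
    have e1 : eps * ln (n%:R : R) <= n%:R `^ eps.
      by rewrite -ln_powR ltW// ln_sublinear// powR_gt0.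
    have y0 : 0 < n%:R `^ eps :> R by exact: powR_gt0.
    have kn' : k%:R * (n%:R `^ eps * n%:R `^ eps) <= n%:R :> R.
      apply: (le_trans (ler_wpM2r _ kn)); first by rewrite mulr_ge0// ltW.
      rewrite -!powRD ?(gt_eqF nR0) ?implybT//.
      rewrite (_ : 1 - _ + _ = 1); last by ring.
      by rewrite powRr1.
    rewrite ler_pdivlMr// -(ler_pM2r eps0).
    have e2 : 10 <= n%:R `^ eps * eps by rewrite -ler_pdivrMr.
    move: kn' e1 e2 y0 lnn0; move: (n%:R `^ eps) (ln n%:R) => y l kn' e1 e2 y0 l0.
    apply: (@le_trans _ _ (k%:R * (eps * l * (y * eps)))); last first.
      rewrite (_ : k%:R * (eps * l * (y * eps)) = k%:R * y * (eps * l) * eps); last by ring.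
      rewrite ler_pM2r//; apply: le_trans kn'; rewrite [leRHS]mulrA ler_wpM2l// mulr_ge0 ?ler0n ?(ltW y0)//.
    rewrite (_ : k%:R * l * 10 * eps = k%:R * (eps * l * 10)); last by ring.
    by rewrite ler_wpM2l// ler_wpM2l// mulr_ge0// ltW.
  have h1 := ler_wpM2l (ler0n R k) lnt_le.
  have h2 : 0 <= (n%:R / 4 - (n %/ 4)%:R) * ln (2 : R) by rewrite mulr_ge0 ?subr_ge0// ltW.
  have h3 := ler_wpM2l (ler0n R n) gap.
  nra.
Qed.

End code_choice.

(** * The minimax lower bound *)

Section nonasymptotic.
Variable R : realType.

Lemma sign_signal_box n (xmin xmax x0 rho dl : R) (v : {ffun 'I_n -> bool}) j :
  0 < xmin -> 0 < xmax -> 0 <= x0 -> 0 <= dl <= rho -> rho <= 1 ->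
  x0 ^+ 2 * (1 - rho) = xmin ^+ 2 -> x0 ^+ 2 * (1 + rho) = xmax ^+ 2 ->
  xmin <= sign_signal R n x0 dl v 0 j <= xmax.
Proof.
move=> xmin0 xmax0 x00 /andP[dl0 dlr] rho1 rmin rmax.
have s2 : -1 <= sgn R (v j) <= 1 by rewrite /sgn; case: (v j); rewrite ?expr0 ?expr1; lra.
have x2 : 0 <= x0 ^+ 2 by exact: sqr_ge0.
have d1 : 1 - rho <= 1 + dl * sgn R (v j) <= 1 + rho.
  by move: s2; move: (sgn _ _) => s /andP[? ?]; apply/andP; split; nra.
have d0 : 0 <= 1 + dl * sgn R (v j) by lra.
rewrite !mxE; apply/andP; split.
  rewrite -(@ler_pXn2r _ 2) ?nnegrE ?mulr_ge0 ?sqrtr_ge0 ?(ltW xmin0)//.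
  by rewrite exprMn sqr_sqrtr// -rmin ler_wpM2l//; lra.
rewrite -(@ler_pXn2r _ 2) ?nnegrE ?mulr_ge0 ?sqrtr_ge0 ?(ltW xmax0)//.
by rewrite exprMn sqr_sqrtr// -rmax ler_wpM2l//; lra.
Qed.

Lemma minimax_risk_lower (m n L : nat) (x0 dl sigma s : R) (D : {set {ffun 'I_n -> bool}})
    d (T : measurableType d) (P : probability T R) (A : T -> 'M[R]_(m, n))
    (w : 'I_L -> T -> 'cV[R]_n) (z : 'I_L -> T -> 'cV[R]_m) :
  (0 < n)%N -> 0 < dl -> dl <= 2^-1 -> 0 <= sigma -> gaussian_model P A w z sigma ->
  (0 < #|D|)%N -> 0 < s -> expR s <= #|D|%:R / 16 ->
  (forall u v, u \in D -> v \in D -> u != v -> (n < 4 * hamming n u v)%N) ->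
  (forall v, v \in D ->
     ((L%:R / s)%:E * mean_trace R m n x0 dl sigma v <= (4^-1)%:E)%E) ->
  ((x0 ^+ 2 * dl ^+ 2 / 32)%:E <=
   minimax_risk P A w z [set x | exists2 v, v \in D & x = sign_signal R n x0 dl v])%E.
Proof.
move=> n0 dl0 dl2 sigma0 model D0 s0 sD Dfar Dtr.
apply: le_ereal_inf_tmp => _ [xhat mxhat <-].
have [v vD h] := code_risk R m n L x0 dl sigma n0 dl0 dl2 sigma0 d T P A w z model
  xhat mxhat D s D0 s0 sD Dfar Dtr.
apply: (le_trans h); apply: ereal_sup_ubound.
by exists (sign_signal R n x0 dl v) => //; exists v.
Qed.

(** The squared size of the perturbation is c1 times the claimed rate, so that
    L times the trace of the squared covariance shift is on average at most
    c1 C k log n, with C the constant of the moment bound. For c1 small, this is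
    a small fraction of the logarithm of the size of the code. *)
Lemma class_risk_lower (m n L k : nat) (xmin xmax a b eps sigma x0 rho c1 : R) :
  0 < xmin -> xmin < xmax -> xmax - xmin <= a -> 1 <= b -> 0 < eps ->
  0 <= x0 -> rho <= 1 ->
  x0 ^+ 2 * (1 - rho) = xmin ^+ 2 -> x0 ^+ 2 * (1 + rho) = xmax ^+ 2 ->
  0 < c1 -> c1 <= 4^-1 -> c1 <= rho ^+ 2 -> c1 * (64 * moment_const R x0) <= 1 ->
  (0 < m)%N -> (0 < L)%N -> (0 < k)%N -> 0 <= sigma ->
  k%:R <= n%:R `^ (1 - 2 * eps) ->
  dominant R m n sigma * k%:R * ln n%:R <= m%:R ^+ 2 * n%:R `^ (1 - eps) * L%:R ->
  (2 ^ 17 <= n)%N -> 10 / eps <= n%:R `^ eps ->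
  forall (d : measure_display) (T : measurableType d) (P : probability T R)
    (A : T -> 'M[R]_(m, n)) (w : 'I_L -> T -> 'cV[R]_n) (z : 'I_L -> T -> 'cV[R]_m),
  gaussian_model P A w z sigma ->
  ((x0 ^+ 2 * c1 / 32 *
      (dominant R m n sigma * k%:R * ln n%:R / (m%:R ^+ 2 * n%:R * L%:R)))%:E <=
   ereal_sup [set minimax_risk P A w z C | C in signal_class xmin xmax a b k])%E.
Proof.
move=> xmin0 xx xa b1 eps0 x00 rho1 rmin rmax c10 c14 c1r c1C m0 L0 k0 sigma0 kn
  main n17 neps d T P A w z model.
have n0 : (0 < n)%N by apply: leq_trans n17.
have nR0 : 0 < n%:R :> R by rewrite ltr0n.
have LR0 : 0 < L%:R :> R by rewrite ltr0n.
have kR0 : 0 < k%:R :> R by rewrite ltr0n.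
have mR0 : 0 < m%:R ^+ 2 :> R by rewrite exprn_gt0// ltr0n.
have lnn0 : 0 < ln (n%:R : R) by rewrite ln_gt0// ltr1n (leq_trans _ n17).
have rho0 : 0 <= rho.
  have : xmin ^+ 2 < xmax ^+ 2 by rewrite ltr_pXn2r// nnegrE; lra.
  rewrite -rmin -rmax => h; rewrite leNgt; apply/negP => r0.
  by have := sqr_ge0 x0; nra.
have C0 := moment_const_gt0 R x0.
have Mx0 : 0 < dominant R m n sigma.
  by rewrite /dominant !lt_max [X in _ || (_ || X)]exprn_gt0 ?orbT.
set Mx := dominant R m n sigma in main Mx0 *.
pose Q := Mx * k%:R * ln n%:R / (m%:R ^+ 2 * n%:R * L%:R).
have num0 : 0 < Mx * k%:R * ln n%:R by rewrite mulr_gt0// mulr_gt0.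
have den0 : 0 < m%:R ^+ 2 * n%:R * L%:R :> R by rewrite mulr_gt0// mulr_gt0.
have Q0 : 0 < Q by exact: divr_gt0.
have Q1 : Q <= 1.
  rewrite ler_pdivrMr// mul1r; apply: (le_trans main).
  rewrite ler_pM2r// ler_pM2l// -[leRHS]powRr1 ?(ltW nR0)// ler_powR ?ler1n//.
  by lra.
pose dl := Num.sqrt (c1 * Q).
have dl2 : dl ^+ 2 = c1 * Q by rewrite sqr_sqrtr// mulr_ge0// ltW.
have dl0 : 0 < dl by rewrite sqrtr_gt0 mulr_gt0.
have dlc : dl ^+ 2 <= c1 by rewrite dl2 ler_piMr// ltW.
have dlrho : dl <= rho.
  by rewrite -(@ler_pXn2r _ 2) ?nnegrE ?(ltW dl0)//; apply: le_trans c1r.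
have dlhalf : dl <= 2^-1.
  by rewrite -(@ler_pXn2r _ 2) ?nnegrE ?(ltW dl0)//; apply: (le_trans dlc); lra.
(* The exponent s is the largest one for which the error term e ^ s / (2 t) of
   the change of measure, with t = N / 4, is at most 1 / 8. *)
have [N [N0 Nn sN NV]] := code_size R eps n k eps0 n17 neps k0 kn.
pose s := ln (N%:R / 16 : R).
have s0 : 0 < s by apply: (lt_le_trans _ sN); rewrite !mulr_gt0// invr_gt0.
pose e := dl ^+ 2 * (n%:R * (moment_const R x0 * m%:R ^+ 2 / Mx)).
have eE : e = c1 * moment_const R x0 * (k%:R * ln n%:R) / L%:R.
  rewrite /e dl2 /Q; field.
  by rewrite !gt_eqF// ltr0n.
have e0 : 0 < e by rewrite eE divr_gt0 ?mulr_gt0.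
have [||D [DN DT Dfar]] :=
    @good_code R n N (mean_trace R m n x0 dl sigma) e e0 _ _ NV.
- move=> v; apply: integral_ge0 => B _; rewrite lee_fin.
  exact: cov_shift_trace_ge0.
- rewrite /e /Mx; case: (n) n0 => // n' _; exact: sum_mean_trace.
apply: (@le_trans _ _ (minimax_risk P A w z
    [set x | exists2 v, v \in D & x = sign_signal R n x0 dl v])); last first.
  apply: ereal_sup_ubound.
  exists [set x | exists2 v, v \in D & x = sign_signal R n x0 dl v] => //.
  apply: finite_signal_class => //.
  - by rewrite DN.
  - move=> v j; apply: (sign_signal_box _ _ _ _ rho) => //; first by lra.
    by rewrite (ltW dl0).
  - by rewrite DN.
rewrite (_ : x0 ^+ 2 * c1 / 32 * _ = x0 ^+ 2 * dl ^+ 2 / 32); last first.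
  by rewrite dl2 /Q; ring.
apply: (minimax_risk_lower _ _ _ _ _ sigma s) => //.
- by rewrite DN.
- by rewrite DN lnK// posrE divr_gt0 ?ltr0n.
move=> v vD; apply: (@le_trans _ _ ((L%:R / s)%:E * (2 * e)%:E)%E).
  by rewrite lee_wpmul2l ?DT// lee_fin divr_ge0 ?ltW.
rewrite -EFinM lee_fin eE.
rewrite (_ : L%:R / s * _ = 2 * (c1 * moment_const R x0) * (k%:R * ln n%:R) / s); last first.
  by field; rewrite !gt_eqF.
rewrite ler_pdivrMr//.
move: c1C; rewrite mulrCA; have := mulr_gt0 c10 C0; move: (c1 * _) => y y0 y64.
move: sN; rewrite -/s; have := mulr_gt0 kR0 lnn0; move: (k%:R * _) => l l0.
by nra.
Qed.

End nonasymptotic.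

Theorem theorem2p15 (R : realType) (xmin xmax eps : R)
    (hxmin : 0 < xmin) (hxmax : xmin < xmax) (heps : 0 < eps < 2^-1) :
  exists2 c : R, 0 < c &
  forall (a b : R), xmax - xmin <= a -> 1 <= b ->
  forall (m L k : nat -> nat) (sigma : nat -> R),
    (forall n, (0 < n)%N ->
       [/\ (0 < m n)%N, (0 < L n)%N, (0 < k n)%N & 0 <= sigma n]) ->
    (fun n : nat => ln (m n)%:R : R^o) =Theta_\oo
      (fun n : nat => ln n%:R : R^o) ->
    (fun n : nat => ln (L n)%:R : R^o) =O_\oo
      (fun n : nat => ln n%:R : R^o) ->
    (forall n, (0 < n)%N -> (k n)%:R <= n%:R `^ (1 - 2 * eps)) ->
    (forall n, (0 < n)%N ->
       Num.max (sigma n ^+ 4) (Num.max ((m n)%:R ^+ 2) (n%:R ^+ 2))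
         * (k n)%:R * ln n%:R
       <= (m n)%:R ^+ 2 * n%:R `^ (1 - eps) * (L n)%:R) ->
  \forall n \near \oo,
    forall (d : measure_display) (T : measurableType d) (P : probability T R)
      (A : T -> 'M[R]_(m n, n)) (w : 'I_(L n) -> T -> 'cV[R]_n)
      (z : 'I_(L n) -> T -> 'cV[R]_(m n)),
    gaussian_model P A w z (sigma n) ->
    ((c * (Num.max (sigma n ^+ 4) (Num.max ((m n)%:R ^+ 2) (n%:R ^+ 2))
             * (k n)%:R * ln n%:R
           / ((m n)%:R ^+ 2 * n%:R * (L n)%:R)))%:E
     <= ereal_sup [set minimax_risk P A w z C
                  | C in signal_class xmin xmax a b (k n)])%E.
Proof.
have /andP[eps0 epsh] := heps.
have xmax0 : 0 < xmax by apply: lt_trans hxmax.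
(* The square of the constant signal is the middle of [xmin ^ 2, xmax ^ 2], so
   that both signs of the perturbation stay in the box when dl <= rho. *)
pose S := (xmin ^+ 2 + xmax ^+ 2) / 2.
have S0 : 0 < S by rewrite divr_gt0// addr_gt0 ?exprn_gt0.
pose x0 := Num.sqrt S.
have x02 : x0 ^+ 2 = S by rewrite sqr_sqrtr ?ltW.
have x00 : 0 < x0 by rewrite sqrtr_gt0.
pose rho := (xmax ^+ 2 - xmin ^+ 2) / (2 * S).
have x2 : xmin ^+ 2 < xmax ^+ 2 by rewrite ltr_pXn2r// nnegrE ltW.
have rho0 : 0 < rho by apply: divr_gt0; [rewrite subr_gt0|rewrite mulr_gt0].
have rho1 : rho <= 1.
  by rewrite ler_pdivrMr ?mulr_gt0// /S; have := sqr_ge0 xmin; lra.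
have Srho : S * rho = (xmax ^+ 2 - xmin ^+ 2) / 2.
  by rewrite /rho; field; rewrite gt_eqF.
have rmin : x0 ^+ 2 * (1 - rho) = xmin ^+ 2.
  by rewrite x02 mulrBr mulr1 Srho /S; field.
have rmax : x0 ^+ 2 * (1 + rho) = xmax ^+ 2.
  by rewrite x02 mulrDr mulr1 Srho /S; field.
have C0 := moment_const_gt0 R x0.
pose c1 := Num.min 4^-1 (Num.min (rho ^+ 2) (64 * moment_const R x0)^-1).
have c10 : 0 < c1 by rewrite !lt_min !invr_gt0 exprn_gt0//= ltr0n /= mulr_gt0.
exists (x0 ^+ 2 * c1 / 32); first by rewrite divr_gt0// mulr_gt0// exprn_gt0.
move=> a b xa b1 m L k sigma pos _ _ kn main.
near=> n.
have n0 : (0 < n)%N by near: n; exact: nbhs_infty_gt.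
have [m0 L0 k0 sigma0] := pos n n0.
apply: (@class_risk_lower R (m n) n (L n) (k n) xmin xmax a b eps (sigma n) x0 rho c1) => //.
- exact: ltW.
- by rewrite ge_min lexx.
- by rewrite !ge_min lexx !orbT.
- by rewrite -ler_pdivlMr ?mulr_gt0// mul1r !ge_min lexx !orbT.
- exact: kn.
- exact: main.
- by near: n; exact: nbhs_infty_ge.
have e10 : 0 <= 10 / eps by rewrite divr_ge0// ltW.
rewrite (_ : 10 / eps = (10 / eps) `^ eps^-1 `^ eps); last first.
  by rewrite -powRrM mulVf ?gt_eqF// powRr1.
apply: ge0_ler_powR; rewrite ?nnegrE ?powR_ge0 ?(ltW eps0)//.
by near: n; exact: nbhs_infty_ger.
Unshelve. all: by end_near.
Qed.
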